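(* Let $\mathbf{L}\subset(\mathbb{C}^* )^n$ be a real linear subvariety of dimension $d$, with tropicalization $L$ and real phase structure $\mathcal{E}=\mathcal{E}_{\mathbf{L}}$. Assume $\mathfrak{R}_{>}L\ne\emptyset$. Let $\Sigma$ be a complete unimodular fan in $\mathbb{R}^n$ such that $L$ is a union of cones of $\Sigma$. Then the pair $\mathfrak{R}_{\ge}L\subset\mathbb{T}\Sigma$, where $\mathfrak{R}_{\ge}L$ is the closure of $\mathfrak{R}_{>}L$ in $\mathbb{T}\Sigma$, is a standard pair of cells of dimension $(d,n)$.
   Context: Linear subvarieties. $\mathbf{L}$ is linear if its closure in $\mathbb{C}\mathbb{P}^n\supset(\mathbb{C}^* )^n$ is a linear subspace, and real if it is conjugation-invariant. Tropicalization and phases. $L=\mathrm{Trop}(\mathbf{L})\subset\mathbb{R}^n$ is its tropicalization (the support of a projective matroid fan). For cones $\sigma$ of a fan structure on $L$, $\mathrm{in}_\sigma\mathbf{L}$ denotes the initial scheme at relative interior points. $\mathcal{E}(\sigma)=\{\varepsilon\in(\mathbb{Z}/2)^n:(-1)^\varepsilon\cdot\mathbb{R}\,\mathrm{in}_\sigma\mathbf{L}\cap\mathbb{R}^n_{>0}\ne\emptyset\}$ on maximal cones. $\mathfrak{R}_{>}L\subset\mathbb{R}^n$ is the union of the maximal cones $\sigma$ with $0\in\mathcal{E}(\sigma)$, i.e. the part of the patchwork in the positive copy of $\mathbb{R}^n$. Ambient tropical space. $\mathbb{T}\Sigma$ is the tropical toric variety of $\Sigma$ over $\mathbb{T}=\mathbb{R}\cup\{-\infty\}$: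 the direct limit over $\rho\in\Sigma$ of the semigroup homomorphisms $\rho^\vee\cap(\mathbb{Z}^n)^\vee\to(\mathbb{T},+)$. It contains $\mathbb{R}^n$ as dense open orbit. Standard pairs. A pair $\tau\subset\sigma$ is a standard pair of cells of dimension $(d,n)$ if some homeomorphism $\alpha:D^n\to\sigma$ has $\alpha^{-1}(\tau)=\{x\in D^n:x_1=\dots=x_{n-d}=0\}$. *)

(* Defs.v *)
From HB Require Import structures.
From mathcomp Require Import all_boot all_order all_algebra.
From mathcomp Require Import all_classical all_reals all_analysis.
From mathcomp Require Import complex.
From mathcomp Require mpoly.
From Stdlib Require Import Relations.
Set Implicit Arguments. Unset Strict Implicit. Unset Printing Implicit Defensive.
Import Order.TTheory GRing.Theory Num.Theory.
Import numFieldNormedType.Exports.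
Local Open Scope ring_scope.
Local Open Scope classical_set_scope.

Section Defs.
Variables (R : realType) (n : nat).
Local Notation C := (complex R).

(* A linear subvariety of the torus of dimension d is the intersection of a
   d-dimensional affine subspace  p + rowspace(B)  of C^n with the torus
   (its closure in CP^n is the projective closure of this affine space). *)
Definition Lset (d : nat) (p : 'rV[C]_n) (B : 'M[C]_(d, n)) : set 'rV[C]_n :=
  [set z | (forall i, z 0 i != 0) /\ exists y : 'rV[C]_d, z = p + y *m B].

Definition is_real_subvariety (S : set 'rV[C]_n) : Prop :=
  forall z, S z -> S (map_mx (@conjc R) z).

Definition vanishing_ideal (S : set 'rV[C]_n) : set (mpoly.mpoly n C) :=
  [set f | forall z, S z -> mpoly.meval (fun i => z 0 i) f = 0].

Definition mweight (w : 'rV[R]_n) (m : mpoly.multinom n) : R :=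
  \sum_(i < n) w 0 i * (mpoly.fun_of_multinom m i)%:R.

Definition initial_eval (w : 'rV[R]_n) (f : mpoly.mpoly n C) (z : 'rV[C]_n) : C :=
  \sum_(m <- mpoly.msupp f | all (fun m' => mweight w m <= mweight w m')
                                 (mpoly.msupp f))
     mpoly.mcoeff m f * \prod_(i < n) z 0 i ^+ mpoly.fun_of_multinom m i.

Definition initial_pt (S : set 'rV[C]_n) (w : 'rV[R]_n) (z : 'rV[C]_n) : Prop :=
  (forall i, z 0 i != 0) /\
  forall f, vanishing_ideal S f -> initial_eval w f z = 0.

Definition Trop (S : set 'rV[C]_n) : set 'rV[R]_n :=
  [set w | exists z, initial_pt S w z].

Definition initial_has_pos_real_pt (S : set 'rV[C]_n) (w : 'rV[R]_n) : Prop :=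
  exists x : 'rV[R]_n, (forall i, 0 < x 0 i) /\
     initial_pt S w (map_mx (real_complex R) x).

Variables (k : nat) (V : 'I_k -> 'rV[int]_n) (K : {set {set 'I_k}}).

Definition rayR (i : 'I_k) : 'rV[R]_n := map_mx (fun z : int => z%:~R) (V i).

Definition cone (S : {set 'I_k}) : set 'rV[R]_n :=
  [set w | exists a : 'I_k -> R, (forall i, 0 <= a i) /\
     (forall i, i \notin S -> a i = 0) /\ w = \sum_(i < k) a i *: rayR i].

Definition relint_cone (S : {set 'I_k}) : set 'rV[R]_n :=
  [set w | exists a : 'I_k -> R, (forall i, i \in S -> 0 < a i) /\
     (forall i, i \notin S -> a i = 0) /\ w = \sum_(i < k) a i *: rayR i].

Definition unimodular_cone (S : {set 'I_k}) : Prop :=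
  exists (P : 'M[int]_n) (g : 'I_k -> 'I_n),
    P \in unitmx /\ {in S &, injective g} /\ forall i, i \in S -> row (g i) P = V i.

Definition complete_unimodular_fan : Prop :=
  (forall S, S \in K -> unimodular_cone S) /\
  (forall S T : {set 'I_k}, S \in K -> T \subset S -> T \in K) /\
  (forall S T : {set 'I_k}, S \in K -> T \in K -> cone S `&` cone T = cone (S :&: T)) /\
  (forall w, exists2 S, S \in K & cone S w).

(* union of the d-dimensional (= maximal) cones σ of Σ contained in Trop L
   with 0 ∈ E(σ) *)
Definition Rpos (S0 : set 'rV[C]_n) (d : nat) : set 'rV[R]_n :=
  [set w | exists2 S, S \in K &
     [/\ #|S| = d, cone S `<=` Trop S0,
         (forall w', relint_cone S w' -> initial_has_pos_real_pt S0 w') &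
         cone S w]].

Definition zpair (m v : 'rV[int]_n) : int := \sum_(j < n) m 0 j * v 0 j.

Definition in_dual (S : {set 'I_k}) (m : 'rV[int]_n) : Prop :=
  forall i, i \in S -> (0 <= zpair m (V i))%R.

(* a chart point: a cone S of Σ and a monoid morphism S^∨ ∩ M -> (T,+),
   T = R ∪ {-oo}, extended by +oo outside S^∨ (canonical representative) *)
Definition TSpt := ({set 'I_k} * ('rV[int]_n -> \bar R))%type.

Definition TSvalid (a : TSpt) : Prop :=
  [/\ a.1 \in K, a.2 0 = 0%E,
      (forall m, in_dual a.1 m -> a.2 m != +oo%E),
      (forall m m', in_dual a.1 m -> in_dual a.1 m' -> a.2 (m + m') = (a.2 m + a.2 m')%E) &
      (forall m, ~ in_dual a.1 m -> a.2 m = +oo%E)].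

(* transition maps of the direct system: for a face T ⊆ S, restriction
   Hom(T^∨ ∩ M, T) -> Hom(S^∨ ∩ M, T) *)
Definition TSstep (a b : TSpt) : Prop :=
  TSvalid a /\ TSvalid b /\ a.1 \subset b.1 /\
  forall m, in_dual b.1 m -> b.2 m = a.2 m.

Definition TSequiv : relation TSpt := clos_refl_sym_trans TSpt TSstep.

Definition TSsaturated (W : set TSpt) : Prop :=
  (forall a, W a -> TSvalid a) /\
  (forall a b, TSequiv a b -> TSvalid b -> W a -> W b).

(* open subsets of the chart Hom(S^∨ ∩ M, T), product (pointwise) topology *)
Definition chart_open (S : {set 'I_k}) (U : set ('rV[int]_n -> \bar R)) : Prop :=
  forall phi0, TSvalid (S, phi0) -> U phi0 ->
    exists (ms : seq 'rV[int]_n) (N : 'rV[int]_n -> set (\bar R)),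
      (forall m, m \in ms -> nbhs (phi0 m) (N m)) /\
      (forall phi, TSvalid (S, phi) -> (forall m, m \in ms -> N m (phi m)) -> U phi).

(* final (direct limit) topology on T Σ, on saturated sets of chart points *)
Definition TSopen (W : set TSpt) : Prop :=
  TSsaturated W /\ forall S, S \in K -> chart_open S (fun phi => W (S, phi)).

Definition TSclosed (F : set TSpt) : Prop :=
  TSsaturated F /\ TSopen (fun a => TSvalid a /\ ~ F a).

Definition TSclosure (A : set TSpt) : set TSpt :=
  fun a => TSvalid a /\ forall F, TSclosed F -> (forall b, A b -> F b) -> F a.

(* the dense orbit R^n ⊂ T Σ, oriented so that x + t v (v ∈ σ, t -> +oo)
   converges in the orbit of σ *)
Definition Rpair (m : 'rV[int]_n) (w : 'rV[R]_n) : R :=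
  \sum_(j < n) (m 0 j)%:~R * w 0 j.

Definition TSembed (w : 'rV[R]_n) : TSpt := (finset.set0, fun m => (- Rpair m w)%:E).

Definition disk : set 'rV[R]_n := [set x | \sum_(i < n) x 0 i ^+ 2 <= 1].

Definition disk_open (U : set 'rV[R]_n) : Prop :=
  exists O : set 'rV[R]_n, open O /\ U = O `&` disk.

Definition standard_pair_TS (A : set TSpt) (d : nat) : Prop :=
  exists alpha : 'rV[R]_n -> TSpt,
    (forall x, disk x -> TSvalid (alpha x)) /\
    (forall x y, disk x -> disk y -> TSequiv (alpha x) (alpha y) -> x = y) /\
    (forall a, TSvalid a -> exists x, disk x /\ TSequiv a (alpha x)) /\
    (forall W, TSopen W -> disk_open [set x | disk x /\ W (alpha x)]) /\
    (forall U, disk_open U ->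
        TSopen (fun a => TSvalid a /\ exists x, U x /\ TSequiv a (alpha x))) /\
    [set x | disk x /\ A (alpha x)] =
      [set x | disk x /\ forall i : 'I_n, (i < n - d)%N -> x 0 i = 0].

End Defs.

(* Main.v *)
(* A positive tropical point w satisfies, for every real affine relation c on L, that the
   minimum of w over the positive coefficients of c equals the minimum over the negative ones;
   by Gordan's alternative these conditions suffice, level by level, to lift w to a curve of
   positive points of L. Let W be the direction of L. If w and w' are positive tropical points
   and w - w' is orthogonal to W, then w - w' is itself the linear part of an affine relation,
   and comparing minima forces w = w'. Conversely Birch's theorem provides, in each coset of
   the orthogonal of W, the logarithm of a positive point of L, and rescaled limits show that
   each coset meets the positive tropicalization. Hence the latter is the graph of a
   continuous, positively homogeneous map over a d-dimensional linear space; a shear of R^n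
   straightens it. Genericity and a clopen argument along segments identify it with the union
   of d-dimensional cones in the statement.

   The variety T Sigma is a cubical complex: its points are the a in [0, +oo]^k with support
   in K. Substituting b = a / (1 + a) turns it into the star-shaped set of points of R^n with
   fan coordinates at most 1, on which radial rescaling is compatible with the shear because
   both preserve the cones over 0. *)

Require Import Defs.
From HB Require Import structures.
From mathcomp Require Import all_boot all_order all_algebra.
From mathcomp Require Import all_classical all_reals all_analysis.
From mathcomp Require Import complex.
From mathcomp Require mpoly.
From mathcomp Require Import perm ring lra zify.
From Stdlib Require Import Relations.
Set Implicit Arguments. Unset Strict Implicit. Unset Printing Implicit Defensive.
Import Order.TTheory GRing.Theory Num.Theory.
Import numFieldNormedType.Exports.
Local Open Scope ring_scope.
Local Open Scope classical_set_scope.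
Import (canonicals) mpoly.

(** * Normed spaces and Gordan's alternative *)

(** Weights are minus logarithms of coordinates, so minima are compared throughout and [TSembed]
    carries a minus sign. Purity of the tropicalization is nowhere assumed. Linear dependencies
    bound by [d] the number of rays of a cone inside it, while at a generic value of the projection
    to the dual of the direction the rays must have images spanning a space of dimension [d];
    together these produce the [d]-dimensional cones of [Rpos].

    The obstacle at the end is infinity. The shear is not asked to respect the cones of Sigma, so it
    is not extended to the boundary orbits of T Sigma. It acts instead on the bounded model, whose
    outer faces represent these orbits. This suffices because the positive part is a union of cones:
    membership of a point in the closure depends only on the support of its fan coordinates, and a
    positively homogeneous map together with a rescaling along rays controls supports up to the
    outer faces. *)

Lemma mx_norm_leP (R : realType) m n (x : 'M[R]_(m, n)) (e : R) : 0 <= e ->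
  (forall i j, `|x i j| <= e) -> `|x| <= e.
Proof.
move=> e0 h; rewrite [leLHS]/Num.Def.normr /= mx_normrE.
by apply/bigmax_leP; split => // i _; exact: h.
Qed.

Lemma mx_norm_entry (R : realType) m n (x : 'M[R]_(m, n)) i j : `|x i j| <= `|x|.
Proof.
rewrite [leRHS]/Num.Def.normr /= mx_normrE; apply/bigmax_geP; right => /=.
by exists (i, j).
Qed.

Lemma mulmx_norm_bound (R : realType) m n r (A : 'M[R]_(n, r)) :
  exists2 C, 0 < C & forall x : 'M[R]_(m, n), `|x *m A| <= C * `|x|.
Proof.
exists (n%:R * `|A| + 1); first by rewrite ltr_wpDl // mulr_ge0.
move=> x; apply: mx_norm_leP; first by rewrite mulr_ge0 // addr_ge0 // mulr_ge0.
move=> i j; rewrite mxE; apply: le_trans (ler_norm_sum _ _ _) _.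
rewrite mulrDl mul1r ler_wpDr //.
have -> : n%:R * `|A| * `|x| = \sum_(l < n) `|A| * `|x|.
  by rewrite sumr_const card_ord -mulrA mulr_natl.
apply: ler_sum => l _; rewrite normrM mulrC ler_pM //; exact: mx_norm_entry.
Qed.

Lemma nbhs_norm_ltP (R : realType) m n (x : 'M[R]_(m, n)) (P : set 'M[R]_(m, n)) :
  nbhs x P <-> exists2 e : R, 0 < e & forall y, `|y - x| < e -> P y.
Proof.
split.
  move=> /nbhs_normP [e /= e0 h]; exists e => // y hy; apply: h => /=.
  by rewrite /ball_ /= distrC.
move=> [e e0 h]; apply: (proj2 (nbhs_normP x P)); exists e => //= y.
by rewrite /ball_ /= distrC; exact: h.
Qed.

Lemma continuous_norm_ltP (R : realType) m n (V : normedModType R)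
    (f : 'M[R]_(m, n) -> V) (x : 'M[R]_(m, n)) :
  {for x, continuous f} <->
  forall e : R, 0 < e -> exists2 del : R, 0 < del &
    forall y, `|y - x| < del -> `|f y - f x| < e.
Proof.
have E := @cvgrPdistC_lt R V _ (nbhs x) (nbhs_filter x) f (f x).
split => [/E h e e0|h]; first exact: (proj1 (nbhs_norm_ltP _ _) (h e e0)).
by apply/E => e e0; apply: (proj2 (nbhs_norm_ltP x _)); exact: h.
Qed.

Lemma mulmx_continuous (R : realType) n r (A : 'M[R]_(n, r)) :
  continuous (fun x : 'rV[R]_n => x *m A).
Proof.
move=> x; have [C C0 hC] := mulmx_norm_bound 1 A.
apply/continuous_norm_ltP => e e0; exists (e / C); first by rewrite divr_gt0.
move=> y hy; rewrite -mulmxBl (le_lt_trans (hC _)) // -(divfK (lt0r_neq0 C0) e).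
by rewrite mulrC ltr_pM2r.
Qed.

(** Compactness as used below: terms of index beyond any [N] come arbitrarily close to [v], which
    spares the extraction of a subsequence. *)
Lemma bounded_cluster (R : realType) n (u : nat -> 'rV[R]_n) (M : R) :
  (forall k, `|u k| <= M) ->
  exists v, forall N (e : R), 0 < e -> exists2 k, (N <= k)%N & `|u k - v| < e.
Proof.
move=> hu.
have cK : compact [set x : 'rV[R]_n | `|x| <= M].
  apply: bounded_closed_compact.
    exists M; split; first by rewrite num_real.
    by move=> x Mx y /= /le_trans; apply; exact: ltW.
  apply: (@closed_comp _ _ (fun x : 'rV[R]_n => `|x|) [set y | y <= M]).
    by move=> x _; exact: norm_continuous.
  exact: closed_le.
have /(_ _) [] := cK (u @ \oo).
  by exists 0%N => // k _ /=; exact: hu.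
move=> v [_ hv]; exists v => N e e0.
have := hv (u @` [set k | (N <= k)%N]) [set y | `|y - v| < e].
case.
- by exists N => // k hk; exists k.
- by apply/nbhs_norm_ltP; exists e.
by move=> _ [[k hk <-] h]; exists k.
Qed.

Lemma continuous_min_on (R : realType) n (A : set 'rV[R]_n) (M : R) (f : 'rV[R]_n -> R) :
  A !=set0 -> closed A -> (forall x, A x -> `|x| <= M) -> continuous f ->
  exists2 x, A x & forall y, A y -> f x <= f y.
Proof.
move=> A0 cA bA cf.
have cK : compact A.
  apply: bounded_closed_compact => //.
  exists M; split; first by rewrite num_real.
  by move=> x Mx y /bA /le_trans; apply; exact: ltW.
have [x xA h] := EVT_min_rV A0 cK (continuous_subspaceT cf).
by exists x; [exact/set_mem|move=> y yA; apply: h; exact/mem_set].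
Qed.

Lemma continuous_sum (R : realType) (T : topologicalType) (I : Type) (s : seq I)
  (f : I -> T -> R) : (forall i, continuous (f i)) ->
  continuous (fun x => \sum_(i <- s) f i x).
Proof.
move=> h; apply: (@continuous_big R I +%R 0 xpredT) => //.
by move=> x; apply: cvgD; [exact: cvg_fst|exact: cvg_snd].
Qed.

Lemma cvg_sum_fin (R : realType) (T I : Type) (F : set_system T) (s : seq I)
  (f : I -> T -> R) (l : I -> R) : Filter F -> (forall i, f i x @[x --> F] --> l i) ->
  \sum_(i <- s) f i x @[x --> F] --> \sum_(i <- s) l i.
Proof.
move=> FF h; apply: (@cvg_big R I +%R 0 xpredT) => //.
by move=> x; apply: cvgD; [exact: cvg_fst|exact: cvg_snd].
Qed.

Lemma continuous_coord (R : realType) n (i : 'I_n) :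
  continuous (fun x : 'rV[R]_n => x 0 i).
Proof. by move=> x; exact: coord_continuous. Qed.

Lemma closed_forall (T : topologicalType) (I : Type) (P : I -> set T) :
  (forall i, closed (P i)) -> closed [set x | forall i, P i x].
Proof.
move=> h; rewrite (_ : [set _ | _] = \bigcap_i P i); first exact: closed_bigI.
by rewrite predeqE => x; split => [H i _|H i]; exact: H.
Qed.

Lemma closed_le_fun (R : realType) (T : topologicalType) (f g : T -> R) :
  continuous f -> continuous g -> closed [set x | f x <= g x].
Proof.
move=> cf cg; rewrite (_ : [set x | _] = (fun x => g x - f x) @^-1` [set y | 0 <= y]).
  apply: closed_comp; last exact: closed_ge.
  by move=> x _; apply: continuousB; [exact: cg|exact: cf].
by rewrite predeqE => x /=; rewrite subr_ge0.
Qed.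

Lemma closed_eq_fun (R : realType) (T : topologicalType) (f g : T -> R) :
  continuous f -> continuous g -> closed [set x | f x = g x].
Proof.
move=> cf cg; rewrite (_ : [set x | _] = [set x | f x <= g x] `&` [set x | g x <= f x]).
  by apply: closedI; exact: closed_le_fun.
rewrite predeqE => x /=; split => [->//|[h1 h2]].
by apply/eqP; rewrite eq_le h1 h2.
Qed.

(* The vector of least norm in the convex hull of the columns of A is either 0 or
   makes an acute angle with every column. *)
Lemma gordan (R : realType) m N (A : 'M[R]_(m, N)) (P : pred 'I_N) :
  (exists v : 'rV[R]_m, forall i, P i -> 0 < (v *m A) 0 i) \/
  (exists l : 'rV[R]_N,
    [/\ forall i, 0 <= l 0 i, forall i, ~~ P i -> l 0 i = 0, l != 0 & l *m A^T = 0]).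
Proof.
have [[i0 Pi0]|nP] := pselect (exists i, P i); last first.
  by left; exists 0 => i Pi; case: nP; exists i.
pose S : set 'rV[R]_N := [set l | (forall i, 0 <= l 0 i) /\
  (forall i, ~~ P i -> l 0 i = 0) /\ \sum_i l 0 i = 1].
pose f (l : 'rV[R]_N) := \sum_j (l *m A^T) 0 j * (l *m A^T) 0 j.
have cc (i : 'I_N) := @continuous_coord R N i.
have [l [l0 [lP l1]] lmin] : exists2 l, S l & forall l', S l' -> f l <= f l'.
  apply: (@continuous_min_on _ _ _ 1).
  - exists (delta_mx 0 i0); split => [i|]; first by rewrite mxE ler0n.
    split => [i nPi|].
      by rewrite mxE eqxx /=; case: eqP => //= e; rewrite e Pi0 in nPi.
    rewrite (bigD1 i0) //= mxE !eqxx big1 ?addr0 // => i /negbTE ii0.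
    by rewrite mxE ii0 andbF.
  - apply: closedI.
      apply: closed_forall => i; apply: closed_le_fun => //; exact: cst_continuous.
    apply: closedI.
      apply: closed_forall => i; apply: closed_forall => _.
      by apply: closed_eq_fun => //; exact: cst_continuous.
    apply: closed_eq_fun; last exact: cst_continuous.
    exact: continuous_sum.
  - move=> x [x0 [_ x1]]; apply: mx_norm_leP => // i j; rewrite ord1 ger0_norm //.
    by rewrite -x1 (bigD1 j) //= lerDl sumr_ge0.
  - apply: continuous_sum => j x.
    apply: continuousM;
      (apply: (@continuous_comp _ _ _ (fun x : 'rV[R]_N => x *m A^T) (fun y => y 0 j));
       [exact: mulmx_continuous|exact: continuous_coord]).
set c := l *m A^T.
have [c0|c0] := eqVneq c 0.
  right; exists l; split => //; apply/eqP => l00.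
  by move: l1; rewrite l00 big1 => [/esym/eqP|i _]; rewrite ?oner_eq0 // mxE.
left; exists c => i Pi.
set D := row i A^T.
have cc0 : 0 < \sum_j c 0 j * c 0 j.
  rewrite lt_neqAle sumr_ge0 ?andbT => [|j _]; last by rewrite -expr2 sqr_ge0.
  apply: contra c0 => /eqP/esym/eqP; rewrite psumr_eq0 => [/allP h|j _]; last first.
    by rewrite -expr2 sqr_ge0.
  apply/eqP/rowP => j; rewrite [RHS]mxE; apply/eqP.
  by have /= := h j (mem_index_enum _); rewrite mulf_eq0 orbb.
suff h : \sum_j c 0 j * c 0 j <= (c *m A) 0 i by exact: lt_le_trans h.
have -> : (c *m A) 0 i = \sum_j c 0 j * D 0 j.
  by rewrite mxE; apply: eq_bigr => j _; rewrite !mxE.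
rewrite -subr_ge0 -sumrB.
set a := \sum_j _.
pose b := \sum_j (D 0 j - c 0 j) * (D 0 j - c 0 j).
(* On the segment from the minimiser [l] to the vertex [i] of the simplex, the squared norm exceeds
   its minimum by [2 * s * a + s ^+ 2 * b], which a negative [a] makes negative for small [s]. *)
have key s : 0 < s -> s <= 1 -> 0 <= 2 * s * a + s ^+ 2 * b.
  move=> s0 s1.
  have /lmin : S ((1 - s) *: l + s *: delta_mx 0 i).
    split => [j|].
      rewrite !mxE; apply: addr_ge0; apply: mulr_ge0; rewrite ?subr_ge0 ?ler0n ?l0 //.
      exact: ltW.
    split => [j nPj|].
      rewrite !mxE eqxx /= lP // mulr0 add0r; case: eqP => [e|_ /=]; last by rewrite mulr0.
      by rewrite e Pi in nPj.
    under eq_bigr do rewrite !mxE.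
    rewrite big_split /= -!mulr_sumr l1 (bigD1 i) //= !eqxx /= big1 ?addr0 ?mulr1 ?subrK //.
    by move=> j /negbTE ->.
  rewrite /f mulmxDl -!scalemxAl -/c -rowE -/D -subr_ge0 -sumrB.
  suff -> : \sum_i0 (((1 - s) *: c + s *: D) 0 i0 * ((1 - s) *: c + s *: D) 0 i0 -
     c 0 i0 * c 0 i0) = 2 * s * a + s ^+ 2 * b by [].
  rewrite /a /b !mulr_sumr -big_split /=; apply: eq_bigr => j _; rewrite !mxE.
  ring.
have b0 : 0 <= b by apply: sumr_ge0 => j _; rewrite -expr2 sqr_ge0.
rewrite leNgt; apply/negP => a0.
have h1 : 0 < 1 + b - a by lra.
(* This denominator keeps [s] in [(0, 1]] and gives [a + s * b = s * (a - 1)], a negative number. *)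
pose s := - a / (1 + b - a).
have s0 : 0 < s by rewrite divr_gt0 //; lra.
have s1 : s <= 1 by rewrite ler_pdivrMr // mul1r; lra.
have := key s s0 s1; apply/negP; rewrite -ltNge.
have hs : s * (1 + b - a) = - a by rewrite /s divfK // lt0r_neq0.
have -> : 2 * s * a + s ^+ 2 * b = s * (a + (a + s * b)) by ring.
have : a + s * b < 0 by nra.
nra.
Qed.

(** * Positive tropicalizations *)

Section ContinuousFunctions.
Variables (R : realType) (T : topologicalType).
Implicit Types f g : T -> R.

Lemma continuous_expR_fun f : continuous f -> continuous (fun x => expR (f x)).
Proof. by move=> cf x; apply: continuous_comp; [exact: cf|exact: continuous_expR]. Qed.

Lemma continuousD_fun f g : continuous f -> continuous g -> continuous (fun x => f x + g x).
Proof. by move=> cf cg x; apply: continuousD; [exact: cf|exact: cg]. Qed.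

Lemma continuousB_fun f g : continuous f -> continuous g -> continuous (fun x => f x - g x).
Proof. by move=> cf cg x; apply: continuousB; [exact: cf|exact: cg]. Qed.

Lemma continuousM_fun f g : continuous f -> continuous g -> continuous (fun x => f x * g x).
Proof. by move=> cf cg x; apply: continuousM; [exact: cf|exact: cg]. Qed.

End ContinuousFunctions.

Lemma closed_norm_lt (R : realType) m n (A : set 'M[R]_(m, n)) :
  (forall v, (forall e : R, 0 < e -> exists2 a, A a & `|a - v| < e) -> A v) -> closed A.
Proof.
move=> h v clv; apply: h => e e0.
have /clv [a [Aa ae]] : nbhs v [set y | `|y - v| < e].
  by apply/nbhs_norm_ltP; exists e.
by exists a.
Qed.

Lemma closed_norm_ltE (R : realType) m n (A : set 'M[R]_(m, n)) v : closed A ->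
  (forall e : R, 0 < e -> exists2 a, A a & `|a - v| < e) -> A v.
Proof.
move=> cA h; apply: cA => B /nbhs_norm_ltP [e e0 he].
by have [a Aa av] := h e e0; exists a; split => //; exact: he.
Qed.

Lemma fin_pos_lower_bound (R : realType) (I : finType) (P : pred I) (f : I -> R) :
  (forall i, P i -> 0 < f i) -> exists2 g : R, 0 < g & forall i, P i -> g <= f i.
Proof.
move=> h; exists (\big[Num.min/1]_(i | P i) f i).
  by apply: (big_ind (fun x => 0 < x)) => // x y x0 y0; rewrite lt_min x0 y0.
by move=> i Pi; rewrite (bigD1 i) //= ge_min lexx.
Qed.

Section PositiveTropicalization.
Variables (R : realType) (n d : nat) (p : 'rV[R]_n) (U : 'M[R]_(d, n)).

(** The additional coordinate belongs to the constant monomial, of weight 0 and value 1. *)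
Definition hat0 (w : 'rV[R]_n) : 'rV[R]_(1 + n) := row_mx 0 w.
Definition hat1 (x : 'rV[R]_n) : 'rV[R]_(1 + n) := row_mx 1%:M x.

Definition homog_mx : 'M[R]_(1 + d, 1 + n) := block_mx 1%:M p 0 U.

Definition affine_rel (c : 'rV[R]_(1 + n)) : Prop := homog_mx *m c^T = 0.

Definition in_affine (x : 'rV[R]_n) : bool := (x - p <= U)%MS.

(** One inequality is enough: the same condition for [- c] is the opposite one, so that the two
    minima agree. *)
Definition pos_trop (w : 'rV[R]_n) : Prop :=
  forall c, affine_rel c -> forall o, 0 < c 0 o ->
    exists2 o', c 0 o' < 0 & hat0 w 0 o' <= hat0 w 0 o.

Lemma hat0_norm_sub w w' o : `|hat0 w 0 o - hat0 w' 0 o| <= `|w - w'|.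
Proof.
rewrite !mxE; case: splitP => j _; rewrite ?mxE ?subrr ?normr0 //.
by have := mx_norm_entry (w - w') 0 j; rewrite !mxE.
Qed.

Lemma hat0Z t w : hat0 (t *: w) = t *: hat0 w.
Proof. by rewrite /hat0 scale_row_mx scaler0. Qed.

Lemma hat1_homog x : in_affine x -> exists y, hat1 x = y *m homog_mx.
Proof.
move=> /submxP [y hy]; exists (row_mx 1%:M y).
rewrite mul_row_block !mul1mx mulmx0 addr0 -hy addrC subrK.
by [].
Qed.

Lemma affine_rel_sum c x : affine_rel c -> in_affine x ->
  \sum_o c 0 o * hat1 x 0 o = 0.
Proof.
move=> hc /hat1_homog [y hy].
have -> : \sum_o c 0 o * hat1 x 0 o = (hat1 x *m c^T) 0 0.
  by rewrite mxE; apply: eq_bigr => o _; rewrite mulrC [c^T _ _]mxE.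
by rewrite hy -mulmxA hc mulmx0 mxE.
Qed.

Lemma affine_relN c : affine_rel c -> affine_rel (- c).
Proof. by rewrite /affine_rel linearN mulmxN => ->; rewrite oppr0. Qed.

Lemma affine_rel_of_orth (a : 'rV[R]_n) : a *m U^T = 0 ->
  affine_rel (row_mx (- (a *m p^T)) a).
Proof.
move=> h; rewrite /affine_rel /homog_mx tr_row_mx mul_block_col mul1mx mul0mx add0r.
have -> : U *m a^T = 0 by rewrite -[U]trmxK -trmx_mul h trmx0.
by rewrite linearN /= trmx_mul trmxK addNr col_mx0.
Qed.

Lemma pos_trop_limit w :
  (forall c, affine_rel c -> forall o, 0 < c 0 o -> forall e, 0 < e ->
     exists2 w', `|w' - w| < e &
       exists2 o', c 0 o' < 0 & hat0 w' 0 o' <= hat0 w' 0 o + e) ->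
  pos_trop w.
Proof.
move=> h c hc o co; apply/not_exists2P => hn.
have [g g0 hg] : exists2 g : R, 0 < g &
    forall o', c 0 o' < 0 -> g <= hat0 w 0 o' - hat0 w 0 o.
  apply: fin_pos_lower_bound => o' co'; rewrite subr_gt0 ltNge; apply/negP.
  by case: (hn o') => // /(_ co').
(* Three errors of at most [g / 4], two from replacing [w'] by [w] and one from the slack, stay
   below the gap [g]. *)
have [ | w' ww' [ o' co' le']] := h c hc o co (g / 4); first by rewrite divr_gt0.
have := hg o' co'.
have := le_lt_trans (hat0_norm_sub w' w o') ww'.
have := le_lt_trans (hat0_norm_sub w' w o) ww'.
rewrite !ltr_norml => /andP[h1 h2] /andP[h3 h4]; lra.
Qed.

Lemma pos_trop_closed : closed [set w | pos_trop w].
Proof.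
apply: closed_norm_lt => w h; apply: pos_trop_limit => c hc o co e e0.
have [w' Tw' hw'] := h e e0; exists w' => //.
have [ o' co' le'] := Tw' c hc o co; exists o' => //.
by rewrite (le_trans le') // lerDl ltW.
Qed.

Lemma pos_tropZ t w : 0 <= t -> pos_trop w -> pos_trop (t *: w).
Proof.
move=> t0 h c hc o co; have [ o' co' le'] := h c hc o co; exists o' => //.
by rewrite hat0Z !mxE ler_wpM2l // -!/(hat0 w 0 _) ; move: le'; rewrite !mxE.
Qed.

(* Since w - w' annihilates U, it is itself the linear part of an affine relation c, and
   the signs of c compare w with w'. *)
Lemma pos_trop_inj w w' : pos_trop w -> pos_trop w' -> (w - w') *m U^T = 0 -> w = w'.
Proof.
move=> Tw Tw' h.
set c : 'rV[R]_(1 + n) := row_mx (- ((w - w') *m p^T)) (w - w').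
have hc : affine_rel c by exact: affine_rel_of_orth.
have cS i : c 0 (rshift 1 i) = w 0 i - w' 0 i by rewrite row_mxEr !mxE.
have h0 u : hat0 u 0 (lshift n 0) = 0 by rewrite row_mxEl mxE.
have hS u i : hat0 u 0 (rshift 1 i) = u 0 i by rewrite row_mxEr.
have cpos o : 0 < c 0 o -> hat0 w' 0 o <= hat0 w 0 o /\
    (hat0 w' 0 o = hat0 w 0 o -> o = lshift n 0).
  case: (split_ordP o) => i -> ; first by rewrite !ord1 !h0.
  rewrite cS !hS subr_gt0 => lt; split; first exact: ltW.
  by move=> e; move: lt; rewrite e ltxx.
have cneg o : c 0 o < 0 -> hat0 w 0 o <= hat0 w' 0 o /\
    (hat0 w' 0 o = hat0 w 0 o -> o = lshift n 0).
  case: (split_ordP o) => i -> ; first by rewrite !ord1 !h0.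
  rewrite cS !hS subr_lt0 => lt; split; first exact: ltW.
  by move=> e; move: lt; rewrite e ltxx.
apply/eqP/negP => /negP ww'.
have [i ci] : exists i, w 0 i != w' 0 i.
  apply/not_existsP => hn; move/eqP: ww'; apply; apply/rowP => i.
  by apply/eqP; have := hn i; move/negP; rewrite negbK.
have [ o co] : exists o, c 0 o < 0.
  move: ci; rewrite -subr_eq0 -cS neq_lt => /orP[|lt]; first by exists (rshift 1 i).
  by have [ o' ? _] := Tw c hc _ lt; exists o'.
have [ om cm hm] : exists2 om, c 0 om < 0 &
    forall o', c 0 o' < 0 -> hat0 w 0 om <= hat0 w 0 o'.
  case: (@Order.TotalTheory.arg_minP _ _ _ o (fun o => c 0 o < 0)
    (fun o => hat0 w 0 o) co) => om cm hm.
  by exists om.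
(* The chain w(o2) <= w'(o2) <= w'(o1) <= w(o1) <= w(om) <= w(o2) closes up. Its equalities force
   both [o1] and [o2] to be the constant coordinate, where [c] would have both signs. *)
have [ | o1 c1 l1] := Tw _ (affine_relN hc) om; first by rewrite mxE oppr_gt0.
have {}c1 : 0 < c 0 o1 by move: c1; rewrite mxE oppr_lt0.
have [ o2 c2 l2] := Tw' _ hc o1 c1.
have [p1 q1] := cpos _ c1; have [p2 q2] := cneg _ c2.
have l3 := hm _ c2.
have e1 : o1 = lshift n 0 by apply: q1; lra.
have e2 : o2 = lshift n 0 by apply: q2; lra.
by move: c1 c2; rewrite e1 e2 => c1 /(lt_trans c1); rewrite ltxx.
Qed.

(** The positive term at [o] is at most the sum of the moduli of the negative terms, hence at most a
    multiple of the largest of them. Since [C] is uniform in [x], it becomes a bounded additive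
    error after logarithms and disappears under rescaling. *)
Lemma affine_positive_comparison c o : affine_rel c -> 0 < c 0 o ->
  exists2 C : R, 0 < C & forall x, in_affine x -> (forall i, 0 < x 0 i) ->
    exists2 o', c 0 o' < 0 & hat1 x 0 o <= C * hat1 x 0 o'.
Proof.
move=> hc co.
pose S := \sum_(o' | c 0 o' < 0) `|c 0 o'|.
have S0 : 0 <= S by apply: sumr_ge0.
exists (S / c 0 o + 1); first by rewrite ltr_wpDl // divr_ge0 // ltW.
move=> x xA x0.
have hx o' : 0 < hat1 x 0 o'.
  by case: (split_ordP o') => i ->; rewrite ?row_mxEl ?row_mxEr // ord1 mxE.
have hs := affine_rel_sum hc xA.
have hle : c 0 o * hat1 x 0 o <= \sum_(o' | c 0 o' < 0) `|c 0 o'| * hat1 x 0 o'.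
  move: hs; rewrite (bigID (fun o' => c 0 o' < 0)) /= => /eqP.
  rewrite addrC addr_eq0 => /eqP hs.
  have -> : \sum_(o' | c 0 o' < 0) `|c 0 o'| * hat1 x 0 o' =
      - (\sum_(o' | c 0 o' < 0) c 0 o' * hat1 x 0 o').
    by rewrite -sumrN; apply: eq_bigr => o' lt; rewrite ltr0_norm // mulNr.
  rewrite -hs (bigD1 o) /=; last by rewrite -leNgt ltW.
  rewrite lerDl; apply: sumr_ge0 => o' /andP[]; rewrite -leNgt => h _.
  by rewrite mulr_ge0 // ltW.
have [ o1 c1] : exists o', c 0 o' < 0.
  apply/not_existsP => hn; have : 0 < c 0 o * hat1 x 0 o by exact: mulr_gt0.
  rewrite ltNge; apply/negP; rewrite negbK (le_trans hle) // big1 // => o' lt.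
  by have := hn o'.
case: (@Order.TotalTheory.arg_maxP _ _ _ o1 (fun o => c 0 o < 0)
    (fun o => hat1 x 0 o) c1) => om cm hm.
exists om => //.
have h2 : c 0 o * hat1 x 0 o <= S * hat1 x 0 om.
  rewrite (le_trans hle) // /S mulr_suml; apply: ler_sum => o' lt.
  by rewrite ler_wpM2l //; exact: hm.
rewrite mulrDl mul1r ler_wpDr //; first exact: ltW.
by rewrite mulrAC ler_pdivlMr // mulrC.
Qed.

(** For [y >= 0] the tangent of [expR] of slope [2 * x] leaves the growth [x * y]; for [y < 0] the
    term [- x * y] is already [x * |y|]. *)
Lemma entropy_coercive (eta x : R) : 0 < x ->
  exists C, forall y, x * `|y| - C <= expR (eta + y) - x * y.
Proof.
move=> x0; exists `|2 * x * (1 + eta - ln (2 * x))| => y.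
have x20 : 0 < 2 * x by rewrite mulr_gt0.
set a := 2 * x * _.
have [y0|y0] := leP 0 y.
  have : 2 * x * (1 + (eta + y - ln (2 * x))) <= expR (eta + y).
    have -> : expR (eta + y) = 2 * x * expR (eta + y - ln (2 * x)).
      by rewrite expRB lnK ?posrE // mulrCA divff ?mulr1 // lt0r_neq0.
    by rewrite ler_pM2l // expR_ge1Dx.
  have -> : 2 * x * (1 + (eta + y - ln (2 * x))) = a + 2 * x * y by rewrite /a; ring.
  have : - `|a| <= a by rewrite lerNl ler_normr lexx orbT.
  rewrite (ger0_norm y0); lra.
have := expR_gt0 (eta + y); have : 0 <= `|a| by [].
rewrite (ltr0_norm y0); lra.
Qed.

(* Birch's theorem: an interior minimiser of the strictly convex function G on the orthogonal
   of U is a point of the affine space. *)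
Lemma birch (x0 eta : 'rV[R]_n) : in_affine x0 -> (forall i, 0 < x0 0 i) ->
  exists y : 'rV[R]_n, y *m U^T = 0 /\ in_affine (\row_i expR (eta 0 i + y 0 i)).
Proof.
move=> xA xpos.
have /choice [C hC] : forall i, exists C, forall y : R,
    x0 0 i * `|y| - C <= expR (eta 0 i + y) - x0 0 i * y.
  by move=> i; exact: entropy_coercive.
have [xm xm0 hxm] : exists2 g : R, 0 < g & forall i : 'I_n, predT i -> g <= x0 0 i.
  by apply: fin_pos_lower_bound => i _.
pose G (y : 'rV[R]_n) := \sum_i (expR (eta 0 i + y 0 i) - x0 0 i * y 0 i).
have Gbound y : xm * `|y| - \sum_i C i <= G y.
  have : \sum_i (x0 0 i * `|y 0 i| - C i) <= G y by apply: ler_sum => i _; exact: hC.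
  apply: le_trans; rewrite sumrB lerD2r.
  have : `|y| <= \sum_i `|y 0 i|.
    apply: mx_norm_leP; first exact: sumr_ge0.
    by move=> i j; rewrite ord1 (bigD1 j) //= lerDl sumr_ge0.
  rewrite -(ler_pM2l xm0) => /le_trans; apply; rewrite mulr_sumr.
  by apply: ler_sum => i _; rewrite ler_wpM2r // hxm.
(* Outside the ball of radius [M] the coercive bound exceeds [G 0], so a minimiser on the ball is a
   global one. *)
pose M : R := `|(G 0 + \sum_i C i) / xm|.
have Gcont : continuous G.
  apply: continuous_sum => i; apply: continuousB_fun.
    apply: continuous_expR_fun.
    by apply: continuousD_fun; [exact: cst_continuous|exact: continuous_coord].
  by apply: continuousM_fun; [exact: cst_continuous|exact: continuous_coord].
have [y [yU yM] ymin] : exists2 y, ([set y : 'rV[R]_n | y *m U^T = 0] `&` [set y | `|y| <= M]) y &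
    forall z, ([set y : 'rV[R]_n | y *m U^T = 0] `&` [set y | `|y| <= M]) z -> G y <= G z.
  apply: (@continuous_min_on _ _ _ M) => //.
  - by exists 0; split; rewrite /= ?mul0mx // normr0 /M.
  - apply: closedI.
      apply: (@closed_comp _ _ (fun y : 'rV[R]_n => y *m U^T) [set y | y = 0]).
        by move=> x _; exact: mulmx_continuous.
      apply: accessible_closed_set1; apply: hausdorff_accessible.
      exact: norm_hausdorff.
    apply: (@closed_comp _ _ (fun x : 'rV[R]_n => `|x|) [set y | y <= M]).
      by move=> x _; exact: norm_continuous.
    exact: closed_le.
  - by move=> x [].
have {}ymin z : z *m U^T = 0 -> G y <= G z.
  move=> zU; have [zM|zM] := leP `|z| M; first exact: ymin.
  have : G y <= G 0 by apply: ymin; split; rewrite /= ?mul0mx // normr0 /M.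
  move=> /le_trans; apply; apply: le_trans (Gbound z).
  rewrite lerBrDr; move: zM; rewrite /M => zM.
  have := le_lt_trans (ler_norm _) zM.
  by rewrite ltr_pdivrMr // mulrC => /ltW.
have crit (v : 'rV[R]_n) : v *m U^T = 0 ->
    \sum_i (expR (eta 0 i + y 0 i) - x0 0 i) * v 0 i = 0.
  move=> vU.
  (* [D s] is the derivative of [G] along [v] at [y + s *: v]. Convexity bounds
     [G (y + s *: v) - G y] by [s * D s], so minimality gives [s * D s >= 0] on both sides of 0, and
     continuity gives [D 0 = 0]. *)
  pose D (s : R) := \sum_i (expR (eta 0 i + y 0 i + s * v 0 i) - x0 0 i) * v 0 i.
  have Dcont : continuous D.
    apply: continuous_sum => i; apply: continuousM_fun; last exact: cst_continuous.
    apply: continuousB_fun; last exact: cst_continuous.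
    apply: continuous_expR_fun; apply: continuousD_fun; first exact: cst_continuous.
    by apply: continuousM_fun; [move=> x; exact: cvg_id|exact: cst_continuous].
  have Dsign s : 0 <= s * D s.
    have : G y <= G (y + s *: v).
      by apply: ymin; rewrite mulmxDl yU -scalemxAl vU scaler0 addr0.
    rewrite -subr_ge0 => /le_trans; apply.
    rewrite /G /D -sumrB mulr_sumr; apply: ler_sum => i _; rewrite !mxE.
    set a := eta 0 i; set b := y 0 i; set c := s * v 0 i.
    have -> : s * ((expR (a + b + c) - x0 0 i) * v 0 i) = expR (a + b + c) * c - x0 0 i * c.
      by rewrite /c; ring.
    have : expR (a + b + c) * (1 - c) <= expR (a + b).
      have -> : expR (a + b) = expR (a + b + c) * expR (- c) by rewrite -expRD addrK.
      by rewrite ler_pM2l ?expR_gt0 // expR_ge1Dx.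
    rewrite addrA; lra.
  have D0 : D 0 = \sum_i (expR (eta 0 i + y 0 i) - x0 0 i) * v 0 i.
    by apply: eq_bigr => i _; rewrite mul0r addr0.
  rewrite -D0; apply/eqP; apply/negP => /negP D0n.
  have := Dcont 0 => /cvgrPdist_lt /(_ `|D 0|); rewrite normr_gt0 => /(_ D0n).
  move=> /nbhs_normP [e /= e0 he].
  have e20 : 0 < e / 2 by rewrite divr_gt0.
  have h1 : `|D 0 - D (e / 2)| < `|D 0|.
    by apply: he; rewrite /ball_ /= sub0r normrN gtr0_norm // ltr_pdivrMr //; lra.
  have h2 : `|D 0 - D (- (e / 2))| < `|D 0|.
    by apply: he; rewrite /ball_ /= sub0r opprK gtr0_norm // ltr_pdivrMr //; lra.
  have := Dsign (e / 2); have := Dsign (- (e / 2)).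
  rewrite mulNr -mulrN !pmulr_rge0 //.
  move: h1 h2; case: (ltgtP (D 0) 0) D0n => // D0s _.
    rewrite (ltr0_norm D0s) !ltr_norml => /andP[? ?] /andP[? ?]; lra.
  rewrite (gtr0_norm D0s) !ltr_norml => /andP[? ?] /andP[? ?]; lra.
exists y; split => //.
set z := \row_i _.
rewrite /in_affine -[z](subrK x0) -addrA addmx_sub //.
rewrite submxE; apply/eqP/rowP => j; rewrite [RHS]mxE.
(* The columns of [cokermx U] serve as test vectors: a vector orthogonal to all of them lies in the
   row space of [U]. *)
have h : (col j (cokermx U))^T *m U^T = 0.
  by rewrite -trmx_mul colE mulmxA mulmx_coker mul0mx trmx0.
rewrite -(crit _ h) mxE; apply: eq_bigr => i _.
by rewrite !mxE.
Qed.

End PositiveTropicalization.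

(** * The continuous section parametrising the positive tropicalization *)

Lemma cluster_closed (R : realType) n (u : nat -> 'rV[R]_n) v (A : set 'rV[R]_n) :
  (forall N (e : R), 0 < e -> exists2 k, (N <= k)%N & `|u k - v| < e) ->
  closed A -> (forall k, A (u k)) -> A v.
Proof.
move=> h cA Au; apply: (closed_norm_ltE cA) => e e0.
by have [k _ hk] := h 0%N e e0; exists (u k).
Qed.

Lemma closed_mulmx_eq (R : realType) (T : topologicalType) n r
    (f : T -> 'rV[R]_n) (A : 'M[R]_(n, r)) (b : 'rV[R]_r) :
  (forall i, continuous (fun x => f x 0 i)) -> closed [set x | f x *m A = b].
Proof.
move=> cf.
rewrite (_ : [set _ | _] = [set x | forall j, \sum_i f x 0 i * A i j = b 0 j]); last first.
  rewrite predeqE => x /=; split => [<- j|h]; first by rewrite mxE.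
  by apply/rowP => j; rewrite mxE h.
apply: closed_forall => j; apply: closed_eq_fun; last exact: cst_continuous.
apply: continuous_sum => i; apply: continuousM_fun; first exact: cf.
exact: cst_continuous.
Qed.

Lemma continuous_normr_mx (R : realType) m n : continuous (fun x : 'M[R]_(m, n) => `|x|).
Proof. by move=> x; exact: norm_continuous. Qed.

Section PositiveSection.
Variables (R : realType) (n d : nat) (p : 'rV[R]_n) (U : 'M[R]_(d, n)).
Local Notation T := (pos_trop p U).

Hypothesis freeU : row_free U.
Variable x0 : 'rV[R]_n.
Hypothesis affx0 : in_affine p U x0.
Hypothesis posx0 : forall i, 0 < x0 0 i.

(** With all weights zero the condition says that a relation with a positive coefficient also has a
    negative one; evaluation at the positive point [x0] enforces it. *)
Lemma pos_trop0 : T 0.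
Proof.
move=> c hc o co; have [C C0 h] := affine_positive_comparison hc co.
have [ o' co' _] := h _ affx0 posx0; exists o' => //.
by rewrite /hat0 row_mx0 !mxE.
Qed.

(* The points of Birch's theorem for k * xi, rescaled, accumulate at the required point. *)
Lemma pos_trop_surj (xi : 'rV[R]_n) : exists w, T w /\ (w - xi) *m U^T = 0.
Proof.
have /choice [y hy] : forall k : nat, exists y : 'rV[R]_n, y *m U^T = 0 /\
    in_affine p U (\row_i expR ((- (k.+1%:R *: xi)) 0 i + y 0 i)).
  by move=> k; exact: birch affx0 posx0.
(* [v k] is minus the logarithm of a positive point of the affine space. Dividing it by
   [k.+1%:R + |v k|] bounds the sequence without any a priori estimate, and [1 - |om k|] records the
   share left to [xi]. *)
pose v k := k.+1%:R *: xi - y k.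
pose om k := (k.+1%:R + `|v k|)^-1 *: v k.
have den k : 0 < k.+1%:R + `|v k| by rewrite ltr_wpDr.
have om1 k : `|om k| <= 1.
  rewrite normrZ gtr0_norm ?invr_gt0 // mulrC ler_pdivrMr // mul1r.
  by rewrite lerDr.
have [w hw] := bounded_cluster om1.
have Tw : T w.
  apply: pos_trop_limit => c hc o co e e0.
  have [C C0 hC] := affine_positive_comparison hc co.
  (* The factor [C] becomes the additive error [ln C]; a divisor of at least [K / e] reduces it to
     at most [e]. *)
  pose K := Num.max 0 (ln C).
  have K0 : 0 <= K by rewrite le_max lexx.
  have [k hk omk] := hw (Num.truncn (K / e)).+1 e e0.
  exists (om k) => //.
  have [yU yA] := hy k.
  have := hC _ yA.
  case=> [i| o' co' hle]; first by rewrite mxE expR_gt0.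
  exists o' => //.
  have E u : hat1 (\row_i expR ((- (k.+1%:R *: xi)) 0 i + y k 0 i)) 0 u = expR (- hat0 (v k) 0 u).
    case: (split_ordP u) => i ->; rewrite ?row_mxEl ?row_mxEr.
      by rewrite ord1 !mxE oppr0 expR0.
    by rewrite !mxE opprB addrC.
  have h1 : hat0 (v k) 0 o' <= hat0 (v k) 0 o + K.
    move: hle; rewrite !E => hle.
    have : expR (- hat0 (v k) 0 o) <= expR (K - hat0 (v k) 0 o').
      apply: le_trans hle _; rewrite expRD ler_wpM2r ?expR_ge0 //.
      by rewrite -{1}(@lnK _ C) ?posrE // ler_expR le_max lexx orbT.
    by rewrite ler_expR; lra.
  rewrite /om hat0Z ![(_ *: hat0 _) _ _]mxE.
  set D := k.+1%:R + `|v k|.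
  have h2 : D^-1 * hat0 (v k) 0 o' <= D^-1 * (hat0 (v k) 0 o + K).
    by rewrite ler_wpM2l // invr_ge0 ltW // /D.
  apply: le_trans h2 _; rewrite mulrDr lerD2l mulrC ler_pdivrMr ?den //.
  rewrite mulrC -ler_pdivrMr //.
  have hkk : K / e <= k.+1%:R.
    rewrite -natr1 ler_wpDr //.
    apply: ltW; apply: lt_le_trans (_ : (Num.truncn (K / e)).+1%:R <= _).
      by rewrite truncnS_gt // divr_ge0 // ltW.
    by rewrite ler_nat.
  by rewrite (le_trans hkk) // /D lerDl.
have [ww1 eqw] : `|w| <= 1 /\ (w - (1 - `|w|) *: xi) *m U^T = 0.
  apply: (cluster_closed hw (A := [set w : 'rV[R]_n | `|w| <= 1] `&`
    [set w : 'rV[R]_n | (w - (1 - `|w|) *: xi) *m U^T = 0])).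
    apply: closedI.
      by apply: closed_le_fun; [exact: continuous_normr_mx|exact: cst_continuous].
    apply: closed_mulmx_eq => i.
    rewrite (_ : (fun _ => _) = fun x : 'rV[R]_n => x 0 i - (1 - `|x|) * xi 0 i); last first.
      by apply/funext => x; rewrite !mxE.
    apply: continuousB_fun; first exact: continuous_coord.
    apply: continuousM_fun; last exact: cst_continuous.
    by apply: continuousB_fun; [exact: cst_continuous|exact: continuous_normr_mx].
  move=> k; split => //=; have [yU _] := hy k.
  have -> : 1 - `|om k| = (k.+1%:R + `|v k|)^-1 * k.+1%:R.
    rewrite /om normrZ gtr0_norm ?invr_gt0 //.
    have := lt0r_neq0 (den k); set D := _ + _ => D0.
    apply: (mulfI D0); rewrite mulrBr !mulrA mulfV // !mul1r mulr1 /D; ring.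
  by rewrite -scalerA -scalerBr /v addrAC subrr sub0r -scalemxAl mulNmx yU
             oppr0 scaler0.
(* If [w] had norm 1, it would be a positive tropical point annihilating the direction, as 0 is,
   hence equal to 0 by injectivity. *)
have tau0 : 0 < 1 - `|w|.
  rewrite subr_gt0 lt_neqAle ww1 andbT; apply/eqP => w1.
  have w0 : w = 0.
    apply: (pos_trop_inj Tw pos_trop0); rewrite subr0.
    by move: eqw; rewrite w1 subrr scale0r subr0.
  by move: w1; rewrite w0 normr0 => /esym/eqP; rewrite oner_eq0.
exists ((1 - `|w|)^-1 *: w); split; first by apply: pos_tropZ => //; rewrite invr_ge0 ltW.
rewrite -[xi](scalerK (lt0r_neq0 tau0)) -scalerBr -scalemxAl eqw.
by rewrite scaler0.
Qed.

Lemma pos_section_exists eta : exists w, T w /\ w *m U^T = eta.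
Proof.
have [B hB] := row_freeP freeU.
have [w [Tw hw]] := pos_trop_surj (eta *m B^T).
exists w; split => //; move/eqP: hw; rewrite mulmxBl subr_eq0 => /eqP ->.
by rewrite -mulmxA -trmx_mul hB trmx1 mulmx1.
Qed.

Definition pos_section eta := sval (cid (pos_section_exists eta)).

Lemma pos_sectionP eta : T (pos_section eta).
Proof. by have [] := svalP (cid (pos_section_exists eta)). Qed.

Lemma pos_sectionK eta : pos_section eta *m U^T = eta.
Proof. by have [] := svalP (cid (pos_section_exists eta)). Qed.

Lemma pos_section_uniq w : T w -> w = pos_section (w *m U^T).
Proof.
move=> Tw; apply: (pos_trop_inj Tw (pos_sectionP _)).
by rewrite mulmxBl pos_sectionK subrr.
Qed.

Lemma pos_sectionZ t eta : 0 <= t -> pos_section (t *: eta) = t *: pos_section eta.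
Proof.
move=> t0; have -> : t *: eta = (t *: pos_section eta) *m U^T.
  by rewrite -scalemxAl pos_sectionK.
by rewrite -pos_section_uniq //; apply: pos_tropZ => //; exact: pos_sectionP.
Qed.

(** On the compact set of unit vectors of the closed cone [T], the norm of [w *m U^T] attains its
    minimum, which is positive by injectivity at 0. Its inverse is the constant. *)
Lemma pos_section_bound : exists2 C, 0 < C & forall eta, `|pos_section eta| <= C * `|eta|.
Proof.
have [h|/existsNP [w1 h]] := pselect (forall w, T w -> `|w| <= 0).
  by exists 1 => // eta; rewrite (le_trans (h _ (pos_sectionP _))) // mul1r.
have {h} [Tw1 w10] : T w1 /\ 0 < `|w1|.
  by move: h => /not_implyP [? /negP]; rewrite -ltNge.
have [w [Tw ww] hmin] : exists2 w : 'rV[R]_n, ([set w | T w] `&` [set w | `|w| = 1]) w &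
    forall z : 'rV[R]_n, ([set w | T w] `&` [set w | `|w| = 1]) z ->
    `|w *m U^T| <= `|z *m U^T|.
  apply: (@continuous_min_on _ _ _ 1 (fun w => `|w *m U^T|)).
  - exists (`|w1|^-1 *: w1); split => /=.
      by apply: pos_tropZ => //; rewrite invr_ge0.
    by rewrite normrZ gtr0_norm ?invr_gt0 // mulVf // lt0r_neq0.
  - apply: closedI; first exact: pos_trop_closed.
    by apply: closed_eq_fun; [exact: continuous_normr_mx|exact: cst_continuous].
  - by move=> x [_ /= ->].
  - move=> x; apply: (@continuous_comp _ _ _ (fun w : 'rV[R]_n => w *m U^T) (fun y => `|y|)).
      exact: mulmx_continuous.
    exact: norm_continuous.
have m0 : 0 < `|w *m U^T|.
  rewrite normr_gt0; apply/eqP => h.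
  have w0 : w = 0 by apply: (pos_trop_inj Tw pos_trop0); rewrite subr0.
  by move: ww; rewrite /= w0 normr0 => /esym/eqP; rewrite oner_eq0.
exists (`|w *m U^T|^-1); first by rewrite invr_gt0.
move=> eta; have [->|e0] := eqVneq `|pos_section eta| 0.
  by rewrite mulr_ge0 // invr_ge0.
have e0' : 0 < `|pos_section eta| by rewrite lt_neqAle eq_sym e0 normr_ge0.
rewrite mulrC ler_pdivlMr // mulrC -ler_pdivlMr // mulrC.
have := hmin (`|pos_section eta|^-1 *: pos_section eta).
rewrite -scalemxAl pos_sectionK normrZ (gtr0_norm (x := _^-1)) ?invr_gt0 //; apply; split => /=.
  by apply: pos_tropZ; [rewrite invr_ge0|exact: pos_sectionP].
by rewrite normrZ gtr0_norm ?invr_gt0 // mulVf.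
Qed.

(** A sequence violating continuity has bounded images by [pos_section_bound]. A cluster point of
    these lies in [T] over [eta], so it is [pos_section eta], from which the images stay at distance
    [e]. *)
Lemma pos_section_continuous : continuous pos_section.
Proof.
move=> eta; apply/continuous_norm_ltP => e e0; apply/not_exists2P => h.
have {}h del : 0 < del -> exists2 y, `|y - eta| < del & e <= `|pos_section y - pos_section eta|.
  move=> d0; have [//|/existsNP [y /not_implyP [h1 /negP h2]]] := h del.
  by exists y => //; rewrite leNgt.
have /choice [u hu] : forall k : nat, exists y, `|y - eta| < k.+1%:R^-1 /\
    e <= `|pos_section y - pos_section eta|.
  by move=> k; have [|y h1 h2] := h k.+1%:R^-1; [rewrite invr_gt0|exists y].
have [C C0 hC] := pos_section_bound.
have bd k : `|pos_section (u k)| <= C * (`|eta| + 1).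
  apply: le_trans (hC _) _; rewrite ler_pM2l // -[u k](subrK eta) addrC.
  apply: le_trans (ler_normD _ _) _; rewrite lerD2l; have [/ltW h1 _] := hu k.
  by rewrite (le_trans h1) // invf_le1 // ler1n.
have [w hw] := bounded_cluster bd.
have Tw : T w.
  apply: (cluster_closed hw (A := [set w | T w])); first exact: pos_trop_closed.
  by move=> k; exact: pos_sectionP.
have wU : w *m U^T = eta.
  apply/eqP; rewrite -subr_eq0 -normr_eq0; apply/eqP/le_anti; rewrite normr_ge0 andbT.
  apply/ler_addgt0Pl => r r0; rewrite addr0.
  have [D D0 hD] := mulmx_norm_bound 1 U^T.
  have [k hk wk] := hw (Num.truncn (r / 2)^-1) (r / 2 / D) ltac:(by rewrite !divr_gt0).
  have [h1 _] := hu k.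
  rewrite -(subrK (u k) (w *m U^T)) -addrA; apply: le_trans (ler_normD _ _) _.
  rewrite -{1}(pos_sectionK (u k)) -mulmxBl (splitr r) lerD //.
    apply: le_trans (hD _) _; rewrite distrC.
    by rewrite mulrC -ler_pdivlMr // ltW.
  apply: le_trans (ltW h1) _; rewrite invf_ple ?posrE ?divr_gt0 //.
  apply: ltW; apply: lt_le_trans (truncnS_gt _) _; last by rewrite ler_nat.
have := hw 0%N e e0; case=> k _; have [_] := hu k.
by rewrite (pos_section_uniq Tw) wU => /le_lt_trans h1 /h1; rewrite ltxx.
Qed.

End PositiveSection.

(** * Initial forms *)

Lemma ReD (R : realType) (x y : complex R) : complex.Re (x + y) = complex.Re x + complex.Re y.
Proof. by case: x y => [? ?] [? ?]. Qed.

Lemma ImD (R : realType) (x y : complex R) : complex.Im (x + y) = complex.Im x + complex.Im y.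
Proof. by case: x y => [? ?] [? ?]. Qed.

Lemma Re_sum (R : realType) (I : Type) (s : seq I) (P : pred I) (F : I -> complex R) :
  complex.Re (\sum_(i <- s | P i) F i) = \sum_(i <- s | P i) complex.Re (F i).
Proof. by apply: (big_morph (@complex.Re R)) => //; exact: ReD. Qed.

Lemma Im_sum (R : realType) (I : Type) (s : seq I) (P : pred I) (F : I -> complex R) :
  complex.Im (\sum_(i <- s | P i) F i) = \sum_(i <- s | P i) complex.Im (F i).
Proof. by apply: (big_morph (@complex.Im R)) => //; exact: ImD. Qed.

Lemma Re_mulr_real (R : realType) (x : complex R) (r : R) :
  complex.Re (x * real_complex R r) = complex.Re x * r.
Proof. by case: x => a b /=; rewrite mulr0 subr0. Qed.

Lemma Im_mulr_real (R : realType) (x : complex R) (r : R) :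
  complex.Im (x * real_complex R r) = complex.Im x * r.
Proof. by case: x => a b /=; rewrite mulr0 add0r. Qed.

(** Below, [q] is the exponential of a nonpositive weight difference, and the limit selects the
    terms of equal weight. *)
Lemma cvg_geometric_le1 (R : realType) (q : R) : 0 < q -> q <= 1 ->
  q ^+ k @[k --> \oo] --> ((q == 1)%:R : R).
Proof.
move=> q0 q1; have [->|qn] := eqVneq q 1.
  by under eq_fun do rewrite expr1n; exact: cvg_cst.
by apply: cvg_expr; rewrite gtr0_norm // lt_neqAle qn.
Qed.

Section InitialForms.
Variables (R : realType) (n d : nat) (p : 'rV[R]_n) (U : 'M[R]_(d, n)).
Local Notation C := (complex R).
Local Notation toC := (map_mx (real_complex R)).
Variable S : set 'rV[C]_n.

Hypothesis SsubC : forall z, S z -> exists y : 'rV[C]_d, z = toC p + y *m toC U.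

Definition hat_monom (o : 'I_(1 + n)) : mpoly.multinom n :=
  match fintype.split o with inl _ => mpoly.mnm0 | inr j => mpoly.mnm1 j end.

Lemma hat_monomL i : hat_monom (lshift n i) = mpoly.mnm0.
Proof.
rewrite /hat_monom; case: fintype.splitP => // j e.
by have := ltn_ord i; rewrite /= in e; rewrite e.
Qed.

Lemma hat_monomR i : hat_monom (rshift 1 i) = mpoly.mnm1 i.
Proof.
rewrite /hat_monom; case: fintype.splitP => [j e|j e].
  by have := ltn_ord j; rewrite -e.
by congr mpoly.mnm1; apply/val_inj; apply/eqP; rewrite -(eqn_add2l 1) eq_sym; apply/eqP.
Qed.

Lemma hat_monom_inj : injective hat_monom.
Proof.
move=> o o'; case: (split_ordP o) => i ->; case: (split_ordP o') => j ->;
  rewrite ?hat_monomL ?hat_monomR.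
- by rewrite !ord1.
- by move=> /(congr1 (fun m => mpoly.fun_of_multinom m j)); rewrite mpoly.mnm0E mpoly.mnm1E eqxx.
- by move=> /(congr1 (fun m => mpoly.fun_of_multinom m i)); rewrite mpoly.mnm0E mpoly.mnm1E eqxx.
- move=> /(congr1 (fun m => mpoly.fun_of_multinom m i)); rewrite !mpoly.mnm1E eqxx.
  by case: eqP => // ->.
Qed.

Lemma mweight_hat_monom (w : 'rV[R]_n) o : mweight w (hat_monom o) = hat0 w 0 o.
Proof.
rewrite /mweight; case: (split_ordP o) => i ->; rewrite ?hat_monomL ?hat_monomR ?row_mxEl ?row_mxEr.
  by rewrite mxE big1 // => j _; rewrite mpoly.mnm0E mulr0.
rewrite (bigD1 i) //= mpoly.mnm1E eqxx mulr1 big1 ?addr0 // => j ji.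
by rewrite mpoly.mnm1E eq_sym (negbTE ji) mulr0.
Qed.

Definition hatC (z : 'rV[C]_n) : 'rV[C]_(1 + n) := row_mx 1%:M z.

Lemma eval_hat_monom (z : 'rV[C]_n) o :
  \prod_(i < n) z 0 i ^+ mpoly.fun_of_multinom (hat_monom o) i = hatC z 0 o.
Proof.
case: (split_ordP o) => i ->; rewrite ?hat_monomL ?hat_monomR ?row_mxEl ?row_mxEr.
  by rewrite ord1 mxE eqxx big1 // => j _; rewrite mpoly.mnm0E expr0.
rewrite (bigD1 i) //= mpoly.mnm1E eqxx expr1 big1 ?mulr1 // => j ji.
by rewrite mpoly.mnm1E eq_sym (negbTE ji) expr0.
Qed.

Definition linform (c : 'rV[R]_(1 + n)) : mpoly.mpoly n C :=
  \sum_o real_complex R (c 0 o) *: mpoly.mpolyX C (hat_monom o).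

Lemma mcoeff_linform c m :
  mpoly.mcoeff m (linform c) = \sum_o real_complex R (c 0 o) * (hat_monom o == m)%:R.
Proof.
rewrite /linform raddf_sum /=; apply: eq_bigr => o _.
by rewrite mpoly.mcoeffZ mpoly.mcoeffX.
Qed.

Lemma mcoeff_linform_hat c o : mpoly.mcoeff (hat_monom o) (linform c) = real_complex R (c 0 o).
Proof.
rewrite mcoeff_linform (bigD1 o) //= eqxx mulr1 big1 ?addr0 // => o' h.
by rewrite (inj_eq hat_monom_inj) (negbTE h) mulr0.
Qed.

Lemma real_complex_neq0 (x : R) : (real_complex R x != 0) = (x != 0).
Proof. by rewrite eq_complex /= eqxx andbT. Qed.

Lemma msupp_linform c :
  perm_eq (mpoly.msupp (linform c)) [seq hat_monom o | o <- enum [pred o | c 0 o != 0]].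
Proof.
apply: uniq_perm; first exact: mpoly.msupp_uniq.
  by rewrite map_inj_uniq ?enum_uniq //; exact: hat_monom_inj.
move=> m; rewrite mpoly.mcoeff_msupp; apply/idP/mapP.
  move=> h; have [ o mo] : exists o, hat_monom o = m.
    apply/not_existsP => hn; move/eqP: h; apply.
    rewrite mcoeff_linform big1 // => o _; case: eqP => [e|]; last by rewrite mulr0.
    by case: (hn o).
  exists o => //; rewrite mem_enum inE; move: h.
  by rewrite -mo mcoeff_linform_hat real_complex_neq0.
move=> [ o]; rewrite mem_enum inE => h ->.
by rewrite mcoeff_linform_hat real_complex_neq0.
Qed.

Lemma linform_vanishing c : affine_rel p U c -> vanishing_ideal S (linform c).
Proof.
move=> hc z /SsubC [y hy].
have -> : mpoly.meval (fun i => z 0 i) (linform c) = (hatC z *m toC c^T) 0 0.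
  rewrite /linform raddf_sum /= mxE; apply: eq_bigr => o _.
  rewrite mpoly.mevalZ mpoly.mevalX mulrC; congr (_ * _); last by rewrite !mxE.
  by rewrite -(eval_hat_monom z).
have -> : hatC z = row_mx 1%:M y *m toC (homog_mx p U).
  rewrite /homog_mx map_block_mx mul_row_block !map_scalar_mx !map_mx0 /= rmorph1.
  by rewrite !mul1mx mulmx0 addr0 /hatC hy.
by rewrite -mulmxA -map_mxM hc map_mx0 mulmx0 mxE.
Qed.

Lemma initial_linform (w : 'rV[R]_n) z c o : initial_pt S w z -> affine_rel p U c ->
  c 0 o != 0 -> (forall o', c 0 o' != 0 -> hat0 w 0 o <= hat0 w 0 o') ->
  \sum_(o' | (c 0 o' != 0) && (hat0 w 0 o' == hat0 w 0 o))
     real_complex R (c 0 o') * hatC z 0 o' = 0.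
Proof.
move=> [_ h] /linform_vanishing /h; rewrite /initial_eval => hz co omin.
rewrite -[RHS]hz.
rewrite (perm_big _ (msupp_linform c)) /= big_map big_enum_cond /=.
apply: eq_big => [ o'| o' _]; last by rewrite mcoeff_linform_hat eval_hat_monom.
rewrite inE; apply: andb_id2l => co'.
rewrite (perm_all _ (msupp_linform c)) all_map.
apply/eqP/allP => [e x|hall].
  rewrite mem_enum inE => cx; rewrite /= !mweight_hat_monom e.
  exact: omin.
apply/eqP; rewrite eq_le (omin _ co') andbT.
by have := hall o; rewrite mem_enum inE /= !mweight_hat_monom => /(_ co).
Qed.

(** Were the condition to fail for [c], all its coefficients of minimal weight would be positive,
    and its initial form could not vanish at a positive real point. *)
Lemma initial_pos_trop (w : 'rV[R]_n) : initial_has_pos_real_pt S w -> pos_trop p U w.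
Proof.
move=> [x [x0 hx]] c hc o co; apply/not_exists2P => hn.
have cS : (fun o => c 0 o != 0) o by rewrite lt0r_neq0.
case: (@Order.TotalTheory.arg_minP _ _ _ o (fun o => c 0 o != 0)
    (fun o => hat0 w 0 o) cS) => om cm hm.
have := initial_linform hx hc cm hm => /(congr1 (@complex.Re R)); rewrite Re_sum /=.
apply/eqP; rewrite gt_eqF //.
have hx0 o' : 0 < hat1 x 0 o'.
  by case: (split_ordP o') => i ->; rewrite ?row_mxEl ?row_mxEr // ord1 mxE.
have E o' : complex.Re (real_complex R (c 0 o') * hatC (toC x) 0 o') = c 0 o' * hat1 x 0 o'.
  have -> : hatC (toC x) 0 o' = real_complex R (hat1 x 0 o').
    case: (split_ordP o') => i ->; rewrite ?row_mxEl ?row_mxEr ?mxE //.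
    by rewrite ord1 eqxx.
  by rewrite Re_mulr_real.
have cpos o' : c 0 o' != 0 -> hat0 w 0 o' = hat0 w 0 om -> 0 < c 0 o'.
  move=> c'0 e; rewrite lt_neqAle eq_sym c'0 leNgt; apply/negP => lt.
  by case: (hn o') => [|h]; [|apply: h; rewrite e; exact: hm].
rewrite (bigD1 om) /=; last by rewrite cm eqxx.
rewrite E ltr_pwDl //; first by rewrite mulr_gt0 // cpos.
by apply: sumr_ge0 => o' /andP[/andP[c' /eqP e] _]; rewrite E ltW // mulr_gt0 // cpos.
Qed.

(* Any 2 + d of the coordinate functions are linearly dependent on the affine space; if
   their weights were distinct, the initial form of the dependency would be a monomial. *)
Lemma initial_weights_repeat (w : 'rV[R]_n) z (f : 'I_(1 + d).+1 -> 'I_(1 + n)) :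
  initial_pt S w z -> exists a b, a != b /\ hat0 w 0 (f a) = hat0 w 0 (f b).
Proof.
move=> hz; apply: contrapT => hn.
have winj a b : hat0 w 0 (f a) = hat0 w 0 (f b) -> a = b.
  by move=> e; apply/eqP; apply: contrapT => /negP ab; apply: hn; exists a, b.
have finj : injective f by move=> a b e; apply: winj; rewrite e.
pose M := colsub f (homog_mx p U).
have : kermx M^T != 0.
  rewrite kermx_eq0 -row_leq_rank -ltnNge (leq_ltn_trans (rank_leq_col _)) //.
case/rowV0Pn => l /sub_kermxP lM l0.
pose c : 'rV[R]_(1 + n) := \row_o \sum_(a | f a == o) l 0 a.
have cf a : c 0 (f a) = l 0 a.
  rewrite mxE (bigD1 a) //= big1 ?addr0 // => b /andP[/eqP/finj -> ].
  by rewrite eqxx.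
have cN o : c 0 o != 0 -> exists a, o = f a.
  move=> h; apply: contrapT => hf; move/eqP: h; apply; rewrite mxE big1 // => a /eqP e.
  by case: hf; exists a.
have hc : affine_rel p U c.
  rewrite /affine_rel; apply: trmx_inj; rewrite trmx_mul trmxK trmx0 -lM.
  apply/rowP => i; rewrite !mxE.
  under eq_bigr do rewrite mxE mulr_suml.
  rewrite (exchange_big_dep xpredT) //=; apply: eq_bigr => a _.
  rewrite (big_pred1 (f a)) ?mxE // => o; by rewrite /= eq_sym.
have [a la] : exists a, l 0 a != 0.
  apply: contrapT => h; move/eqP: l0; apply; apply/rowP => a; rewrite mxE.
  by apply/eqP; apply: contrapT => /negP ha; apply: h; exists a.
have cS : (fun o => c 0 o != 0) (f a) by rewrite cf.
case: (@Order.TotalTheory.arg_minP _ _ _ (f a) (fun o => c 0 o != 0)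
    (fun o => hat0 w 0 o) cS) => om cm hm.
have := initial_linform hz hc cm hm.
rewrite (big_pred1 om) => [|o /=]; last first.
  apply/andP/eqP => [[co /eqP e]|->]; last by rewrite cm eqxx.
  have [a1 e1] := cN _ co; have [a2 e2] := cN _ cm.
  by move: e; rewrite e1 e2 => /winj ->.
move=> /eqP; rewrite mulf_eq0 -[_ == 0]negbK real_complex_neq0 cm /=.
case: hz => hz _; case: (split_ordP om) => i ->; rewrite ?row_mxEl ?row_mxEr.
  by rewrite ord1 mxE eqxx oner_eq0.
by rewrite (negbTE (hz i)).
Qed.

End InitialForms.

(** * Lifting positive tropical points to curves of positive points *)

Lemma cvg_prod_fin (R : realType) (T I : Type) (F : set_system T) (s : seq I)
  (f : I -> T -> R) (l : I -> R) : Filter F -> (forall i, f i x @[x --> F] --> l i) ->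
  \prod_(i <- s) f i x @[x --> F] --> \prod_(i <- s) l i.
Proof.
move=> FF h; apply: (@cvg_big R I *%R 1 xpredT) => //.
by move=> x; apply: cvgM; [exact: cvg_fst|exact: cvg_snd].
Qed.

Lemma cvg_exprn (R : realType) (T : Type) (F : set_system T) (f : T -> R) (l : R) m :
  Filter F -> f x @[x --> F] --> l -> f x ^+ m @[x --> F] --> l ^+ m.
Proof.
move=> FF h; elim: m => [|m IH].
  by under eq_fun do rewrite expr0; exact: cvg_cst.
by under eq_fun do rewrite exprS; rewrite exprS; exact: cvgM.
Qed.

Section LiftingPositivePoints.
Variables (R : realType) (n d : nat) (p : 'rV[R]_n) (U : 'M[R]_(d, n)).
Local Notation C := (complex R).
Local Notation toC := (map_mx (real_complex R)).
Local Notation H := (homog_mx p U).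

(** Gordan's alternative among the vectors of the row space of [H] vanishing at all weights above
    that of [o]. A dual certificate, corrected at those higher weights, would be an affine relation
    that is nonnegative and nonzero at the level of [o] and has no term below it, against
    [pos_trop]. Coordinates of lower weight remain unconstrained. *)
Lemma pos_trop_level (w : 'rV[R]_n) o : pos_trop p U w ->
  exists y : 'rV[R]_(1 + n), [/\ (y <= H)%MS,
    forall o', hat0 w 0 o < hat0 w 0 o' -> y 0 o' = 0 &
    forall o', hat0 w 0 o' = hat0 w 0 o -> 0 < y 0 o'].
Proof.
move=> Tw; set v := hat0 w 0 o.
pose HZ := \matrix_(i, j) (if v < hat0 w 0 j then H i j else 0).
pose A := kermx HZ *m H.
have kerE (x : 'rV[R]_(1 + d)) o' : v < hat0 w 0 o' -> (x *m A) 0 o' = 0.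
  move=> lt; have : x *m kermx HZ *m HZ = 0 by rewrite -mulmxA mulmx_ker mulmx0.
  move=> /matrixP /(_ 0 o'); rewrite [RHS]mxE => <-; rewrite /A mulmxA mxE [RHS]mxE.
  by apply: eq_bigr => i _; rewrite [HZ _ _]mxE lt.
have [[x hx]|[l [l0 lP ln0 lA]]] := gordan A (fun o' => hat0 w 0 o' == v).
  exists (x *m A); split; first by rewrite /A mulmxA submxMl.
  - exact: kerE.
  - by move=> o' /eqP; exact: hx.
exfalso.
have kX : kermx HZ *m (H *m l^T) = 0.
  by rewrite mulmxA -/A; apply: trmx_inj; rewrite trmx_mul trmxK lA trmx0.
(* A functional that vanishes on the kernel of [HZ] factors through [HZ]; [Y] holds the corrections
   at the higher weights. *)
have /submxP [Y hY] : ((H *m l^T)^T <= HZ^T)%MS.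
  rewrite submxE -[cokermx _]trmxK -trmx_mul.
  have /submxP [D ->] : ((cokermx HZ^T)^T <= kermx HZ)%MS.
    by apply/sub_kermxP; apply: trmx_inj; rewrite trmx_mul trmxK mulmx_coker trmx0.
  by rewrite -mulmxA kX mulmx0 trmx0.
pose c := l - \row_j (if v < hat0 w 0 j then Y 0 j else 0).
have cE j : c 0 j = l 0 j - (if v < hat0 w 0 j then Y 0 j else 0).
  rewrite /c [LHS]mxE; congr (_ + _); rewrite [LHS]mxE; congr (- _).
  by rewrite [LHS]mxE.
have hc : affine_rel p U c.
  rewrite /affine_rel /c linearB /= mulmxBr.
  apply: trmx_inj; rewrite linearB /= hY trmx0; apply/eqP; rewrite subr_eq0; apply/eqP.
  apply/rowP => i; rewrite !mxE; apply: eq_bigr => j _; rewrite !mxE.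
  by case: ifP => _; rewrite ?mulr0 ?mul0r // mulrC.
have [i li] : exists i, l 0 i != 0.
  apply: contrapT => h; move/eqP: ln0; apply; apply/rowP => a; rewrite mxE.
  by apply/eqP; apply: contrapT => /negP ha; apply: h; exists a.
have wi : hat0 w 0 i = v by apply/eqP; apply: contraNT li => /lP ->.
have ci : 0 < c 0 i by rewrite cE wi ltxx subr0 lt_neqAle eq_sym li l0.
have [ o' co' le'] := Tw c hc i ci.
have := l0 o'; rewrite leNgt => /negP; apply.
by move: co'; rewrite cE -wi [_ < hat0 w 0 o']ltNge le' /= subr0.
Qed.

Lemma homog_affine (y : 'rV[R]_(1 + n)) : (y <= H)%MS -> 0 < y 0 (lshift n 0) ->
  in_affine p U ((y 0 (lshift n 0))^-1 *: rsubmx y).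
Proof.
move=> /submxP [D hD] y0.
have yl : lsubmx D = (y 0 (lshift n 0))%:M.
  apply/matrixP => a b; rewrite !ord1 [RHS]mxE eqxx mulr1n hD -[D in RHS]hsubmxK.
  by rewrite mul_row_block mulmx1 mulmx0 addr0 row_mxEl.
have yr : rsubmx y = y 0 (lshift n 0) *: p + rsubmx D *m U.
  by rewrite hD -[D in LHS]hsubmxK mul_row_block row_mxKr -hD yl mul_scalar_mx.
rewrite /in_affine yr scalerDr scalerA mulVf ?lt0r_neq0 // scale1r addrAC subrr add0r.
by rewrite scalemxAl submxMl.
Qed.

(* For t = exp(-k), the point sum_o t^(w_o) y_o of the level vectors has the
   coordinate i asymptotic to a positive multiple of t^(w_i). *)
Lemma pos_trop_lift (w : 'rV[R]_n) : pos_trop p U w ->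
  exists (x : nat -> 'rV[R]_n) (zeta : 'rV[R]_n),
  [/\ forall i, 0 < zeta 0 i,
      \forall k \near \oo, in_affine p U (x k) /\ forall i, 0 < x k 0 i &
      forall i, x k 0 i / expR (- w 0 i) ^+ k @[k --> \oo] --> zeta 0 i].
Proof.
move=> Tw.
have /choice [y hy] := fun o => pos_trop_level o Tw.
pose e o := expR (- hat0 w 0 o).
have e0 o : 0 < e o by exact: expR_gt0.
pose X k := \sum_o e o ^+ k *: y o.
(* This is the leading coefficient of the coordinate [j]: level vectors of lower weight vanish
   there, and those of higher weight carry a factor that decays faster. *)
pose c j := \sum_o y o 0 j * (hat0 w 0 o == hat0 w 0 j)%:R.
have XH k : (X k <= H)%MS.
  by apply: summx_sub => o _; apply: scalemx_sub; have [] := hy o.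
have c0 j : 0 < c j.
  rewrite /c (bigD1 j) //= eqxx mulr1 ltr_pwDl //.
    by have [_ _] := hy j; apply.
  apply: sumr_ge0 => o _; case: eqP => [E|]; last by rewrite mulr0.
  by rewrite mulr1 ltW //; have [_ _] := hy o; apply.
have Xc j : X k 0 j / e j ^+ k @[k --> \oo] --> c j.
  rewrite (_ : (fun k => _) = fun k => \sum_o (e o / e j) ^+ k * y o 0 j); last first.
    apply/funext => k; rewrite /X summxE mulr_suml; apply: eq_bigr => o _.
    by rewrite mxE exprMn exprVn mulrAC.
  rewrite (_ : c j = \sum_o (hat0 w 0 o == hat0 w 0 j)%:R * y o 0 j); last first.
    by apply: eq_bigr => o _; rewrite mulrC.
  apply: cvg_sum_fin => o; have [lt|le] := ltP (hat0 w 0 o) (hat0 w 0 j).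
    have [_ h _] := hy o; rewrite (h _ lt) mulr0.
    by under eq_fun do rewrite mulr0; exact: cvg_cst.
  apply: cvgM; last exact: cvg_cst.
  have -> : (hat0 w 0 o == hat0 w 0 j) = (e o / e j == 1).
    rewrite -[RHS](inj_eq (mulIf (lt0r_neq0 (e0 j)))) divfK ?lt0r_neq0 // mul1r.
    by rewrite /e (inj_eq (@expR_inj R)) (inj_eq oppr_inj).
  apply: cvg_geometric_le1; first by rewrite divr_gt0.
  by rewrite ler_pdivrMr // mul1r ler_expR lerN2.
set l0 := lshift n (0 : 'I_1).
have el0 : e l0 = 1 by rewrite /e row_mxEl mxE oppr0 expR0.
have Xpos : \forall k \near \oo, forall j, 0 < X k 0 j.
  apply: filter_forall => j.
  have : \forall k \near \oo, 0 < X k 0 j / e j ^+ k by exact: (cvgr_gt _ (Xc j)).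
  by apply: filterS => k; rewrite pmulr_lgt0 // invr_gt0 exprn_gt0.
exists (fun k => (X k 0 l0)^-1 *: rsubmx (X k)), (\row_i (c (rshift 1 i) / c l0)); split.
- by move=> i; rewrite mxE divr_gt0.
- apply: filterS Xpos => k Xk; split; first exact: homog_affine.
  by move=> i; rewrite !mxE mulr_gt0 ?invr_gt0.
- move=> i; rewrite mxE.
  rewrite (_ : (fun k => _) = fun k => (X k 0 (rshift 1 i) / e (rshift 1 i) ^+ k) *
      (X k 0 l0 / e l0 ^+ k)^-1); last first.
    apply/funext => k; rewrite !mxE el0 expr1n divr1.
    by rewrite /e row_mxEr [RHS]mulrC mulrA.
  by apply: cvgM => //; apply: cvgV => //; rewrite lt0r_neq0.
Qed.

(** Dividing the polynomial identity at [x k] by [expR (- mu) ^+ k] leaves at each monomial a factor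
    [rho m ^+ k], equal to 1 at weight [mu] and tending to 0 at larger weights. Real sequences thus
    do the work of points over a valued field. *)
Lemma initial_form_limit (w zeta : 'rV[R]_n) (x : nat -> 'rV[R]_n)
    (s : seq (mpoly.multinom n)) (a : mpoly.multinom n -> R) (mu : R) :
  (forall i, x k 0 i / expR (- w 0 i) ^+ k @[k --> \oo] --> zeta 0 i) ->
  (forall m, m \in s -> mu <= mweight w m) ->
  (\forall k \near \oo,
     \sum_(m <- s) a m * \prod_i x k 0 i ^+ mpoly.fun_of_multinom m i = 0) ->
  \sum_(m <- s | mweight w m == mu) a m * \prod_i zeta 0 i ^+ mpoly.fun_of_multinom m i = 0.
Proof.
move=> xz smu x0.
pose rho m := expR (- (mweight w m - mu)).
pose F k := \sum_(m <- s) a m * (\prod_i (x k 0 i / expR (- w 0 i) ^+ k) ^+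
   mpoly.fun_of_multinom m i * rho m ^+ k).
have F0 : F k @[k --> \oo] --> (0 : R).
  apply: cvg_near_cst; apply: filterS x0 => k hk.
  rewrite /F -[RHS](mulr0 (expR mu ^+ k)) -[X in _ = _ * X]hk mulr_sumr.
  apply: eq_bigr => m _; rewrite [RHS]mulrCA; congr (_ * _).
  have -> : rho m = expR mu * \prod_i expR (- w 0 i) ^+ mpoly.fun_of_multinom m i.
    rewrite /rho opprB addrC expRD mulrC; congr (_ * _).
    rewrite /mweight -sumrN expR_sum; apply: eq_bigr => i _.
    by rewrite -mulNr expRM_natr.
  rewrite exprMn mulrCA; congr (_ * _).
  rewrite -prodrXl -big_split /=; apply: eq_bigr => i _.
  rewrite -!exprM mulnC exprM -exprMn divfK // expf_neq0 // lt0r_neq0 //.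
  exact: expR_gt0.
have Flim : F k @[k --> \oo] --> \sum_(m <- s) a m *
   (\prod_i zeta 0 i ^+ mpoly.fun_of_multinom m i * (mweight w m == mu)%:R).
  have sub : {subset s <= s} by [].
  rewrite /F; elim: {1 3 4}s sub => [_|m r IH sub].
    by rewrite big_nil; under eq_fun do rewrite big_nil; exact: cvg_cst.
  rewrite big_cons; under eq_fun do rewrite big_cons.
  apply: cvgD; last by apply: IH => m' h; apply: sub; rewrite inE h orbT.
  apply: cvgM; first exact: cvg_cst.
  apply: cvgM.
    apply: cvg_prod_fin => i; exact: cvg_exprn.
  have -> : (mweight w m == mu) = (rho m == 1).
    by rewrite /rho -{1}(expR0 R) (inj_eq (@expR_inj R)) oppr_eq0 subr_eq0.
  apply: cvg_geometric_le1; first exact: expR_gt0.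
  by rewrite -(expR0 R) ler_expR oppr_le0 subr_ge0 smu // sub // inE eqxx.
have := cvg_unique (@norm_hausdorff _ _) Flim F0.
move=> E; rewrite -[RHS]E [RHS](bigID (fun m => mweight w m == mu)) /= [X in _ + X]big1; last first.
  by move=> m /negbTE ->; rewrite !mulr0.
by rewrite addr0; apply: eq_bigr => m ->; rewrite mulr1.
Qed.

Variable S : set 'rV[C]_n.
Hypothesis posS : forall x, in_affine p U x -> (forall i, 0 < x 0 i) -> S (toC x).

Lemma prod_real_complex (x : 'rV[R]_n) (m : mpoly.multinom n) :
  \prod_i toC x 0 i ^+ mpoly.fun_of_multinom m i =
  real_complex R (\prod_i x 0 i ^+ mpoly.fun_of_multinom m i).
Proof.
rewrite rmorph_prod; apply: eq_bigr => i _; rewrite rmorphXn /=.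
by rewrite mxE.
Qed.

(** Every polynomial vanishing on [S] vanishes along the lifted points, so its initial form vanishes
    at their leading coefficients [zeta]. This treats the whole ideal at once, without a tropical
    basis. *)
Lemma pos_trop_initial (w : 'rV[R]_n) : pos_trop p U w -> initial_has_pos_real_pt S w.
Proof.
move=> /pos_trop_lift [x [zeta [zeta0 xA xz]]]; exists zeta; split => //; split.
  by move=> i; rewrite mxE real_complex_neq0 lt0r_neq0.
move=> f fS; rewrite /initial_eval.
have [s0|[m0 m0s]] : mpoly.msupp f = [::] \/ exists m, m \in mpoly.msupp f.
  by case: (mpoly.msupp f) => [|m s]; [left|right; exists m; rewrite inE eqxx].
  by rewrite s0 big_nil.
have [m1 m1s m1min] : exists2 m1, m1 \in mpoly.msupp f &
    forall m, m \in mpoly.msupp f -> mweight w m1 <= mweight w m.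
  elim: (mpoly.msupp f) m0 m0s => // m s IH m0 _.
  case: s IH => [_|m' s /(_ m')]; first by exists m => [|m'']; rewrite inE ?eqxx // => /eqP ->.
  case=> [|m1 h1 h2]; first by rewrite inE eqxx.
  have [le|lt] := leP (mweight w m1) (mweight w m).
    exists m1 => [|m'']; rewrite inE ?h1 ?orbT // => /predU1P[->//|]; exact: h2.
  exists m => [|m'']; rewrite inE ?eqxx // => /predU1P[->//|/h2]; apply: le_trans.
  exact: ltW.
under eq_bigl => m.
  rewrite (_ : all _ _ = (mweight w m <= mweight w m1)); last first.
    apply/allP/idP => [h|h m' /m1min]; [exact: h|exact: le_trans].
  over.
set mu := mweight w m1.
have big_eq (F : mpoly.multinom n -> C) :
   \sum_(m <- mpoly.msupp f | mweight w m <= mu) F m =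
   \sum_(m <- mpoly.msupp f | mweight w m == mu) F m.
  rewrite big_seq_cond [RHS]big_seq_cond; apply: eq_bigl => m.
  by apply: andb_id2l => ms; rewrite eq_le m1min // andbT.
(* The coefficients are complex but the points are real, so real and imaginary parts give two real
   identities, each with its own limit. *)
rewrite big_eq; apply/eqP; rewrite eq_complex Re_sum Im_sum /=.
under eq_bigr do rewrite prod_real_complex Re_mulr_real.
under [X in _ && (X == _)]eq_bigr do rewrite prod_real_complex Im_mulr_real.
have ev k : in_affine p U (x k) -> (forall i, 0 < x k 0 i) ->
    \sum_(m <- mpoly.msupp f) mpoly.mcoeff m f *
      real_complex R (\prod_i x k 0 i ^+ mpoly.fun_of_multinom m i) = 0.
  move=> h1 h2; have := fS _ (posS h1 h2); rewrite mpoly.mevalE => h3.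
  by rewrite -[RHS]h3; apply: eq_bigr => m _; rewrite prod_real_complex.
apply/andP; split; apply/eqP; apply: (initial_form_limit xz) => //.
  apply: filterS xA => k [h1 h2]; have := congr1 (@complex.Re R) (ev k h1 h2).
  rewrite Re_sum /= => h3; rewrite -[RHS]h3; apply: eq_bigr => m _.
  by rewrite Re_mulr_real.
apply: filterS xA => k [h1 h2]; have := congr1 (@complex.Im R) (ev k h1 h2).
rewrite Im_sum /= => h3; rewrite -[RHS]h3; apply: eq_bigr => m _.
by rewrite Im_mulr_real.
Qed.

Lemma pos_trop_affine_point (w : 'rV[R]_n) : pos_trop p U w ->
  exists2 x, in_affine p U x & forall i, 0 < x 0 i.
Proof.
move=> /pos_trop_lift [x [zeta [_ xA _]]].
by have [k [h1 h2]] := filter_ex xA; exists (x k).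
Qed.

End LiftingPositivePoints.

(** * Fan coordinates *)

Section FanCoordinates.
Variables (R : realType) (n k : nat) (V : 'I_k -> 'rV[int]_n) (K : {set {set 'I_k}}).
Hypothesis fanK : complete_unimodular_fan R V K.
Local Notation toR := (map_mx (intr : int -> R)).

Definition rays_mx : 'M[R]_(k, n) := \matrix_(i, j) (V i 0 j)%:~R.

Definition rsupp (a : 'rV[R]_k) : {set 'I_k} := finset (fun i => a 0 i != 0).

Lemma mem_rsupp a i : (i \in rsupp a) = (a 0 i != 0).
Proof. by rewrite finset.in_set. Qed.

Lemma rsupp_subP (a : 'rV[R]_k) (S : {set 'I_k}) :
  reflect (forall i, i \notin S -> a 0 i = 0) (rsupp a \subset S).
Proof.
apply: (iffP fintype.subsetP) => [h i iS|h i].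
  by apply/eqP; apply: contraNT iS => ai; apply: h; rewrite mem_rsupp.
by rewrite mem_rsupp; apply: contraR => /h ->.
Qed.

Lemma row_rays_mx i : row i rays_mx = rayR R V i.
Proof. by apply/rowP => j; rewrite !mxE. Qed.

Lemma mul_rays_mx (a : 'rV[R]_k) : a *m rays_mx = \sum_i a 0 i *: rayR R V i.
Proof. by rewrite mulmx_sum_row; apply: eq_bigr => i _; rewrite row_rays_mx. Qed.

Lemma coneP (S : {set 'I_k}) w : cone V S w <->
  exists a : 'rV[R]_k, [/\ forall i, 0 <= a 0 i, rsupp a \subset S & w = a *m rays_mx].
Proof.
split=> [[a [a0 [aS ->]]]|[a [a0 /rsupp_subP aS ->]]].
  exists (\row_i a i); split => [i||]; first by rewrite mxE.
    by apply/rsupp_subP => i /aS; rewrite mxE.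
  by rewrite mul_rays_mx; apply: eq_bigr => i _; rewrite mxE.
by exists (a 0); rewrite mul_rays_mx.
Qed.

Lemma relint_coneP (S : {set 'I_k}) w : relint_cone V S w <->
  exists a : 'rV[R]_k, [/\ forall i, 0 <= a 0 i, rsupp a = S & w = a *m rays_mx].
Proof.
split=> [[a [a0 [aS ->]]]|[a [a0 aS ->]]].
  exists (\row_i a i); split => [i||].
  - by rewrite mxE; have [/a0/ltW//|/aS ->] := boolP (i \in S).
  - apply/setP => i; rewrite mem_rsupp mxE; have [/a0/lt0r_neq0//|/aS ->] := boolP (i \in S).
    by rewrite eqxx.
  - by rewrite mul_rays_mx; apply: eq_bigr => i _; rewrite mxE.
exists (a 0); rewrite mul_rays_mx; split => // [i|]; last first.
  by split => // i; rewrite -aS mem_rsupp negbK => /eqP.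
by rewrite -aS mem_rsupp lt_neqAle eq_sym a0 => ->.
Qed.

Lemma unimodular_basis (S : {set 'I_k}) : S \in K ->
  exists (P Pi : 'M[int]_n) (g : 'I_k -> 'I_n),
   [/\ P *m Pi = 1%:M, Pi *m P = 1%:M, {in S &, injective g} &
       forall i, i \in S -> row (g i) P = V i].
Proof.
move=> /(proj1 fanK) [P [g [Pu [ginj gP]]]].
by exists P, (invmx P), g; rewrite mulmxV // mulVmx.
Qed.

Lemma unimodular_dual (S : {set 'I_k}) (P Pi : 'M[int]_n) (g : 'I_k -> 'I_n) i j :
  P *m Pi = 1%:M -> (forall i, i \in S -> row (g i) P = V i) -> i \in S ->
  (V i *m Pi) 0 j = (g i == j)%:R.
Proof. by move=> h gP /gP <-; rewrite -row_mul h !mxE. Qed.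

(** Unimodularity makes the coordinates on a cone the restriction of a linear map of the whole
    space. Uniqueness, closedness of the cone and Lipschitz bounds all follow from this. *)
Lemma cone_coord_mx (S : {set 'I_k}) : S \in K ->
  exists C : 'M[R]_(n, k), (forall w : 'rV[R]_n, rsupp (w *m C) \subset S) /\
    forall a : 'rV[R]_k, rsupp a \subset S -> a *m rays_mx *m C = a.
Proof.
move=> /unimodular_basis [P [Pi [g [PPi _ ginj gP]]]].
exists (\matrix_(j, i) if i \in S then (Pi j (g i))%:~R else 0); split => [w|a /rsupp_subP aS].
  apply/rsupp_subP => i /negbTE iS; rewrite mxE big1 // => j _.
  by rewrite mxE iS mulr0.
apply/rowP => i; rewrite -mulmxA mxE.
have [iS|iS] := boolP (i \in S); last first.
  rewrite aS // big1 // => l _; rewrite mxE big1 ?mulr0 // => j _.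
  by rewrite [X in _ * X]mxE (negbTE iS) mulr0.
have E l : l \in S -> (rays_mx *m \matrix_(j, i) (if i \in S then (Pi j (g i))%:~R else 0)) l i =
    (l == i)%:R :> R.
  move=> lS; have := unimodular_dual (g i) PPi gP lS.
  rewrite (inj_in_eq ginj) // mxE => /(congr1 (fun z : int => z%:~R : R)) h.
  transitivity (((l == i)%:R : int)%:~R : R); last by case: (l == i).
  rewrite -h rmorph_sum mxE; apply: eq_bigr => j _.
  by rewrite !mxE iS rmorphM.
rewrite (bigD1 i) //= E // eqxx mulr1 big1 ?addr0 // => l li.
have [lS|lS] := boolP (l \in S); first by rewrite E // (negbTE li) mulr0.
by rewrite aS // mul0r.
Qed.

Lemma fan_face (S S' : {set 'I_k}) : S \in K -> S' \subset S -> S' \in K.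
Proof. by have [_ [h _]] := fanK; exact: h. Qed.

Lemma cone_coord_uniq (S : {set 'I_k}) (a b : 'rV[R]_k) : S \in K ->
  rsupp a \subset S -> rsupp b \subset S -> a *m rays_mx = b *m rays_mx -> a = b.
Proof.
by move=> /cone_coord_mx [C [_ hC]] aS bS e; rewrite -(hC _ aS) e hC.
Qed.

Definition fan_point (a : 'rV[R]_k) : Prop := (forall i, 0 <= a 0 i) /\ rsupp a \in K.

Lemma cone_fan_point (S : {set 'I_k}) w : S \in K -> cone V S w ->
  exists a, [/\ fan_point a, rsupp a \subset S & w = a *m rays_mx].
Proof.
move=> SK /coneP [a [a0 aS ->]]; exists a; split => //; split => //.
exact: fan_face SK aS.
Qed.

Lemma fan_point_exists w : exists a, fan_point a /\ a *m rays_mx = w.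
Proof.
have [_ [_ [_ /(_ w) [S SK Sw]]]] := fanK.
by have [a [a1 _ ->]] := cone_fan_point SK Sw; exists a.
Qed.

(** The common point lies in the intersection of the two cones, which is the cone over the shared
    rays; both vectors agree with its coordinates there. *)
Lemma fan_point_uniq a b : fan_point a -> fan_point b ->
  a *m rays_mx = b *m rays_mx -> a = b.
Proof.
move=> [a0 aK] [b0 bK] e; have [_ [_ [h _]]] := fanK.
have : (cone V (rsupp a) `&` cone V (rsupp b)) (a *m rays_mx).
  by split; apply/coneP; [exists a|exists b].
rewrite h // => /coneP [c [c0 cab ec]].
rewrite (_ : a = c); last first.
  by apply: (cone_coord_uniq aK) => //; apply: fintype.subset_trans cab (finset.subsetIl _ _).
apply: (cone_coord_uniq bK) => //; last by rewrite -ec.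
by apply: fintype.subset_trans cab (finset.subsetIr _ _).
Qed.

Definition fan_coord w : 'rV[R]_k := sval (cid (fan_point_exists w)).

Lemma fan_coordP w : fan_point (fan_coord w).
Proof. by have [] := svalP (cid (fan_point_exists w)). Qed.

Lemma fan_coordK w : fan_coord w *m rays_mx = w.
Proof. by have [] := svalP (cid (fan_point_exists w)). Qed.

Lemma fan_coord_uniq a : fan_point a -> fan_coord (a *m rays_mx) = a.
Proof. by move=> ha; apply: fan_point_uniq => //; [exact: fan_coordP|rewrite fan_coordK]. Qed.

Lemma cone_fan_coord (S : {set 'I_k}) w : S \in K ->
  cone V S w <-> rsupp (fan_coord w) \subset S.
Proof.
move=> SK; split=> [/(cone_fan_point SK) [a [ha aS ->]]|h].
  by rewrite fan_coord_uniq.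
by apply/coneP; exists (fan_coord w); rewrite fan_coordK; have [] := fan_coordP w.
Qed.

Lemma rsuppZ t (a : 'rV[R]_k) : rsupp (t *: a) \subset rsupp a.
Proof. by apply/rsupp_subP => i; rewrite mem_rsupp negbK mxE => /eqP ->; rewrite mulr0. Qed.

Lemma fan_pointZ t a : 0 <= t -> fan_point a -> fan_point (t *: a).
Proof.
move=> t0 [a0 aK]; split => [i|]; first by rewrite mxE mulr_ge0.
exact: fan_face aK (rsuppZ _ _).
Qed.

Lemma fan_coordZ t w : 0 <= t -> fan_coord (t *: w) = t *: fan_coord w.
Proof.
move=> t0; rewrite -{1}[w]fan_coordK scalemxAl fan_coord_uniq //.
by apply: fan_pointZ => //; exact: fan_coordP.
Qed.

Lemma cone_closed (S : {set 'I_k}) : S \in K -> closed [set w : 'rV[R]_n | cone V S w].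
Proof.
move=> SK; have [C [CS hC]] := cone_coord_mx SK.
rewrite (_ : [set _ | _] = [set w : 'rV[R]_n | forall i, 0 <= (w *m C) 0 i] `&`
    [set w : 'rV[R]_n | w *m (C *m rays_mx - 1%:M) = 0]); last first.
  rewrite predeqE => w; split=> [/coneP [a [a0 aS ->]]|[h0 h1]].
    split => [i|] /=; first by rewrite hC.
    by rewrite mulmxBr mulmx1 mulmxA hC // subrr.
  apply/coneP; exists (w *m C); split => //.
  by apply/esym/eqP; rewrite -subr_eq0 -mulmxA -[X in _ - X]mulmx1 -mulmxBr h1.
apply: closedI; last first.
  by apply: (closed_mulmx_eq (f := id)) => i; exact: continuous_coord.
apply: closed_forall => i; apply: closed_le_fun; first exact: cst_continuous.
move=> w; apply: (@continuous_comp _ _ _ (fun w : 'rV[R]_n => w *m C) (fun y => y 0 i)).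
  exact: mulmx_continuous.
exact: continuous_coord.
Qed.

(** The cones are finitely many and closed, so near [w0] only those through [w0] are met, and each
    has linear coordinates. The first conclusion says that supports can only grow near [w0]; it
    later controls neighbourhoods of points at infinity. *)
Lemma fan_coord_local (w0 : 'rV[R]_n) : exists del L : R, [/\ 0 < del, 0 < L &
  forall w, `|w - w0| < del ->
    (forall S, S \in K -> cone V S w -> cone V S w0) /\
    `|fan_coord w - fan_coord w0| <= L * `|w - w0|].
Proof.
have /choice [f hf] : forall S : {set 'I_k}, exists dL : R * R, [/\ 0 < dL.1, 0 < dL.2 &
    S \in K -> forall w, `|w - w0| < dL.1 -> cone V S w ->
      cone V S w0 /\ `|fan_coord w - fan_coord w0| <= dL.2 * `|w - w0|].
  move=> S; have [SK|SK] := boolP (S \in K); last by exists (1, 1).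
  have [C [CS hC]] := cone_coord_mx SK.
  have [L L0 hL] := mulmx_norm_bound 1 C.
  have [Sw0|nSw0] := pselect (cone V S w0).
    exists (1, L); split => // _ w _ Sw; split => //.
    rewrite -(hC (fan_coord w)); last exact/cone_fan_coord.
    rewrite -(hC (fan_coord w0)); last exact/cone_fan_coord.
    by rewrite !fan_coordK -mulmxBl.
  have : exists2 e : R, 0 < e & forall w, `|w - w0| < e -> ~ cone V S w.
    apply: contrapT => h; apply: nSw0; apply: (closed_norm_ltE (cone_closed SK)) => e e0.
    apply: contrapT => h2; apply: h; exists e => // w we Sw; apply: h2; exists w => //.
  case=> e e0 he; exists (e, 1); split => // _ w we Sw.
  by case: (he w we).
have [del del0 hdel] : exists2 g : R, 0 < g & forall S : {set 'I_k}, predT S -> g <= (f S).1.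
  by apply: fin_pos_lower_bound => S _; have [] := hf S.
pose L := \sum_S (f S).2.
have hL S : (f S).2 <= L.
  rewrite /L (bigD1 S) //= lerDl sumr_ge0 // => S' _; apply: ltW.
  by have [] := hf S'.
have [S SK Sw0] := proj2 (proj2 (proj2 fanK)) w0.
exists del, L; split => //; first by apply: lt_le_trans (hL S); have [] := hf S.
move=> w hw; have [S' S'K S'w] := proj2 (proj2 (proj2 fanK)) w.
have near_w0 S1 : S1 \in K -> cone V S1 w ->
    cone V S1 w0 /\ `|fan_coord w - fan_coord w0| <= (f S1).2 * `|w - w0|.
  move=> S1K S1w; have [_ _ h] := hf S1.
  exact: h S1K w (lt_le_trans hw (hdel _ erefl)) S1w.
split => [S1 S1K S1w|]; first by have [] := near_w0 S1 S1K S1w.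
by have [_ /le_trans] := near_w0 S' S'K S'w; apply; rewrite ler_wpM2r.
Qed.

Lemma fan_coord_continuous : continuous fan_coord.
Proof.
move=> w0; apply/continuous_norm_ltP => e e0.
have [del [L [d0 L0 h]]] := fan_coord_local w0.
exists (Num.min del (e / L)); first by rewrite lt_min d0 divr_gt0.
move=> w; rewrite lt_min => /andP[wd we]; apply: le_lt_trans (proj2 (h w wd)) _.
by rewrite mulrC -ltr_pdivlMr.
Qed.

End FanCoordinates.

(** * The positive part of the tropicalization *)

Lemma generic_point (R : realType) m (s : seq 'cV[R]_m) (x0 : 'rV[R]_m) (e : R) :
  0 < e -> (forall c, c \in s -> c != 0) ->
  exists2 x, `|x - x0| < e & forall c, c \in s -> x *m c != 0.
Proof.
move=> e0 hs.
(* The induction carries a whole ball, so that moving off the next hyperplane does not fall back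
   onto an earlier one. *)
suff [x [del [d0 hx hc]]] : exists x (del : R), [/\ 0 < del,
    forall y, `|y - x| < del -> `|y - x0| < e &
    forall y, `|y - x| < del -> forall c, c \in s -> y *m c != 0].
  by exists x; [apply: hx|apply: hc]; rewrite subrr normr0.
elim: s hs => [_|c s IH hs]; first by exists x0, e.
have [c' h|x [del [d0 hx hc]]] := IH; first by apply: hs; rewrite inE h orbT.
have c0 : c != 0 by apply: hs; rewrite inE eqxx.
have [x' xx' x'c] : exists2 x', `|x' - x| < del & x' *m c != 0.
  have [xc|xc] := eqVneq (x *m c) 0; last by exists x => //; rewrite subrr normr0.
  have n0 : 0 < `|c^T| by rewrite normr_gt0 trmx_eq0.
  exists (x + (del / 2 / `|c^T|) *: c^T).
    rewrite addrAC subrr add0r normrZ gtr0_norm ?divr_gt0 // divfK ?lt0r_neq0 //.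
    by rewrite ltr_pdivrMr //; lra.
  rewrite mulmxDl xc add0r -scalemxAl scaler_eq0 negb_or lt0r_neq0 ?divr_gt0 //=.
  apply: contra c0 => /eqP /matrixP /(_ 0 0); rewrite !mxE => /eqP.
  rewrite psumr_eq0 => [/allP h|i _]; last by rewrite mxE -expr2 sqr_ge0.
  apply/eqP/colP => i; rewrite [RHS]mxE; apply/eqP.
  by have /= := h i (mem_index_enum _); rewrite mxE mulf_eq0 orbb.
have [C C0 hC] := mulmx_norm_bound 1 c.
exists x', (Num.min (del - `|x' - x|) (`|x' *m c| / C)); split.
- by rewrite lt_min subr_gt0 xx' divr_gt0 // normr_gt0.
- move=> y; rewrite lt_min => /andP[h _]; apply: hx.
  by rewrite -(subrK x' y) -addrA (le_lt_trans (ler_normD _ _)) // -ltrBrDr.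
- move=> y; rewrite lt_min => /andP[h1 h2] c'; rewrite inE => /predU1P[->|]; last first.
    by apply: hc; rewrite -(subrK x' y) -addrA (le_lt_trans (ler_normD _ _)) // -ltrBrDr.
  apply/eqP => yc; have := hC (y - x').
  rewrite mulmxBl yc sub0r normrN leNgt => /negP; apply.
  by rewrite mulrC -ltr_pdivlMr.
Qed.

Section PositivePart.
Variables (R : realType) (n d k : nat) (V : 'I_k -> 'rV[int]_n) (K : {set {set 'I_k}}).
Hypothesis fanK : complete_unimodular_fan R V K.
Variables (p : 'rV[R]_n) (U : 'M[R]_(d, n)) (X : set 'rV[complex R]_n).
Local Notation toC := (map_mx (real_complex R)).
Hypothesis XsubC : forall z, X z -> exists y : 'rV[complex R]_d, z = toC p + y *m toC U.

Definition cone_rays (S : {set 'I_k}) : 'M[R]_(#|S|, n) := rowsub enum_val (rays_mx R V).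

Lemma supp_cone_rays (S : {set 'I_k}) (a : 'rV[R]_k) : rsupp a \subset S ->
  a *m rays_mx R V = (\row_i a 0 (enum_val i)) *m cone_rays S.
Proof.
move=> /rsupp_subP aS; apply/rowP => j; rewrite !mxE.
rewrite (bigID (mem S)) /= [X in _ + X]big1 ?addr0; last first.
  by move=> i /aS ->; rewrite mul0r.
by rewrite big_enum_val /=; apply: eq_bigr => i _; rewrite !mxE.
Qed.

Lemma cone_rays_free (S : {set 'I_k}) : S \in K -> row_free (cone_rays S).
Proof.
move=> SK; apply/inj_row_free => v hv.
pose a : 'rV[R]_k := \row_i \sum_(l | enum_val l == i) v 0 l.
have av l : a 0 (enum_val l) = v 0 l.
  rewrite mxE (bigD1 l) //= big1 ?addr0 // => l' /andP[/eqP/enum_val_inj ->].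
  by rewrite eqxx.
have aS : rsupp a \subset S.
  apply/rsupp_subP => i iS; rewrite mxE big1 // => l /eqP e.
  by move: iS; rewrite -e enum_valP.
have a0 : a = 0.
  apply: (cone_coord_uniq fanK SK aS).
    by apply/rsupp_subP => i _; rewrite mxE.
  rewrite mul0mx (supp_cone_rays aS) -[RHS]hv; congr (_ *m _).
  by apply/rowP => l; rewrite mxE av.
by apply/rowP => l; rewrite -av a0 !mxE.
Qed.

Lemma cone_mul_rays (S : {set 'I_k}) (a : 'rV[R]_#|S|) : (forall i, 0 <= a 0 i) ->
  cone V S (a *m cone_rays S).
Proof.
move=> a0; apply/coneP.
exists (\row_i \sum_(l | enum_val l == i) a 0 l); split => [i||].
- by rewrite mxE sumr_ge0.
- apply/rsupp_subP => i iS; rewrite mxE big1 // => l /eqP e.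
  by move: iS; rewrite -e enum_valP.
- rewrite (@supp_cone_rays S); last first.
    apply/rsupp_subP => i iS; rewrite mxE big1 // => l /eqP e.
    by move: iS; rewrite -e enum_valP.
  congr (_ *m _); apply/rowP => l; rewrite !mxE (bigD1 l) //= big1 ?addr0 //.
  by move=> l' /andP[/eqP/enum_val_inj ->]; rewrite eqxx.
Qed.

(** On a cone with more than [d] rays, [d + 1] coordinates are linearly independent, and a generic
    point gives them distinct nonzero weights. With the weight 0 of the constant these are [d + 2]
    distinct weights, against [initial_weights_repeat]. *)
Lemma cone_trop_dim (S : {set 'I_k}) : S \in K -> cone V S `<=` Trop X -> (#|S| <= d)%N.
Proof.
move=> SK SX; rewrite leqNgt; apply/negP => dS.
have full : row_full (cone_rays S)^T by rewrite /row_full mxrank_tr; exact: cone_rays_free.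
pose J := fullrankfun full.
pose wd (b : 'I_(1 + d)) : 'I_#|S| := widen_ord dS b.
have unitJ : colsub J (cone_rays S) \in unitmx.
  rewrite -unitmx_tr -row_full_unit.
  have := fullrowsub_full full; rewrite -/J.
  by congr row_full; apply/matrixP => i j; rewrite !mxE.
pose c b := colsub J (cone_rays S) *m (delta_mx b 0 : 'cV[R]_#|S|).
have cinj v : colsub J (cone_rays S) *m v = 0 -> v = 0 :> 'cV[R]_#|S|.
  by move=> h; rewrite -[v](mulKmx unitJ) h mulmx0.
pose s := [seq c (wd b) | b <- enum 'I_(1 + d)] ++
  [seq c (wd bb.1) - c (wd bb.2) | bb <- enum [pred bb : 'I_(1 + d) * 'I_(1 + d) | bb.1 != bb.2]].
have hs v : v \in s -> v != 0.
  rewrite mem_cat => /orP[/mapP [b _ ->]|/mapP [[b b'] hb ->]].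
    apply/eqP => /cinj /matrixP /(_ (wd b) 0); rewrite !mxE !eqxx => /eqP.
    by rewrite oner_eq0.
  move: hb; rewrite mem_enum inE /= => bb'.
  rewrite /c -mulmxBr; apply/eqP => /cinj /matrixP /(_ (wd b) 0); rewrite !mxE !eqxx /=.
  have -> : (wd b == wd b') = false.
    by apply/negbTE; apply: contra bb' => /eqP /(congr1 val) /= e; apply/eqP/val_inj.
  by rewrite subr0 => /eqP; rewrite oner_eq0.
(* Radius 1 around the all-ones vector keeps the coefficients positive, hence the point in the
   cone. *)
have [a ha1 ha2] := generic_point (const_mx 1) (ltr01 : 0 < (1 : R)) hs.
have a0 i : 0 <= a 0 i.
  have := le_lt_trans (mx_norm_entry _ 0 i) ha1; rewrite !mxE ltr_norml => /andP[h _].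
  by rewrite ltW //; lra.
have [z hz] := SX _ (cone_mul_rays a0).
set w := a *m cone_rays S in hz.
have wc b : (a *m c (wd b)) = (w 0 (J (wd b)))%:M.
  apply/matrixP => x y; rewrite !ord1 /c mulmxA -colE !mxE eqxx mulr1n.
  by apply: eq_bigr => l _; rewrite !mxE.
pose f (i : 'I_(1 + d).+1) : 'I_(1 + n) :=
  if unlift ord0 i is Some b then rshift 1 (J (wd b)) else lshift n 0.
have [i [i' [ii' e]]] := initial_weights_repeat XsubC f hz.
have w0 b : w 0 (J (wd b)) != 0.
  apply/eqP => h; have : c (wd b) \in s.
    by rewrite mem_cat; apply/orP; left; apply/mapP; exists b; rewrite ?mem_enum.
  by move=> /ha2; rewrite wc h -scalemx1 scale0r eqxx.
have ww b b' : b != b' -> w 0 (J (wd b)) != w 0 (J (wd b')).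
  move=> bb'; apply/eqP => h; have : c (wd b) - c (wd b') \in s.
    rewrite mem_cat; apply/orP; right; apply/mapP; exists (b, b') => //.
    by rewrite mem_enum inE.
  by move=> /ha2; rewrite mulmxBr !wc h subrr eqxx.
move: e ii'; rewrite /f; case: unliftP => [b ->|->]; case: unliftP => [b' ->|->].
- rewrite !row_mxEr => e; rewrite (inj_eq lift_inj) => /ww.
  by rewrite e eqxx.
- by rewrite row_mxEr row_mxEl [X in _ = X]mxE => e; have := w0 b; rewrite e eqxx.
- by rewrite row_mxEr row_mxEl [X in X = _]mxE => e; have := w0 b'; rewrite -e eqxx.
- by rewrite eqxx.
Qed.

End PositivePart.

Section PositivePartIsPosTrop.
Variables (R : realType) (n d k : nat) (V : 'I_k -> 'rV[int]_n) (K : {set {set 'I_k}}).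
Hypothesis fanK : complete_unimodular_fan R V K.
Variables (p : 'rV[R]_n) (U : 'M[R]_(d, n)) (X : set 'rV[complex R]_n).
Local Notation toC := (map_mx (real_complex R)).
Hypothesis freeU : row_free U.
Hypothesis XsubC : forall z, X z -> exists y : 'rV[complex R]_d, z = toC p + y *m toC U.
Hypothesis posX : forall x, in_affine p U x -> (forall i, 0 < x 0 i) -> X (toC x).
Hypothesis tropX : forall w, Trop X w ->
     exists2 S, S \in K & cone V S `<=` Trop X /\ cone V S w.
Variable x0 : 'rV[R]_n.
Hypothesis affx0 : in_affine p U x0.
Hypothesis posx0 : forall i, 0 < x0 0 i.
Local Notation T := (pos_trop p U).
Local Notation sec := (pos_section freeU affx0 posx0).
Local Notation rays := (cone_rays R V).

Lemma pos_trop_in_cone w : T w ->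
  exists S, [/\ S \in K, cone V S `<=` Trop X, cone V S w & (#|S| <= d)%N].
Proof.
move=> /(pos_trop_initial posX) [x [_ hx]].
have [S SK [SX Sw]] := tropX (ex_intro _ _ hx).
by exists S; split => //; exact: (cone_trop_dim fanK XsubC SK SX).
Qed.

(* The section is continuous, and near w the tropicalization is just the cone S, so the section
   follows the span of S there. *)
Lemma pos_trop_relint_open (S : {set 'I_k}) (w : 'rV[R]_n) : S \in K -> #|S| = d ->
  row_free (rays S *m U^T) -> relint_cone V S w -> T w ->
  exists2 e : R, 0 < e & forall w', `|w' - w| < e -> relint_cone V S w' -> T w'.
Proof.
move=> SK Sd freeS Sw Tw.
have suppw u : relint_cone V S u -> rsupp (fan_coord fanK u) = S.
  move=> /relint_coneP [a [a0 aS ->]]; rewrite fan_coord_uniq //.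
  by split; rewrite // aS.
have [del [L [d0 _ hdel]]] := fan_coord_local fanK w.
have /continuous_norm_ltP /(_ del d0) [e e0 he] :=
  @pos_section_continuous _ _ _ p U freeU x0 affx0 posx0 (w *m U^T).
have [C C0 hC] := mulmx_norm_bound 1 U^T.
exists (e / C); first by rewrite divr_gt0.
move=> w' w'w Sw'.
pose y := sec (w' *m U^T).
have Ty : T y by exact: pos_sectionP.
have yw : `|y - w| < del.
  rewrite [X in _ - X](pos_section_uniq freeU affx0 posx0 Tw); apply: he.
  by rewrite -mulmxBl (le_lt_trans (hC _)) // mulrC -ltr_pdivlMr.
have [S' [S'K _ S'y S'd]] := pos_trop_in_cone Ty.
have S'w : cone V S' w by have [h _] := hdel _ yw; exact: h.
(* The support of [w] is [S] and [w] lies in the cone of [S'], so [S] is a face of [S']; the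
   dimension bound on [S'] makes them equal. *)
have SS' : S = S'.
  apply/eqP; rewrite finset.eqEcard Sd S'd andbT -(suppw w) //.
  exact/(cone_fan_coord fanK).
suff -> : w' = y by [].
have [a hay] : exists a, y = a *m rays S.
  have /coneP [b [_ bS ->]] := S'y; rewrite -SS' in bS.
  by rewrite (supp_cone_rays V bS); eexists; reflexivity.
have [a' haw] : exists a, w' = a *m rays S.
  have /relint_coneP [b [_ bS ->]] := Sw'.
  rewrite (@supp_cone_rays R n k V S b) ?bS //.
  by eexists; reflexivity.
rewrite haw hay; congr (_ *m _).
apply: (row_free_inj freeS); rewrite !mulmxA -hay -haw.
by rewrite /y pos_sectionK.
Qed.

Lemma pos_trop_relint (S : {set 'I_k}) (w w' : 'rV[R]_n) : S \in K -> #|S| = d ->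
  row_free (rays S *m U^T) -> relint_cone V S w -> T w -> relint_cone V S w' -> T w'.
Proof.
move=> SK Sd freeS Sw Tw Sw'.
pose g (t : R) := w + t *: (w' - w).
have gS t : 0 <= t -> t <= 1 -> relint_cone V S (g t).
  move=> t0 t1; have /relint_coneP [a [a0 aS aw]] := Sw.
  have /relint_coneP [b [b0 bS bw]] := Sw'.
  apply/relint_coneP; exists (a + t *: (b - a)).
  have E i : (a + t *: (b - a)) 0 i = (1 - t) * a 0 i + t * b 0 i by rewrite !mxE; ring.
  have t1' : 0 <= 1 - t by rewrite subr_ge0.
  split => [i||].
  - by rewrite E addr_ge0 // mulr_ge0.
  - apply/setP => i; rewrite mem_rsupp E; have [iS|iS] := boolP (i \in S).
      have ai : 0 < a 0 i by rewrite lt_neqAle eq_sym -mem_rsupp aS iS a0.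
      have bi : 0 < b 0 i by rewrite lt_neqAle eq_sym -mem_rsupp bS iS b0.
      rewrite lt0r_neq0 //; have [->|tn] := eqVneq t 0; first by rewrite subr0 mul1r mul0r addr0.
      by rewrite ltr_wpDl ?mulr_ge0 // mulr_gt0 // lt_neqAle eq_sym tn.
    have /rsupp_subP -> // : rsupp a \subset S by rewrite aS.
    have /rsupp_subP -> // : rsupp b \subset S by rewrite bS.
    by rewrite !mulr0 addr0 eqxx.
  - by rewrite /g aw bw mulmxDl -scalemxAl mulmxBl.
have gcont : continuous g.
  move=> t; rewrite /continuous_at /g; apply: cvgD; first exact: cvg_cst.
  exact: scalel_continuous.
pose C := [set t : R | T (g t)].
have Ccl : closed C.
  apply: (@closed_comp _ _ g [set w | T w]); first by move=> t _; exact: gcont.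
  exact: pos_trop_closed.
(* [O] is open in the whole line and has the same trace on [[0, 1]] as the closed set [C]. *)
pose O := [set t : R | exists2 e : R, 0 < e &
   forall t', `|t' - t| < e -> 0 <= t' -> t' <= 1 -> T (g t')].
have Oop : open O.
  rewrite openE => t [e e0 he]; apply/nbhs_ballP; exists (e / 2) => /=.
    by rewrite divr_gt0.
  move=> s; rewrite /ball /= => st; exists (e / 2); first by rewrite divr_gt0.
  move=> t' t's; apply: he; rewrite -(subrK s t') -addrA (le_lt_trans (ler_normD _ _)) //.
  by rewrite (splitr e) ltrD // distrC.
have E : `[0, 1]%classic `&` C = `[0, 1]%classic.
  apply: (@segment_connected R 0 1).
  - exists 0; split; first by rewrite /= in_itv /= lexx ler01.
    by rewrite /C /= /g scale0r addr0.
  - exists O => //; rewrite predeqE => t; split => [[h1 h2]|[h1 [e e0 he]]]; split => //.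
      move: h1; rewrite /= in_itv /= => /andP[t0 t1].
      have [e e0 he] := pos_trop_relint_open SK Sd freeS (gS t t0 t1) h2.
      have W0 : 0 < `|w' - w| + 1 by rewrite ltr_wpDl.
      exists (e / (`|w' - w| + 1)); first by rewrite divr_gt0.
      move=> t' tt' t'0 t'1; apply: he; last exact: gS.
      rewrite /g addrAC opprD addrA subrr add0r addrC -scalerBl normrZ.
      have := tt'; rewrite ltr_pdivlMr // => /le_lt_trans; apply.
      by rewrite ler_wpM2l // lerDl.
    by move: h1; rewrite /= in_itv /= => /andP[t0 t1]; apply: he; rewrite ?subrr ?normr0.
  - by exists C.
have h1 : `[0, 1]%classic (1 : R) by rewrite /= in_itv /= lexx ler01.
by move: h1; rewrite -E => -[_]; rewrite /C /= /g scale1r addrC subrK.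
Qed.

Lemma Rpos_closed : closed [set w : 'rV[R]_n | Rpos V K X d w].
Proof.
rewrite (_ : [set w | _] = \bigcup_(S in [set S : {set 'I_k} | [/\ S \in K, #|S| = d,
   cone V S `<=` Trop X & forall w', relint_cone V S w' -> initial_has_pos_real_pt X w']])
   [set w : 'rV[R]_n | cone V S w]); last first.
  rewrite predeqE => w; split=> [[S SK [Sd SX Sp Sw]]|[S [SK Sd SX Sp] Sw]]; first by exists S.
  by exists S.
apply: closed_bigcup => [|S [SK _ _ _]]; first exact: finite_finset.
exact: (cone_closed fanK SK).
Qed.

Lemma Rpos_pos_trop w : Rpos V K X d w -> T w.
Proof.
move=> [S SK [Sd SX Sp /coneP [a [a0 aS ->]]]].
(* Adding a small multiple of the sum of the rays of [S] moves the point into the relative interior,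
   where positivity is given. *)
pose b : 'rV[R]_k := \row_i (i \in S)%:R.
apply: (closed_norm_ltE (@pos_trop_closed _ _ _ p U)) => e e0.
have W0 : 0 < `|b *m rays_mx R V| + 1 by rewrite ltr_wpDl.
have e1 : 0 < e / (`|b *m rays_mx R V| + 1) by rewrite divr_gt0.
exists ((a + (e / (`|b *m rays_mx R V| + 1) / 2) *: b) *m rays_mx R V).
  apply: (initial_pos_trop XsubC); apply: Sp; apply/relint_coneP.
  exists (a + (e / (`|b *m rays_mx R V| + 1) / 2) *: b); split => // [i|].
    by rewrite !mxE addr_ge0 // mulr_ge0 // ltW // divr_gt0.
  apply/setP => i; rewrite mem_rsupp !mxE; have [iS|iS] := boolP (i \in S).
    by rewrite mulr1 lt0r_neq0 // ltr_wpDl // divr_gt0.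
  by have /rsupp_subP -> // := aS; rewrite mulr0 addr0 eqxx.
rewrite mulmxDl addrAC subrr add0r -scalemxAl normrZ gtr0_norm ?divr_gt0 //.
have : e / (`|b *m rays_mx R V| + 1) * (`|b *m rays_mx R V| + 1) = e.
  by rewrite divfK // lt0r_neq0.
move: W0 e1; set N := `|_|; set q := e / _ => W0 e1 h.
have N0 : 0 <= N by rewrite /N.
nra.
Qed.

(** Choose [xi'] off finitely many hyperplanes containing the images of the cones whose rays do not
    span after projection. The smallest cone through the section then has at least [d] rays; it is a
    face of a cone with at most [d], hence equal to it. *)
Lemma Rpos_dense (xi : 'rV[R]_d) (e : R) : 0 < e ->
  exists2 xi', `|xi' - xi| < e & Rpos V K X d (sec xi').
Proof.
move=> e0.
pose Q S := rays S *m U^T.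
have /choice [c hc] : forall S : {set 'I_k}, exists c : 'cV[R]_d,
    (\rank (Q S) < d)%N -> c != 0 /\ Q S *m c = 0.
  move=> S; have [h|h] := ltnP (\rank (Q S)) d; last by exists 0.
  have : cokermx (Q S) != 0.
    by rewrite -mxrank_eq0 mxrank_coker -lt0n subn_gt0.
  move=> /eqP ck; apply: contrapT => h2; apply: ck; apply/matrixP => i j; rewrite mxE.
  apply/eqP; apply: contrapT => /negP ij; apply: h2; exists (col j (cokermx (Q S))) => _.
  split; last by rewrite -[col _ _]/(col j (cokermx _)) colE mulmxA mulmx_coker mul0mx.
  by apply: contra ij => /eqP /matrixP /(_ i 0); rewrite !mxE => ->.
pose s := [seq c S0 | S0 <- enum [pred S0 | (\rank (Q S0) < d)%N]].
have hs v : v \in s -> v != 0.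
  by move=> /mapP [S]; rewrite mem_enum inE => /hc [h _] ->.
have [xi' h1 h2] := generic_point xi e0 hs.
exists xi' => //; set w := sec xi'.
have Tw : T w by exact: pos_sectionP.
have [S [SK SX Sw Sd]] := pos_trop_in_cone Tw.
set S1 := rsupp (fan_coord fanK w).
have [fc0 S1K] := fan_coordP fanK w.
have S1S : S1 \subset S by apply: (proj1 (cone_fan_coord fanK w SK)).
have wS1 : w = (\row_i (fan_coord fanK w) 0 (enum_val i)) *m rays S1.
  by rewrite -supp_cone_rays // fan_coordK.
have rk : (d <= \rank (Q S1))%N.
  rewrite leqNgt; apply/negP => lt; have [c0 Qc] := hc _ lt.
  have : c S1 \in s by apply: map_f; rewrite mem_enum inE.
  move=> /h2; rewrite -(pos_sectionK freeU affx0 posx0 xi') -/w wS1.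
  by rewrite -!mulmxA -/(Q S1) [rays S1 *m _]mulmxA Qc mulmx0 eqxx.
have dS1 : (d <= #|S1|)%N := leq_trans rk (rank_leq_row _).
have SS1 : S1 = S.
  by apply/eqP; rewrite finset.eqEcard S1S (leq_trans Sd).
have Sd' : #|S| = d by apply/eqP; rewrite eqn_leq Sd -SS1.
have relw : relint_cone V S w.
  by apply/relint_coneP; exists (fan_coord fanK w); rewrite fan_coordK.
exists S => //; split => // w' Sw'.
apply: (pos_trop_initial posX); apply: (pos_trop_relint SK Sd' _ relw Tw Sw').
by rewrite /row_free eqn_leq rank_leq_row -/(Q S) -SS1 (leq_trans _ rk) // SS1 Sd'.
Qed.

Lemma Rpos_eq_pos_trop w : Rpos V K X d w <-> T w.
Proof.
split; first exact: Rpos_pos_trop.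
move=> Tw; apply: (closed_norm_ltE Rpos_closed) => e e0.
have /continuous_norm_ltP /(_ e e0) [e' e'0 he] :=
  @pos_section_continuous _ _ _ p U freeU x0 affx0 posx0 (w *m U^T).
have [xi' h1 h2] := Rpos_dense (w *m U^T) e'0.
by exists (sec xi') => //; have := he _ h1; rewrite -pos_section_uniq.
Qed.

End PositivePartIsPosTrop.

(** * The tropical toric variety *)

Section TropicalToricPoints.
Variables (R : realType) (n k : nat) (V : 'I_k -> 'rV[int]_n) (K : {set {set 'I_k}}).
Hypothesis fanK : complete_unimodular_fan R V K.
Local Notation toR := (map_mx (intr : int -> R)).
Local Notation VR := (rays_mx R V).

Lemma zpairDl (m m' v : 'rV[int]_n) : zpair (m + m') v = zpair m v + zpair m' v.
Proof. by rewrite /zpair -big_split; apply: eq_bigr => j _; rewrite mxE mulrDl. Qed.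

Lemma zpairNl (m v : 'rV[int]_n) : zpair (- m) v = - zpair m v.
Proof. by rewrite /zpair -sumrN; apply: eq_bigr => j _; rewrite mxE mulNr. Qed.

Lemma zpair0l (v : 'rV[int]_n) : zpair 0 v = 0.
Proof. by rewrite /zpair big1 // => j _; rewrite mxE mul0r. Qed.

Lemma RpairDl (m m' : 'rV[int]_n) (w : 'rV[R]_n) : Rpair (m + m') w = Rpair m w + Rpair m' w.
Proof. by rewrite /Rpair -big_split; apply: eq_bigr => j _; rewrite mxE rmorphD mulrDl. Qed.

Lemma Rpair0l (w : 'rV[R]_n) : Rpair 0 w = 0.
Proof. by rewrite /Rpair big1 // => j _; rewrite mxE mul0r. Qed.

Lemma RpairDr (m : 'rV[int]_n) (w w' : 'rV[R]_n) : Rpair m (w + w') = Rpair m w + Rpair m w'.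
Proof. by rewrite /Rpair -big_split; apply: eq_bigr => j _; rewrite mxE mulrDr. Qed.

Lemma Rpair_rays (m : 'rV[int]_n) (c : 'rV[R]_k) :
  Rpair m (c *m VR) = \sum_i c 0 i * (zpair m (V i))%:~R.
Proof.
rewrite /Rpair; under eq_bigr do rewrite mxE mulr_sumr.
rewrite exchange_big; apply: eq_bigr => i _.
rewrite /zpair rmorph_sum mulr_sumr; apply: eq_bigr => j _.
by rewrite mxE rmorphM mulrCA.
Qed.

(** When [P *m Pi = 1%:M], these vectors form the lattice basis dual to the rows of [P]. *)
Definition dual_vec (Pi : 'M[int]_n) (j : 'I_n) : 'rV[int]_n := (col j Pi)^T.

Lemma zpair_dual_vec Pi j v : zpair (dual_vec Pi j) v = (v *m Pi) 0 j.
Proof. by rewrite /zpair mxE; apply: eq_bigr => l _; rewrite !mxE mulrC. Qed.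

Lemma Rpair_dual_vec Pi j (w : 'rV[R]_n) : Rpair (dual_vec Pi j) w = (w *m toR Pi) 0 j.
Proof. by rewrite /Rpair mxE; apply: eq_bigr => l _; rewrite !mxE mulrC. Qed.

Lemma dual_vec_expand (P Pi : 'M[int]_n) (m : 'rV[int]_n) : Pi *m P = 1%:M ->
  m = \sum_j zpair m (row j P) *: dual_vec Pi j.
Proof.
move=> h; have e : m = m *m P^T *m Pi^T by rewrite -mulmxA -trmx_mul h trmx1 mulmx1.
rewrite {1}e mulmx_sum_row; apply: eq_bigr => j _; congr (_ *: _).
  by rewrite /zpair mxE; apply: eq_bigr => l _; rewrite !mxE.
by apply/rowP => l; rewrite !mxE.
Qed.

(* [F] is the set of rays along which the point is at infinity, so that [w] matters only
   modulo the span of [F]. *)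
Definition tpoint (S F : {set 'I_k}) (w : 'rV[R]_n) : TSpt R n k :=
  (S, fun m => if `[< in_dual V S m >] then
                 if [exists i in F, zpair m (V i) != 0] then -oo%E else (- Rpair m w)%:E
               else +oo%E).

Lemma tpoint_valid (S F : {set 'I_k}) w : S \in K -> F \subset S -> TSvalid V K (tpoint S F w).
Proof.
move=> SK FS; rewrite /tpoint; split => //=.
- rewrite asboolT; last by move=> i _; rewrite zpair0l.
  rewrite ifF ?Rpair0l ?oppr0 //; apply/negbTE/existsPn => i.
  by rewrite zpair0l eqxx andbF.
- by move=> m hm; rewrite asboolT //; case: ifP.
- move=> m m' hm hm'; rewrite !asboolT //; last first.
    by move=> i iS; rewrite zpairDl addr_ge0 //; [exact: hm|exact: hm'].
  have [/existsP [i /andP[iF hi]]|h] := boolP [exists i in F, zpair m (V i) != 0].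
    have -> : [exists i in F, zpair (m + m') (V i) != 0].
      apply/existsP; exists i; rewrite iF zpairDl gt_eqF //= ltr_wpDr //.
        exact/hm'/(fintype.subsetP FS).
      by rewrite lt_neqAle eq_sym hi; exact/hm/(fintype.subsetP FS).
    by case: ifP.
  have [/existsP [i /andP[iF hi]]|h'] := boolP [exists i in F, zpair m' (V i) != 0].
    have -> // : [exists i in F, zpair (m + m') (V i) != 0].
    apply/existsP; exists i; rewrite iF zpairDl gt_eqF //= ltr_wpDl //.
      exact/hm/(fintype.subsetP FS).
    by rewrite lt_neqAle eq_sym hi; exact/hm'/(fintype.subsetP FS).
  rewrite ifF; first by rewrite RpairDl opprD EFinD.
  apply/negbTE/existsPn => i; rewrite negb_and.
  have [iF /=|//] := boolP (i \in F); rewrite negbK zpairDl.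
  move: h => /existsPn /(_ i); rewrite iF /= negbK => /eqP ->.
  by move: h' => /existsPn /(_ i); rewrite iF /= negbK => /eqP ->.
- by move=> m hm; rewrite asboolF.
Qed.

Lemma tpoint_span (S F : {set 'I_k}) w w' (c : 'rV[R]_k) : rsupp c \subset F ->
  w - w' = c *m VR -> tpoint S F w = tpoint S F w'.
Proof.
move=> /rsupp_subP cF e; congr (_, _); apply/funext => m; case: ifP => // _.
have [//|h] := boolP [exists i in F, zpair m (V i) != 0]; congr (_ %:E); congr (- _).
rewrite -(subrK w' w) e RpairDr Rpair_rays big1 ?add0r // => i _.
have [iF|iF] := boolP (i \in F); last by rewrite cF // mul0r.
by move: h => /existsPn /(_ i); rewrite iF /= negbK => /eqP ->; rewrite mulr0.
Qed.

Lemma in_dual_dual_vec (S : {set 'I_k}) (P Pi : 'M[int]_n) g j :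
  P *m Pi = 1%:M -> (forall i, i \in S -> row (g i) P = V i) -> in_dual V S (dual_vec Pi j).
Proof.
by move=> h gP i iS; rewrite zpair_dual_vec (unimodular_dual j h gP iS) ler0n.
Qed.

Lemma tpoint_dual_vec (S F : {set 'I_k}) w (P Pi : 'M[int]_n) g j :
  P *m Pi = 1%:M -> (forall i, i \in S -> row (g i) P = V i) -> F \subset S ->
  (tpoint S F w).2 (dual_vec Pi j) =
    if [exists i in F, g i == j] then -oo%E else (- Rpair (dual_vec Pi j) w)%:E.
Proof.
move=> h gP FS; rewrite /tpoint /= asboolT; last exact: in_dual_dual_vec h gP.
congr (if _ then _ else _); apply: eq_existsb => i; apply: andb_id2l => iF.
rewrite zpair_dual_vec (unimodular_dual j h gP (fintype.subsetP FS _ iF)).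
by case: (g i == j).
Qed.

(** Evaluation at the dual basis recovers [F] from the infinite values, and the coordinates of [w]
    transverse to [F] from the finite ones. *)
Lemma tpoint_inj (S F F' : {set 'I_k}) w w' : S \in K -> F \subset S -> F' \subset S ->
  tpoint S F w = tpoint S F' w' ->
  F = F' /\ exists2 c : 'rV[R]_k, rsupp c \subset F & w - w' = c *m VR.
Proof.
move=> SK FS FS' e; have [P [Pi [g [PPi PiP ginj gP]]]] := unimodular_basis fanK SK.
have ev j := congr1 (fun a : TSpt R n k => a.2 (dual_vec Pi j)) e.
have gF (G : {set 'I_k}) i : G \subset S -> i \in S -> [exists l in G, g l == g i] = (i \in G).
  move=> GS iS; apply/existsP/idP => [[l /andP[lG /eqP el]]|iG].
    by rewrite -(ginj l i) //; exact: (fintype.subsetP GS).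
  by exists i; rewrite iG eqxx.
have FF' : F = F'.
  apply/setP => i; have [iS|iS] := boolP (i \in S).
    have := ev (g i); rewrite !(tpoint_dual_vec _ _ PPi gP) // !gF //.
    by case: (i \in F); case: (i \in F').
  have nG (G : {set 'I_k}) : G \subset S -> i \notin G.
    by move=> GS; apply: contra iS => /(fintype.subsetP GS).
  by rewrite (negbTE (nG F FS)) (negbTE (nG F' FS')).
split => //; rewrite -FF' in FS' e ev.
pose u := (w - w') *m toR Pi.
exists (\row_i if i \in F then u 0 (g i) else 0).
  by apply/rsupp_subP => i /negbTE iF; rewrite mxE iF.
have -> : w - w' = u *m toR P by rewrite -mulmxA -map_mxM PiP map_mx1 mulmx1.
have u0 j : ~~ [exists i in F, g i == j] -> u 0 j = 0.
  move=> hj; have := ev j; rewrite !(tpoint_dual_vec _ _ PPi gP) // (negbTE hj).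
  move=> [] /oppr_inj; rewrite !Rpair_dual_vec => h.
  by rewrite /u mulmxBl mxE h [X in _ + X]mxE subrr.
rewrite !mulmx_sum_row [RHS](bigID (mem F)) /= [X in _ = _ + X]big1 ?addr0; last first.
  by move=> i /negbTE iF; rewrite mxE iF scale0r.
rewrite (bigID (mem (g @: F)%SET)) /= [X in _ + X]big1 ?addr0; last first.
  move=> j hj; rewrite u0 ?scale0r //; apply: contra hj => /existsP [i /andP[iF /eqP <-]].
  exact: imset_f.
rewrite big_imset /=; last by move=> a b aF bF; apply: ginj; exact: (fintype.subsetP FS).
apply: eq_bigr => i iF; rewrite [in RHS]mxE iF row_rays_mx; congr (_ *: _).
by rewrite /rayR -(gP _ (fintype.subsetP FS _ iF)); apply/rowP => l; rewrite !mxE.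
Qed.

End TropicalToricPoints.

(** * Cubical coordinates on the charts *)

Section TropicalToricCharts.
Variables (R : realType) (n k : nat) (V : 'I_k -> 'rV[int]_n) (K : {set {set 'I_k}}).
Hypothesis fanK : complete_unimodular_fan R V K.
Local Notation toR := (map_mx (intr : int -> R)).
Local Notation VR := (rays_mx R V).

Lemma zpairZl (z : int) (m v : 'rV[int]_n) : zpair (z *: m) v = z * zpair m v.
Proof. by rewrite /zpair mulr_sumr; apply: eq_bigr => j _; rewrite mxE mulrA. Qed.

Lemma RpairZl (z : int) (m : 'rV[int]_n) (w : 'rV[R]_n) : Rpair (z *: m) w = z%:~R * Rpair m w.
Proof. by rewrite /Rpair mulr_sumr; apply: eq_bigr => j _; rewrite mxE rmorphM mulrA. Qed.

Lemma in_dualD (S : {set 'I_k}) m m' : in_dual V S m -> in_dual V S m' -> in_dual V S (m + m').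
Proof. by move=> h h' i iS; rewrite zpairDl addr_ge0 // ?h ?h'. Qed.

Lemma in_dual0 (S : {set 'I_k}) : in_dual V S 0.
Proof. by move=> i _; rewrite zpair0l. Qed.

Lemma valid_scale (S : {set 'I_k}) (phi : 'rV[int]_n -> \bar R) (m : 'rV[int]_n) (r : R) (t : nat) :
  TSvalid V K (S, phi) -> in_dual V S m -> phi m = r%:E ->
  phi (t%:Z *: m) = (t%:R * r)%:E.
Proof.
move=> [/= _ phi0 _ phiD _] hm hr; elim: t => [|t IH]; first by rewrite scale0r mul0r.
have hd : in_dual V S (t%:Z *: m) by move=> i iS; rewrite zpairZl mulr_ge0 // hm.
by rewrite -natr1 mulrDl mul1r -(addn1 t) PoszD scalerDl scale1r phiD //= IH hr.
Qed.

(** In a unimodular chart the dual monoid is generated by the dual vectors of the rays of [S] and by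
    the remaining ones together with their opposites. A morphism avoiding [+oo] is finite at
    invertible elements, so only the rays can contribute to [F]. *)
Lemma valid_tpoint (S : {set 'I_k}) (phi : 'rV[int]_n -> \bar R) : TSvalid V K (S, phi) ->
  exists (F : {set 'I_k}) w, F \subset S /\ (S, phi) = tpoint V S F w.
Proof.
move=> hv; have [/= SK phi0 phiN phiD phioo] := hv.
have [P [Pi [g [PPi PiP ginj gP]]]] := unimodular_basis fanK SK.
pose dv := dual_vec Pi.
have hdv j : in_dual V S (dv j) by exact: in_dual_dual_vec PPi gP.
have zdv j i : i \in S -> zpair (dv j) (V i) = (g i == j)%:R.
  by move=> iS; rewrite zpair_dual_vec (unimodular_dual j PPi gP iS).
pose F := finset (fun i => (i \in S) && (phi (dv (g i)) == -oo%E)).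
pose r j := fine (phi (dv j)).
pose w := (\row_j - r j) *m toR P.
have wdv j : Rpair (dv j) w = - r j.
  by rewrite Rpair_dual_vec /w -mulmxA -map_mxM PPi map_mx1 mulmx1 mxE.
have FS : F \subset S by apply/fintype.subsetP => i; rewrite finset.in_set => /andP[].
exists F, w; split => //; congr (_, _); apply/funext => m.
case: asboolP => [hm|hm]; last exact: phioo.
have [/existsP [i /andP[iF hi]]|h] := boolP [exists i in F, zpair m (V i) != 0].
  move: iF; rewrite finset.in_set => /andP[iS /eqP phii].
  (* The pairing of [m] with the ray [i] is a positive integer, so one copy of the dual vector, of
     value [-oo], splits off inside the monoid. *)
  have hm' : in_dual V S (m - dv (g i)).
    move=> l lS; rewrite zpairDl zpairNl zdv // (inj_in_eq ginj) //.
    have [->|li] := eqVneq l i; last by rewrite subr0 hm.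
    by have := hm i iS; move: hi; case: (zpair m (V i)) => // -[].
  rewrite -(subrK (dv (g i)) m) phiD // phii.
  by have := phiN _ hm'; case: (phi _).
have term j : in_dual V S (zpair m (row j P) *: dv j) /\
    phi (zpair m (row j P) *: dv j) = ((zpair m (row j P))%:~R * r j)%:E.
  have [/imsetP [i iS ->]|jS] := boolP (j \in (g @: S)%SET).
    rewrite gP //; have := hm i iS; case E : (zpair m (V i)) => [t|t] // _.
    split; first by move=> l lS; rewrite zpairZl zdv // mulr_ge0 // ler0n.
    have [iF|iF] := boolP (i \in F).
      move: h => /existsPn /(_ i); rewrite iF /= negbK E => /eqP ->.
      by rewrite scale0r mul0r.
    apply: (valid_scale _ hv) => //.
    move: iF; rewrite finset.in_set iS /r /= => hoo.
    by have := phiN _ (hdv (g i)); case: (phi _) hoo.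
  have zero i : i \in S -> zpair (dv j) (V i) = 0.
    move=> iS; rewrite zdv //; have [e|//] := eqVneq (g i) j.
    by move: jS; rewrite -e imset_f.
  have hN : in_dual V S (- dv j) by move=> i iS; rewrite zpairNl zero // oppr0.
  have [phij phiNj] : phi (dv j) = (r j)%:E /\ phi (- dv j) = (- r j)%:E.
    have := phiD _ _ (hdv j) hN; rewrite subrr phi0.
    have := phiN _ (hdv j); have := phiN _ hN; rewrite /r.
    case: (phi (dv j)) => [x| |] //; case: (phi (- dv j)) => [y| |] //= _ _ [] /eqP.
    by rewrite eq_sym addrC addr_eq0 => /eqP ->.
  split; first by move=> i iS; rewrite zpairZl zero // mulr0.
  case: (zpair m (row j P)) => t; first exact: (valid_scale _ hv).
  rewrite NegzE scaleNr -scalerN (valid_scale _ hv hN phiNj).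
  by rewrite rmorphN /= mulrN mulNr.
have summ (s : seq 'I_n) : in_dual V S (\sum_(j <- s) zpair m (row j P) *: dv j) /\
    phi (\sum_(j <- s) zpair m (row j P) *: dv j) =
    (- Rpair (\sum_(j <- s) zpair m (row j P) *: dv j) w)%:E.
  elim: s => [|j s [IH1 IH2]].
    by rewrite big_nil Rpair0l oppr0; split => //; exact: in_dual0.
  have [h1 h2] := term j; rewrite big_cons; split; first exact: in_dualD.
  by rewrite phiD // h2 IH2 RpairDl RpairZl wdv opprD mulrN opprK EFinD.
by have [_] := summ (index_enum _); rewrite -(dual_vec_expand _ PiP).
Qed.

(* [cube] parametrises the points of the tropical toric variety by the coordinates
   [b = a / (1 + a)] of [a] in [0, +oo]^k; since [1 / 0 = 0], [cube_fin] replaces the infinite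
   coordinates of [a] by 0. *)
Definition cube (b : 'rV[R]_k) : Prop := (forall i, 0 <= b 0 i <= 1) /\ rsupp b \in K.

Definition cube_inf (b : 'rV[R]_k) : {set 'I_k} := finset (fun i => b 0 i == 1).

Definition cube_fin (b : 'rV[R]_k) : 'rV[R]_k := \row_i (b 0 i / (1 - b 0 i)).

Definition cube_pt (S : {set 'I_k}) (b : 'rV[R]_k) : TSpt R n k :=
  tpoint V S (cube_inf b) (cube_fin b *m VR).

Lemma cube_inf_supp b : cube_inf b \subset rsupp b.
Proof.
apply/fintype.subsetP => i; rewrite finset.in_set mem_rsupp => /eqP ->.
exact: oner_neq0.
Qed.

Lemma cube_fin_supp b : rsupp (cube_fin b) \subset rsupp b.
Proof.
by apply/rsupp_subP => i; rewrite mem_rsupp negbK mxE => /eqP ->; rewrite mul0r.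
Qed.

Lemma cube_inf_face b : cube b -> cube_inf b \in K.
Proof. by move=> [_ bK]; exact: (fan_face fanK bK (cube_inf_supp b)). Qed.

Lemma cube_fin_ge0 b i : cube b -> 0 <= cube_fin b 0 i.
Proof. by move=> [b01 _]; have /andP[b0 b1] := b01 i; rewrite mxE divr_ge0 // subr_ge0. Qed.

Definition indic (F : {set 'I_k}) : 'rV[R]_k := \row_i (i \in F)%:R.

Lemma rsupp_indic F : rsupp (indic F) = F.
Proof.
by apply/setP => i; rewrite mem_rsupp mxE; case: (i \in F); rewrite ?oner_eq0 ?eqxx.
Qed.

(** Only the class of [w] modulo the span of [F] matters, so [w] may be pushed far along the rays of
    [F]. There it lies in a cone having [F] as a face, and its coordinates outside [F] give the
    finite part of [b]. *)
Lemma cube_pt_exists (S : {set 'I_k}) phi : TSvalid V K (S, phi) ->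
  exists b, [/\ cube b, cube_inf b \subset S & (S, phi) = cube_pt S b].
Proof.
move=> hv; have [F [w [FS ->]]] := valid_tpoint hv.
have SK : S \in K by case: hv.
have FK := fan_face fanK SK FS.
have fpF : fan_point K (indic F) by split; [move=> i; rewrite mxE ler0n|rewrite rsupp_indic].
have [del [L [d0 _ hdel]]] := fan_coord_local fanK (indic F *m VR).
(* After division by [N], being far along [F] means being [del]-close to [indic F *m VR]. *)
pose N := (`|w| + 1) / del + 1.
have N0 : 0 < N by rewrite ltr_wpDl // divr_ge0 ?addr_ge0 // ltW.
pose y := indic F *m VR + N^-1 *: w.
have yd : `|y - indic F *m VR| < del.
  rewrite /y addrAC subrr add0r normrZ gtr0_norm ?invr_gt0 // mulrC ltr_pdivrMr //.
  rewrite /N mulrDr mulr1 mulrC divfK ?lt0r_neq0 //; lra.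
have [a0 aK] := fan_coordP fanK y.
have Fa : F \subset rsupp (fan_coord fanK y).
  have [h _] := hdel y yd.
  have <- : rsupp (fan_coord fanK (indic F *m VR)) = F.
    by rewrite (fan_coord_uniq fanK fpF) rsupp_indic.
  apply: (proj1 (cone_fan_coord fanK _ aK)); apply: (h _ aK).
  exact: (proj2 (cone_fan_coord fanK _ aK)).
have [a aE] : exists a, a = N *: fan_coord fanK y by eexists.
have aVR : a *m VR = w + (N *: indic F) *m VR.
  rewrite aE -scalemxAl fan_coordK /y scalerDr scalerA mulfV ?lt0r_neq0 // scale1r.
  by rewrite scalemxAl addrC.
have {}a0 i : 0 <= a 0 i by rewrite aE mxE mulr_ge0 // ltW.
have apos i : 0 < 1 + a 0 i by rewrite ltr_pwDl.
pose b : 'rV[R]_k := \row_i (if i \in F then 1 else a 0 i / (1 + a 0 i)).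
have bF : cube_inf b = F.
  apply/setP => i; rewrite finset.in_set mxE; case: ifP => _; first by rewrite eqxx.
  apply/negbTE; rewrite lt_eqF // ltr_pdivrMr // mul1r; lra.
have bsupp : rsupp b \subset rsupp (fan_coord fanK y).
  apply/rsupp_subP => i iy; rewrite mxE ifF; last first.
    by apply/negbTE; apply: contra iy => /(fintype.subsetP Fa).
  by move: iy; rewrite mem_rsupp negbK aE mxE => /eqP ->; rewrite mulr0 mul0r.
have cb : cube b.
  split => [i|]; last exact: (fan_face fanK aK bsupp).
  rewrite mxE; case: ifP => _; first by rewrite ler01 lexx.
  by rewrite divr_ge0 ?(ltW (apos i)) //= ler_pdivrMr // mul1r lerDr.
exists b; split => //; first by rewrite bF.
rewrite /cube_pt bF; apply: (@tpoint_span _ _ _ _ _ _ _ _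
  (\row_i if i \in F then a 0 i - N else 0)).
  by apply/rsupp_subP => i /negbTE iF; rewrite mxE iF.
apply/eqP; rewrite subr_eq -mulmxDl -[w](addrK ((N *: indic F) *m VR)) -aVR subr_eq -mulmxDl.
apply/eqP; congr (_ *m _); apply/rowP => i; rewrite !mxE.
case: (i \in F); first by rewrite mulr1 subrr invr0 mulr0 addr0 subrK.
rewrite mulr0 addr0 add0r; have := lt0r_neq0 (apos i) => h.
have -> : 1 - a 0 i / (1 + a 0 i) = (1 + a 0 i)^-1 by rewrite -{1}(mulfV h) -mulrBl addrK mul1r.
by rewrite invrK divfK.
Qed.

Lemma cube_pt_inj (S : {set 'I_k}) b b' : S \in K -> cube b -> cube b' ->
  cube_inf b \subset S -> cube_inf b' \subset S -> cube_pt S b = cube_pt S b' -> b = b'.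
Proof.
move=> SK cb cb' bS b'S /(tpoint_inj fanK SK bS b'S) [FF' [c cF e]].
set F := cube_inf b in FF' cF.
(* Adding [M] times the rays of [F] makes the coefficients on [F] nonnegative, so that both sides
   are fan points of one vector. *)
pose M := `|c|.
have fp (x : 'rV[R]_k) u : cube u -> F = cube_inf u -> (forall i, i \notin F -> x 0 i = 0) ->
    (forall i, 0 <= x 0 i) -> fan_point K (cube_fin u + x).
  move=> cu Fu xF x0; split => [i|]; first by rewrite mxE addr_ge0 // cube_fin_ge0.
  have [_ uK] := cu; apply: (fan_face fanK uK); apply/rsupp_subP => i iu; rewrite mxE.
  have /rsupp_subP -> // := cube_fin_supp u; rewrite xF ?addr0 // Fu.
  by apply: contra iu => /(fintype.subsetP (cube_inf_supp u)).
have cM i : 0 <= c 0 i + M.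
  by have := mx_norm_entry c 0 i; rewrite -/M ler_norml => /andP[h _]; rewrite -lerBlDr sub0r.
have /rsupp_subP cF' := cF.
have E : cube_fin b + M *: indic F = cube_fin b' + (c + M *: indic F).
  apply: (fan_point_uniq fanK).
  - apply: fp => // i; first by move=> /negbTE iF; rewrite !mxE iF mulr0.
    by rewrite !mxE mulr_ge0 ?ler0n // /M.
  - apply: fp => // i; first by move=> iF; rewrite !mxE (negbTE iF) mulr0 addr0 cF'.
    rewrite !mxE; have [iF|iF] := boolP (i \in F); first by rewrite mulr1.
    by rewrite cF' // mulr0 addr0.
  - by rewrite addrA !mulmxDl; congr (_ + _); rewrite -e addrC subrK.
apply/rowP => i; have [iF|iF] := boolP (i \in F).
  have := iF; rewrite {1}FF'; move: iF; rewrite !finset.in_set.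
  by move=> /eqP -> /eqP ->.
have := congr1 (fun x : 'rV[R]_k => x 0 i) E; rewrite !mxE cF' // (negbTE iF) mulr0 !addr0.
have b1 : 1 - b 0 i != 0.
  by move: iF; rewrite finset.in_set subr_eq0 eq_sym.
have b'1 : 1 - b' 0 i != 0.
  by move: iF; rewrite FF' finset.in_set subr_eq0 eq_sym.
move=> h; have : b 0 i * (1 - b' 0 i) = b' 0 i * (1 - b 0 i).
  by apply/eqP; rewrite -eqr_div //; apply/eqP.
lra.
Qed.

(** The same [b] serves in every chart containing the point, so this is a coordinate on the classes
    of [TSequiv]. *)
Definition chart_coord (x : TSpt R n k) (b : 'rV[R]_k) : Prop :=
  [/\ cube b, cube_inf b \subset x.1, x.1 \in K & x = cube_pt x.1 b].

Lemma chart_coord_exists x : TSvalid V K x -> exists b, chart_coord x b.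
Proof.
case: x => S phi hv; have [b [cb bS e]] := cube_pt_exists hv.
by exists b; split => //; case: hv.
Qed.

Lemma chart_coord_uniq x b b' : chart_coord x b -> chart_coord x b' -> b = b'.
Proof.
move=> [cb bS xK e] [cb' b'S _ e']; apply: (cube_pt_inj xK) => //.
by rewrite -e -e'.
Qed.

Lemma chart_coord_valid x b : chart_coord x b -> TSvalid V K x.
Proof. by move=> [cb bS xK ->]; apply: tpoint_valid. Qed.

Lemma cube_pt_coord (S : {set 'I_k}) b : cube b -> cube_inf b \subset S -> S \in K ->
  chart_coord (cube_pt S b) b.
Proof. by split. Qed.

Lemma chart_coord_step x y b : TSstep V K x y -> chart_coord x b -> chart_coord y b.
Proof.
case: x y => [S phi] [S' phi'] [_ [hv [/= SS' h]]] [cb /= bS SK [e]].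
have [/= S'K _ _ _ hoo] := hv; split => //=; first exact: fintype.subset_trans bS SS'.
congr (_, _); apply/funext => m; case: asboolP => hm; last exact: hoo.
rewrite h // e asboolT // => i iS; apply: hm.
exact: (fintype.subsetP SS').
Qed.

Lemma chart_coord_equiv x y b : TSequiv V K x y -> chart_coord x b <-> chart_coord y b.
Proof.
elim=> {x y} [x y xy|x|x y _ <-|x y z _ -> _ ->] //.
(* Against the direction of a step: [x] has some coordinate, it passes to [y], and there it is
   unique. *)
split => [|hy]; first exact: chart_coord_step xy.
have [b' hb'] := chart_coord_exists (proj1 xy).
by rewrite (chart_coord_uniq hy (chart_coord_step xy hb')).
Qed.

Lemma cube_pt_step (S S' : {set 'I_k}) b : cube b -> cube_inf b \subset S -> S \subset S' ->
  S' \in K -> TSstep V K (cube_pt S b) (cube_pt S' b).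
Proof.
move=> cb bS SS' S'K; have SK := fan_face fanK S'K SS'.
split; first exact: tpoint_valid.
split; first by apply: tpoint_valid => //; exact: fintype.subset_trans bS SS'.
split => //= m hm; rewrite !asboolT // => i iS; apply: hm.
exact: (fintype.subsetP SS').
Qed.

(** This representative uses the smallest chart containing the point; any other one is reached from
    it by a single step. *)
Definition cube_point b := cube_pt (cube_inf b) b.

Lemma cube_point_coord b : cube b -> chart_coord (cube_point b) b.
Proof. by move=> cb; apply: cube_pt_coord => //; exact: cube_inf_face. Qed.

Lemma chart_coord_point x b : chart_coord x b -> TSequiv V K x (cube_point b).
Proof.
move=> [cb bS xK ->]; apply: rst_sym; apply: rst_step.
exact: cube_pt_step.
Qed.

Lemma cube_point_equiv b b' : cube b -> cube b' ->
  TSequiv V K (cube_point b) (cube_point b') -> b = b'.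
Proof.
move=> cb cb' h; apply: (@chart_coord_uniq (cube_point b')); last exact: cube_point_coord.
by apply/(chart_coord_equiv b h); exact: cube_point_coord.
Qed.

End TropicalToricCharts.

(** * Comparison of the chart topology with the cubical coordinates *)

Section TropicalToricTopology.
Variables (R : realType) (n k : nat) (V : 'I_k -> 'rV[int]_n) (K : {set {set 'I_k}}).
Hypothesis fanK : complete_unimodular_fan R V K.
Local Notation toR := (map_mx (intr : int -> R)).
Local Notation VR := (rays_mx R V).

Definition chart_nbhs (eta M : R) (x0 : \bar R) : set (\bar R) :=
  [set x | match x0 with
           | EFin r => exists2 s, x = s%:E & `|s - r| < eta
           | ENInf => (x < (- M)%:E)%E
           | EPInf => True
           end].

Lemma nbhs_chart_nbhs eta M x0 : 0 < eta -> nbhs x0 (chart_nbhs eta M x0).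
Proof.
move=> eta0; case: x0 => [r| |].
- have : nbhs r [set s | `|s - r| < eta].
    apply/nbhs_normP; exists eta => //= s; rewrite /ball_ /= distrC.
    by [].
  by move=> h; apply: filterS h => s hs; exists s.
- exact: filterT.
- by exists (- M); split => //; rewrite num_real.
Qed.

Lemma cube_fin_dist (x y : R) : 0 <= x < 1 -> 0 <= y < 1 ->
  `|x - y| <= `|x / (1 - x) - y / (1 - y)|.
Proof.
move=> /andP[x0 x1] /andP[y0 y1].
have hx : 0 < 1 - x by rewrite subr_gt0.
have hy : 0 < 1 - y by rewrite subr_gt0.
have -> : x - y = (x / (1 - x) - y / (1 - y)) * ((1 - x) * (1 - y)).
  by field; rewrite !lt0r_neq0.
set A := _ - _; rewrite normrM ler_piMr //.
rewrite ger0_norm; last by rewrite mulr_ge0 // ltW.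
by rewrite mulr_ile1 ?(ltW hx) ?(ltW hy) // lerBlDr lerDl.
Qed.

Lemma indic_dual (S F : {set 'I_k}) (P Pi : 'M[int]_n) g j : P *m Pi = 1%:M ->
  {in S &, injective g} -> (forall i, i \in S -> row (g i) P = V i) -> F \subset S ->
  forall c : 'rV[R]_k, rsupp c \subset F ->
  (forall i, i \in F -> (c *m VR *m toR Pi) 0 (g i) = c 0 i) /\
  (~~ [exists i in F, g i == j] -> (c *m VR *m toR Pi) 0 j = 0).
Proof.
move=> PPi ginj gP FS c /rsupp_subP cF.
have E l : (c *m VR *m toR Pi) 0 l = \sum_i c 0 i * (g i == l)%:R.
  rewrite -mulmxA mxE; apply: eq_bigr => i _.
  have [iF|iF] := boolP (i \in F); last by rewrite cF // !mul0r.
  congr (_ * _); have iS := fintype.subsetP FS _ iF.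
  have := unimodular_dual l PPi gP iS => /(congr1 (fun z : int => z%:~R : R)).
  rewrite mxE rmorph_sum /= => h; rewrite mxE.
  transitivity (((g i == l)%:R : int)%:~R : R); last by case: (g i == l).
  by rewrite -h; apply: eq_bigr => u _; rewrite !mxE rmorphM.
split => [i iF|hj].
  rewrite E (bigD1 i) //= eqxx mulr1 big1 ?addr0 // => l li.
  have [lF|lF] := boolP (l \in F); last by rewrite cF // mul0r.
  rewrite (inj_in_eq ginj) ?(negbTE li) ?mulr0 //; exact: (fintype.subsetP FS).
rewrite E big1 // => i _; have [iF|iF] := boolP (i \in F); last by rewrite cF // mul0r.
by move: hj => /existsPn /(_ i); rewrite iF /= => /negbTE ->; rewrite mulr0.
Qed.

(** Values at the dual basis bound the nearby point transversally to the infinite rays [F0] and make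
    it large along them. Fan coordinates are not linear across cones, so the nearby point is written
    as a point close to [q0] plus a nonnegative combination [beta] of rays of [F0]; the former lies
    in a cone having [F0] as a face, and adding [beta] stays in this cone. *)
Lemma chart_coord_near (S : {set 'I_k}) phi0 b0 (e : R) :
  chart_coord V K (S, phi0) b0 -> 0 < e ->
  exists (ms : seq 'rV[int]_n) (N : 'rV[int]_n -> set (\bar R)),
    (forall m, m \in ms -> nbhs (phi0 m) (N m)) /\
    forall phi b, chart_coord V K (S, phi) b -> (forall m, m \in ms -> N m (phi m)) ->
      `|b - b0| <= e.
Proof.
move=> [cb0 /= b0S SK [ephi0]] e0.
have [P [Pi [g [PPi PiP ginj gP]]]] := unimodular_basis fanK SK.
pose dv := dual_vec Pi.
set F0 := cube_inf b0 in b0S; set w0 := cube_fin b0 *m VR in ephi0.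
(* The unit added on [F0] makes these rays part of the support, so that every cone met near [q0]
   contains them. *)
pose a0 := cube_fin b0 + indic R F0.
have fa0 : fan_point K a0.
  have [b01 b0K] := cb0; split => [i|].
    rewrite mxE; apply: addr_ge0; first exact: (cube_fin_ge0 i cb0).
    by rewrite mxE ler0n.
  apply: (fan_face fanK b0K); apply/rsupp_subP => i ib; rewrite mxE.
  have /rsupp_subP -> // := cube_fin_supp b0; rewrite mxE add0r.
  have -> // : i \in F0 = false.
  by apply/negbTE; apply: contra ib => /(fintype.subsetP (cube_inf_supp b0)).
pose q0 := a0 *m VR.
have fq0 : fan_coord fanK q0 = a0 by exact: fan_coord_uniq.
have [del [L [d0 L0 hdel]]] := fan_coord_local fanK q0.
have [C C0 hC] := mulmx_norm_bound 1 (toR P).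
pose eta := Num.min (del / 2 / C) (e / L / C).
have eta0 : 0 < eta by rewrite lt_min !divr_gt0.
have eta1 : C * eta < del.
  have : eta <= del / 2 / C by rewrite ge_min lexx.
  rewrite ler_pdivlMr // mulrC => h; apply: le_lt_trans h _.
  by rewrite ltr_pdivrMr //; lra.
have eta2 : L * (C * eta) <= e.
  have : eta <= e / L / C by rewrite ge_min lexx orbT.
  by rewrite ler_pdivlMr // ler_pdivlMr // mulrC [eta * C]mulrC.
(* This makes [beta] at least [e^-1] on [F0]; a coordinate [a >= e^-1] satisfies
   [1 - a / (1 + a) <= e]. *)
pose M := `|w0 *m toR Pi| + 1 + e^-1.
have M1 : `|w0 *m toR Pi| + 1 <= M by rewrite lerDl invr_ge0 ltW.
exists [seq dv j | j <- enum 'I_n], (fun m => chart_nbhs eta M (phi0 m)); split.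
  by move=> m _; exact: nbhs_chart_nbhs.
move=> phi b [cb /= bS _ [ephi]] hN.
set F := cube_inf b in bS; set w := cube_fin b *m VR in ephi.
have val0 j : phi0 (dv j) = if [exists i in F0, g i == j] then -oo%E
    else (- (w0 *m toR Pi) 0 j)%:E.
  have -> : phi0 (dv j) = (tpoint V S F0 w0).2 (dv j) by rewrite ephi0.
  by rewrite (tpoint_dual_vec w0 j PPi gP b0S) Rpair_dual_vec.
have val j : phi (dv j) = if [exists i in F, g i == j] then -oo%E
    else (- (w *m toR Pi) 0 j)%:E.
  have -> : phi (dv j) = (tpoint V S F w).2 (dv j) by rewrite ephi.
  by rewrite (tpoint_dual_vec w j PPi gP bS) Rpair_dual_vec.
have {}hN j : chart_nbhs eta M (phi0 (dv j)) (phi (dv j)).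
  by apply: hN; apply: map_f; rewrite mem_enum.
have gE (G : {set 'I_k}) i : G \subset S -> i \in S -> [exists l in G, g l == g i] = (i \in G).
  move=> GS iS; apply/existsP/idP => [[l /andP[lG /eqP el]]|iG].
    by rewrite -(ginj l i) //; exact: (fintype.subsetP GS).
  by exists i; rewrite iG eqxx.
have far j : ~~ [exists i in F0, g i == j] -> ~~ [exists i in F, g i == j] /\
    `|(w *m toR Pi) 0 j - (w0 *m toR Pi) 0 j| < eta.
  move=> hj; have := hN j; rewrite val0 val (negbTE hj) /chart_nbhs /=.
  by case: ifP => _ [s] // [<-]; rewrite -opprD normrN.
have FF0 : F \subset F0.
  apply/fintype.subsetP => i iF; have iS := fintype.subsetP bS _ iF.
  apply: contraT => iF0; have := far (g i); rewrite !gE // => /(_ iF0) [].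
  by rewrite iF.
pose L1 := M + `|w *m toR Pi|.
have L10 : 0 <= L1 by rewrite addr_ge0 // (le_trans _ M1) // addr_ge0.
(* An honest vector replacing the nearby point: its infinite rays [F] get a finite coefficient [L1],
   large enough for its coordinates on [F] to be at least [M]. *)
pose ws := (cube_fin b + L1 *: indic R F) *m VR.
have suppL1 : rsupp (L1 *: indic R F) \subset F.
  by apply/rsupp_subP => i /negbTE iF; rewrite !mxE iF mulr0.
have wsE : ws *m toR Pi = w *m toR Pi + (L1 *: indic R F) *m VR *m toR Pi.
  by rewrite /ws !mulmxDl.
have ws_far j : ~~ [exists i in F0, g i == j] -> (ws *m toR Pi) 0 j = (w *m toR Pi) 0 j.
  move=> /far [h _]; have [_ h2] := indic_dual j PPi ginj gP bS suppL1.
  by rewrite wsE mxE h2 // addr0.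
have ws_near i : i \in F0 -> M <= (ws *m toR Pi) 0 (g i).
  move=> iF0; have iS := fintype.subsetP b0S _ iF0.
  have [iF|iF] := boolP (i \in F).
    have [h1 _] := indic_dual (g i) PPi ginj gP bS suppL1.
    rewrite wsE mxE h1 // !mxE iF mulr1 /L1.
    have := mx_norm_entry (w *m toR Pi) 0 (g i); rewrite ler_norml => /andP[+ _].
    rewrite !mxE; lra.
  have [_ h2] := indic_dual (g i) PPi ginj gP bS suppL1.
  rewrite wsE mxE h2 ?addr0; last by rewrite gE.
  have := hN (g i); rewrite val0 val !gE // iF0 (negbTE iF) /chart_nbhs /= lte_fin.
  by rewrite ltrN2 => /ltW.
(* The coefficients of [ws - q0] along [F0], where the 1 comes from [indic R F0] in [a0]; what
   remains is the small vector [h]. *)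
pose beta : 'rV[R]_k := \row_i if i \in F0 then
   (ws *m toR Pi) 0 (g i) - (w0 *m toR Pi) 0 (g i) - 1 else 0.
have beta_lb i : i \in F0 -> M - `|w0 *m toR Pi| - 1 <= beta 0 i.
  move=> iF0; rewrite mxE iF0 lerD2r lerB //; first exact: ws_near.
  exact: le_trans (ler_norm _) (mx_norm_entry _ _ _).
have beta0 i : 0 <= beta 0 i.
  have [iF0|iF0] := boolP (i \in F0); last by rewrite mxE (negbTE iF0).
  by apply: le_trans (beta_lb i iF0); rewrite -addrA -opprD subr_ge0.
have supp_beta : rsupp beta \subset F0.
  by apply/rsupp_subP => i /negbTE iF0; rewrite mxE iF0.
pose h := ws - q0 - beta *m VR.
have q0E : q0 *m toR Pi = w0 *m toR Pi + indic R F0 *m VR *m toR Pi.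
  by rewrite /q0 /a0 !mulmxDl.
have supp_ind : rsupp (indic R F0) \subset F0 by rewrite rsupp_indic.
have hPi : `|h *m toR Pi| <= eta.
  apply: mx_norm_leP; first exact: ltW.
  move=> x j; rewrite ord1 /h !mulmxBl q0E.
  have [b1 b2] := indic_dual j PPi ginj gP b0S supp_beta.
  have [i1 i2] := indic_dual j PPi ginj gP b0S supp_ind.
  set u1 := ws *m _; set u2 := w0 *m _; set u3 := indic _ _ *m _ *m _; set u4 := beta *m _ *m _.
  have -> : (u1 - (u2 + u3) - u4) 0 j = u1 0 j - (u2 0 j + u3 0 j) - u4 0 j by rewrite !mxE.
  have [/existsP [i /andP[iF0 /eqP <-]]|nj] := boolP [exists i in F0, g i == j].
    have e1 : u3 0 (g i) = 1 by rewrite /u3 i1 // mxE iF0.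
    have e2 : u4 0 (g i) = u1 0 (g i) - u2 0 (g i) - 1 by rewrite /u4 b1 // mxE iF0.
    by rewrite e1 e2 opprD addrA subrr normr0 ltW.
  rewrite b2 // i2 // addr0 subr0 /u1 ws_far //.
  by have [_ /ltW] := far j nj.
have hn : `|h| <= C * eta.
  have -> : h = h *m toR Pi *m toR P by rewrite -mulmxA -map_mxM PiP map_mx1 mulmx1.
  by apply: le_trans (hC _) _; rewrite ler_pM2l.
pose y := q0 + h.
have yq0 : y - q0 = h by rewrite /y addrAC subrr add0r.
have [ycone ydist] : (forall S', S' \in K -> cone V S' y -> cone V S' q0) /\
    `|fan_coord fanK y - a0| <= e.
  have [|h1 h2] := hdel y; first by rewrite yq0 (le_lt_trans hn).
  split => //; rewrite -fq0; apply: le_trans h2 _; rewrite yq0.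
  by apply: le_trans eta2; rewrite ler_pM2l.
have [y0 yK] := fan_coordP fanK y.
have F0y : F0 \subset rsupp (fan_coord fanK y).
  have : rsupp a0 \subset rsupp (fan_coord fanK y).
    rewrite -fq0; apply: (proj1 (cone_fan_coord fanK _ yK)); apply: (ycone _ yK).
    exact: (proj2 (cone_fan_coord fanK _ yK)).
  apply: fintype.subset_trans; apply/fintype.subsetP => i iF0.
  by rewrite mem_rsupp lt0r_neq0 // !mxE iF0 ltr_wpDl //; have := cube_fin_ge0 i cb0; rewrite mxE.
have key : cube_fin b + L1 *: indic R F = fan_coord fanK y + beta.
  apply: (fan_point_uniq fanK).
  - have [b01 bK] := cb; split => [i|].
      rewrite mxE; apply: addr_ge0; first exact: (cube_fin_ge0 i cb).
      by rewrite !mxE mulr_ge0 // ler0n.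
    apply: (fan_face fanK bK); apply/rsupp_subP => i ib; rewrite mxE.
    have /rsupp_subP -> // := cube_fin_supp b; rewrite add0r.
    have /rsupp_subP -> // := suppL1.
    by apply: contra ib => /(fintype.subsetP (cube_inf_supp b)).
  - split => [i|]; first by rewrite mxE addr_ge0.
    apply: (fan_face fanK yK); apply/rsupp_subP => i iy; rewrite mxE.
    have -> : fan_coord fanK y 0 i = 0 by apply/eqP; move: iy; rewrite mem_rsupp negbK.
    have /rsupp_subP -> // := supp_beta; first by rewrite addr0.
    by apply: contra iy => /(fintype.subsetP F0y).
  - by rewrite -/ws [RHS]mulmxDl fan_coordK /y /h -[RHS]addrA subrK addrC subrK.
have keyi i := congr1 (fun x : 'rV[R]_k => x 0 i) key.
apply: mx_norm_leP; first exact: ltW.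
move=> x i; rewrite ord1 {x}; have [/(_ i) b01 _] := cb; have [/(_ i) b001 _] := cb0.
have -> : (b - b0) 0 i = b 0 i - b0 0 i by rewrite !mxE.
have [iF0|iF0] := boolP (i \in F0).
  have b0i : b0 0 i = 1 by move: iF0; rewrite finset.in_set => /eqP.
  have [iF|iF] := boolP (i \in F).
    have -> : b 0 i = 1 by move: iF; rewrite finset.in_set => /eqP.
    by rewrite b0i subrr normr0 ltW.
  have bi1 : b 0 i < 1.
    by rewrite lt_neqAle; move: iF; rewrite finset.in_set => ->; case/andP: b01.
  have hb : e^-1 <= b 0 i / (1 - b 0 i).
    have := keyi i; rewrite [in LHS]mxE [in RHS]mxE => hk.
    have hz : (L1 *: indic R F) 0 i = 0 by rewrite !mxE (negbTE iF) mulr0.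
    have hc : cube_fin b 0 i = b 0 i / (1 - b 0 i) by rewrite mxE.
    rewrite -hc; move: hk; rewrite hz addr0 => ->.
    have := y0 i; have := beta_lb i iF0; rewrite /M; lra.
  have hb' : 0 < 1 - b 0 i by rewrite subr_gt0.
  rewrite b0i distrC (ger0_norm (ltW hb')).
  move: hb; rewrite ler_pdivlMr // mulrC ler_pdivrMr // => hb.
  by rewrite (le_trans hb) // ler_piMl // ltW.
have iF : i \notin F by apply: contra iF0 => /(fintype.subsetP FF0).
have lt1 (u : 'rV[R]_k) : 0 <= u 0 i <= 1 -> i \notin cube_inf u -> 0 <= u 0 i < 1.
  move=> /andP[-> u1]; rewrite finset.in_set => un.
  by rewrite lt_neqAle un u1.
apply: le_trans (cube_fin_dist (lt1 _ b01 iF) (lt1 _ b001 iF0)) _.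
have := keyi i; rewrite [in LHS]mxE [in RHS]mxE.
have -> : (L1 *: indic R F) 0 i = 0 by rewrite !mxE (negbTE iF) mulr0.
have -> : beta 0 i = 0 by have /rsupp_subP -> := supp_beta.
have hc u : cube_fin u 0 i = u 0 i / (1 - u 0 i) :> R by rewrite mxE.
rewrite !addr0 hc => ->.
have := mx_norm_entry (fan_coord fanK y - a0) 0 i.
have -> : (fan_coord fanK y - a0) 0 i = fan_coord fanK y 0 i - b0 0 i / (1 - b0 0 i).
  rewrite -hc 2!mxE [(cube_fin b0 + _) _ _]mxE [indic _ _ _ _]mxE (negbTE iF0) addr0.
  by [].
by move=> h1; apply: le_trans h1 ydist.
Qed.

End TropicalToricTopology.

Section CubeToChart.
Variables (R : realType) (n k : nat) (V : 'I_k -> 'rV[int]_n) (K : {set {set 'I_k}}).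
Hypothesis fanK : complete_unimodular_fan R V K.
Local Notation VR := (rays_mx R V).

Lemma near_entry (b0 : 'rV[R]_k) i (e : R) : 0 < e ->
  \forall b \near b0, `|(b : 'rV[R]_k) 0 i - b0 0 i| < e.
Proof.
move=> e0; apply/nbhs_norm_ltP; exists e => // b; apply: le_lt_trans.
by have := mx_norm_entry (b - b0) 0 i; rewrite !mxE.
Qed.

Lemma near_cube_inf (b0 : 'rV[R]_k) : cube K b0 ->
  \forall b \near b0, cube_inf b \subset cube_inf b0.
Proof.
move=> cb0.
have : \forall b \near b0, forall i, i \in cube_inf b -> i \in cube_inf b0.
  apply: (filter_forall (nbhs_filter b0)) => i; have [h|h] := boolP (i \in cube_inf b0).
    by apply: (nearW (nbhs_filter b0)).
  have e0 : 0 < 1 - b0 0 i.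
    rewrite subr_gt0 lt_neqAle; move: h; rewrite finset.in_set => -> /=.
    by have [/(_ i) /andP[]] := cb0.
  apply: (@filterS _ _ (nbhs_filter b0) _ _ _ (near_entry b0 i e0)) => b hb.
  rewrite finset.in_set => /eqP b1.
  by move: hb; rewrite b1 gtr0_norm // ltxx.
by apply: (@filterS _ _ (nbhs_filter b0)) => b hb; apply/fintype.subsetP => i; exact: hb.
Qed.

Lemma cube_fin_continuous (b0 : 'rV[R]_k) i : i \notin cube_inf b0 ->
  {for b0, continuous (fun b : 'rV[R]_k => cube_fin b 0 i)}.
Proof.
move=> h; have {}h : 1 - b0 0 i != 0.
  by move: h; rewrite finset.in_set subr_eq0 eq_sym.
rewrite (_ : (fun b => _) = fun b : 'rV[R]_k => b 0 i * (1 - b 0 i)^-1); last first.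
  by apply/funext => b; rewrite mxE.
apply: continuousM; first exact: coord_continuous.
apply: continuousV => //; apply: continuousB; first exact: cst_continuous.
exact: coord_continuous.
Qed.

(** Infinite coordinates may become finite nearby but not conversely, so all nearby points are read
    in the chart of [b0]. Where the value at [b0] is [-oo], an infinite coordinate with pairing at
    least 1 dominates: the others on [cube_inf b0] contribute with the same sign and the rest is
    bounded. *)
Lemma cube_pt_near (b0 : 'rV[R]_k) m (N : set (\bar R)) : cube K b0 ->
  nbhs ((cube_point V b0).2 m) N ->
  \forall b \near b0, cube K b -> N ((cube_pt V (cube_inf b0) b).2 m).
Proof.
move=> cb0; rewrite /cube_point /cube_pt /=; case: asboolP => [hm|hm hN]; last first.
  by apply: (nearW (nbhs_filter b0)) => b _; exact: nbhs_singleton.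
have sub := near_cube_inf cb0.
have [/existsP [i1 /andP[i1F hi1]]|h] := boolP [exists i in cube_inf b0, zpair m (V i) != 0].
  move=> [M [_ hM]].
  (* The coordinates finite at [b0] lower the pairing to no less than [- (B + M)], so a coordinate
     [i1] beyond [|B| + 1] brings the value below [M]. *)
  pose B := \sum_(i | i \notin cube_inf b0) (1 - cube_fin b0 0 i * (zpair m (V i))%:~R) - M.
  have near1 : \forall b \near b0, forall i, i \notin cube_inf b0 ->
      cube_fin b0 0 i * (zpair m (V i))%:~R - 1 < cube_fin b 0 i * (zpair m (V i))%:~R.
    apply: (filter_forall (nbhs_filter b0)) => i; have [h|h] := boolP (i \in cube_inf b0).
      by apply: (nearW (nbhs_filter b0)).
    have ct : {for b0, continuous (fun b : 'rV[R]_k => cube_fin b 0 i * (zpair m (V i))%:~R)}.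
      by apply: continuousM; [exact: cube_fin_continuous|exact: cst_continuous].
    have /continuous_norm_ltP /(_ 1 ltr01) [e e0 he] := ct.
    apply/nbhs_norm_ltP; exists e => // b /he; rewrite ltr_norml => /andP[hlt _] _.
    by rewrite -subr_lt0; lra.
  have B0 : 0 < `|B| + 1 by rewrite ltr_wpDl.
  have B10 : 0 < (`|B| + 1 + 1)^-1 by rewrite invr_gt0 ltr_wpDl // ltW.
  have near2 := near_entry b0 i1 B10.
  near=> b => cb.
  have bF : cube_inf b \subset cube_inf b0 by near: b.
  have h1 : forall i, i \notin cube_inf b0 ->
      cube_fin b0 0 i * (zpair m (V i))%:~R - 1 < cube_fin b 0 i * (zpair m (V i))%:~R.
    by near: b.
  have h2 : `|b 0 i1 - b0 0 i1| < (`|B| + 1 + 1)^-1 by near: b.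
  have [_|nb] := boolP [exists i in cube_inf b, zpair m (V i) != 0].
    by apply: hM; rewrite ltNyr.
  apply: hM; rewrite lte_fin ltrNl.
  have b0i : b0 0 i1 = 1 by move: i1F; rewrite finset.in_set => /eqP.
  have i1b : i1 \notin cube_inf b.
    by move: nb => /existsPn /(_ i1); rewrite hi1 andbT.
  have [/(_ i1) /andP[b00 b01] _] := cb.
  have b1 : b 0 i1 < 1 by rewrite lt_neqAle b01 andbT; move: i1b; rewrite finset.in_set.
  have big : `|B| + 1 < cube_fin b 0 i1.
    have d0 : 0 < 1 - b 0 i1 by rewrite subr_gt0.
    move: h2; rewrite b0i distrC (gtr0_norm d0) => h2.
    have B2 : 0 < `|B| + 1 + 1 by rewrite ltr_wpDl // ltW.
    have : (1 - b 0 i1) * (`|B| + 1 + 1) < 1 by rewrite -ltr_pdivlMr // mul1r.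
    rewrite mxE ltr_pdivlMr //; lra.
  have zp i : i \in cube_inf b0 -> 0 <= (zpair m (V i))%:~R :> R.
    by move=> iF; rewrite ler0z; exact: hm.
  have z1 : 1 <= (zpair m (V i1))%:~R :> R.
    rewrite (_ : 1 = 1%:~R) // ler_int -gtz0_ge1 lt_neqAle eq_sym hi1.
    exact: hm.
  rewrite Rpair_rays (bigID (fun i => i \in cube_inf b0)) /= (bigD1 i1) //=.
  have t1 : `|B| + 1 <= cube_fin b 0 i1 * (zpair m (V i1))%:~R.
    apply: le_trans (ltW big) _; rewrite ler_peMr //.
    exact: (cube_fin_ge0 i1 cb).
  have t2 : 0 <= \sum_(i | (i \in cube_inf b0) && (i != i1))
      cube_fin b 0 i * (zpair m (V i))%:~R.
    apply: sumr_ge0 => i /andP[iF _]; rewrite mulr_ge0 //; last exact: zp.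
    exact: (cube_fin_ge0 i cb).
  have t3 : - (\sum_(i | i \notin cube_inf b0) (1 - cube_fin b0 0 i * (zpair m (V i))%:~R)) <=
      \sum_(i | i \notin cube_inf b0) cube_fin b 0 i * (zpair m (V i))%:~R.
    rewrite -sumrN; apply: ler_sum => i iF; rewrite opprB ltW //; exact: h1.
  have t4 : B <= `|B| by exact: ler_norm.
  rewrite {1}/B in t4.
  move: t1 t2 t3 t4; set s0 := `|B|; lra.
move=> hN.
have ct : {for b0, continuous (fun b : 'rV[R]_k => - Rpair m (cube_fin b *m VR))}.
  rewrite (_ : (fun b => _) = fun b : 'rV[R]_k =>
     - \sum_i cube_fin b 0 i * (zpair m (V i))%:~R); last first.
    by apply/funext => b; rewrite Rpair_rays.
  apply: continuousN.
  have := @cvg_sum_fin R _ _ (nbhs b0) (index_enum 'I_k)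
    (fun i b => cube_fin b 0 i * (zpair m (V i))%:~R)
    (fun i => cube_fin b0 0 i * (zpair m (V i))%:~R) (nbhs_filter b0).
  apply => i; have [iF|iF] := boolP (i \in cube_inf b0); last first.
    by apply: continuousM; [exact: cube_fin_continuous|exact: cst_continuous].
  move: h => /existsPn /(_ i); rewrite iF /= negbK => /eqP ->.
  by under eq_fun do rewrite mulr0; rewrite mulr0; exact: cvg_cst.
have := ct _ hN.
move=> hnear; near=> b => cb.
have bF : cube_inf b \subset cube_inf b0 by near: b.
rewrite ifF; first by near: b.
apply/negbTE/existsPn => i; have [/(fintype.subsetP bF) iF|//] := boolP (i \in cube_inf b).
by move: h => /existsPn /(_ i); rewrite iF.
Unshelve. all: by end_near. Qed.

Lemma TSopen_cube (W : set (TSpt R n k)) (b0 : 'rV[R]_k) : TSopen V K W -> cube K b0 ->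
  W (cube_point V b0) -> \forall b \near b0, cube K b -> W (cube_point V b).
Proof.
move=> [[_ Wsat] Wop] cb0 Wb0.
set F0 := cube_inf b0.
have F0K : F0 \in K := cube_inf_face fanK cb0.
have hv0 : TSvalid V K (cube_point V b0) := chart_coord_valid (cube_point_coord fanK cb0).
have [ms [N [hN hW]]] := Wop F0 F0K _ hv0 Wb0.
have sub := near_cube_inf cb0.
have near1 : \forall b \near b0, forall m, m \in ms -> cube K b ->
    N m ((cube_pt V F0 b).2 m).
  elim: ms {hW} hN => [_|m ms IH hN]; first by apply: (nearW (nbhs_filter b0)).
  have := cube_pt_near cb0 (hN m (mem_head _ _)).
  have := IH (fun m' h => hN m' (mem_behead (s := m :: ms) h)).
  move=> h1 h2; near=> b => m'.
  have h1b : forall m', m' \in ms -> cube K b -> N m' ((cube_pt V F0 b).2 m') by near: b.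
  have h2b : cube K b -> N m ((cube_pt V F0 b).2 m) by near: b.
  by rewrite inE => /predU1P[->|/h1b].
near=> b => cb.
have bF : cube_inf b \subset F0 by near: b.
have hc : chart_coord V K (cube_pt V F0 b) b by exact: cube_pt_coord.
(* [cube_point V b] lives in its own, possibly smaller, chart; saturation of [W] transports the
   question to the chart of [b0]. *)
apply: (Wsat (cube_pt V F0 b)).
- exact: (chart_coord_point fanK hc).
- exact: chart_coord_valid (cube_point_coord fanK cb).
apply: hW; first exact: (chart_coord_valid hc).
move=> m mms /=; have hm : forall m, m \in ms -> cube K b -> N m ((cube_pt V F0 b).2 m).
  by near: b.
exact: hm.
Unshelve. all: by end_near. Qed.

End CubeToChart.

(** * The homeomorphism with the ball *)

Section StandardPair.
Variables (R : realType) (n k d : nat) (V : 'I_k -> 'rV[int]_n) (K : {set {set 'I_k}}).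
Hypothesis fanK : complete_unimodular_fan R V K.
Local Notation VR := (rays_mx R V).
Local Notation fc := (fan_coord fanK).

Variable psi : 'rV[R]_n -> 'rV[R]_n.
Hypothesis psi_cont : continuous psi.
Hypothesis psiZ : forall t x, 0 <= t -> psi (t *: x) = t *: psi x.
Hypothesis psi_inj : injective psi.
Hypothesis psi_surj : forall w, exists x, psi x = w.

Variable A : set 'rV[R]_n.
Hypothesis A_supp : forall w w', A w -> rsupp (fc w') \subset rsupp (fc w) -> A w'.
Definition flat (x : 'rV[R]_n) : Prop := forall i : 'I_n, (i < n - d)%N -> x 0 i = 0.
Hypothesis A_flat : forall x, A (psi x) <-> flat x.

Definition enorm (x : 'rV[R]_n) : R := Num.sqrt (\sum_i x 0 i ^+ 2).

Lemma enorm_sum_ge0 (x : 'rV[R]_n) : 0 <= \sum_i x 0 i ^+ 2.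
Proof. by apply: sumr_ge0 => i _; rewrite sqr_ge0. Qed.

Lemma enorm_ge0 x : 0 <= enorm x.
Proof. exact: sqrtr_ge0. Qed.

Lemma enormZ t x : 0 <= t -> enorm (t *: x) = t * enorm x.
Proof.
move=> t0; rewrite /enorm; under eq_bigr do rewrite mxE exprMn.
by rewrite -mulr_sumr sqrtrM ?sqr_ge0 // sqrtr_sqr ger0_norm.
Qed.

Lemma enorm0_eq0 x : enorm x = 0 -> x = 0.
Proof.
move=> /eqP; rewrite sqrtr_eq0 => h.
have /eqP : \sum_i x 0 i ^+ 2 = 0 by apply/le_anti; rewrite h enorm_sum_ge0.
rewrite psumr_eq0 => [/allP h0|i _]; last by rewrite sqr_ge0.
apply/rowP => i; rewrite [RHS]mxE; apply/eqP.
by have := h0 i (mem_index_enum _); rewrite /= sqrf_eq0.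
Qed.

Lemma enorm0 : enorm 0 = 0.
Proof. by rewrite -[X in enorm X](scale0r 0) enormZ // mul0r. Qed.

Lemma disk_enorm (x : 'rV[R]_n) : disk x <-> enorm x <= 1.
Proof. by rewrite /disk /enorm /= -{2}(@sqrtr1 R) ler_sqrt. Qed.

Lemma enorm_continuous : continuous enorm.
Proof.
move=> x; apply: (@continuous_comp _ _ _ (fun x : 'rV[R]_n => \sum_i x 0 i ^+ 2) Num.sqrt).
  apply: continuous_sum => i.
  by apply: continuousM_fun; exact: continuous_coord.
exact: sqrt_continuous.
Qed.

Lemma psi0 : psi 0 = 0.
Proof. by rewrite -[X in psi X](scale0r 0) psiZ // scale0r. Qed.

Lemma fc0 : fc 0 = 0.
Proof. by rewrite -[X in fc X](scale0r 0) fan_coordZ // scale0r. Qed.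

Lemma fc_psi_eq0 x : (fc (psi x) == 0) = (x == 0).
Proof.
apply/eqP/eqP => [h|->]; last by rewrite psi0 fc0.
by apply: psi_inj; rewrite psi0 -[LHS](fan_coordK fanK) h mul0mx.
Qed.

(** The factor turns the Euclidean norm of [x] into the maximum norm of the coordinates, so the
    round ball goes onto coordinates bounded by 1. At the origin the quotient is 0 by convention. *)
Definition bmap (x : 'rV[R]_n) : 'rV[R]_k := (enorm x / `|fc (psi x)|) *: fc (psi x).

Lemma bmap_coef_ge0 x : 0 <= enorm x / `|fc (psi x)|.
Proof. by rewrite divr_ge0 // enorm_ge0. Qed.

Lemma bmap0 : bmap 0 = 0.
Proof. by rewrite /bmap enorm0 mul0r scale0r. Qed.

Lemma bmap_norm x : `|bmap x| = enorm x.
Proof.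
have [->|x0] := eqVneq x 0; first by rewrite bmap0 normr0 enorm0.
rewrite /bmap normrZ ger0_norm ?bmap_coef_ge0 // divfK //.
by rewrite normr_eq0 fc_psi_eq0.
Qed.

Lemma bmap_ge0 x i : 0 <= bmap x 0 i.
Proof. by rewrite mxE mulr_ge0 ?bmap_coef_ge0 //; have [] := fan_coordP fanK (psi x). Qed.

Lemma bmap_supp x : rsupp (bmap x) = rsupp (fc (psi x)).
Proof.
apply/setP => i; rewrite !mem_rsupp mxE mulf_eq0 negb_or.
have [->|x0] := eqVneq x 0; first by rewrite psi0 fc0 mxE eqxx andbF.
suff -> : enorm x / `|fc (psi x)| != 0 by [].
rewrite mulf_neq0 ?invr_eq0 ?normr_eq0 ?fc_psi_eq0 //.
by apply: contra x0 => /eqP/enorm0_eq0 ->.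
Qed.

Lemma bmap_cube x : enorm x <= 1 -> cube K (bmap x).
Proof.
move=> x1; split => [i|]; last by rewrite bmap_supp; have [] := fan_coordP fanK (psi x).
rewrite bmap_ge0 /= (le_trans _ x1) // -bmap_norm (le_trans (ler_norm _)) //.
exact: mx_norm_entry.
Qed.

Lemma bmap_inj : injective bmap.
Proof.
move=> x y e; have en : enorm x = enorm y by rewrite -!bmap_norm e.
have [x0|x0] := eqVneq x 0.
  by move: en; rewrite x0 enorm0 => /esym/enorm0_eq0 ->.
have y0 : y != 0.
  by apply: contra x0 => /eqP y0; move: en; rewrite y0 enorm0 => /enorm0_eq0 ->.
have pos z : z != 0 -> 0 < enorm z / `|fc (psi z)|.
  move=> z0; rewrite lt_neqAle bmap_coef_ge0 andbT eq_sym.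
  rewrite mulf_neq0 ?invr_eq0 ?normr_eq0 ?fc_psi_eq0 //.
  by apply: contra z0 => /eqP/enorm0_eq0 ->.
have E : (enorm x / `|fc (psi x)|) *: x = (enorm y / `|fc (psi y)|) *: y.
  apply: psi_inj; rewrite !psiZ ?(ltW (pos _ _)) //.
  rewrite -[psi x](fan_coordK fanK) -[psi y](fan_coordK fanK) !scalemxAl.
  by rewrite !fan_coordK -/(bmap x) -/(bmap y) e.
have px := pos _ x0; have py := pos _ y0; rewrite en in E px.
have := congr1 enorm E; rewrite (enormZ _ (ltW px)) (enormZ _ (ltW py)) en => h.
have en0 : enorm y != 0 by apply: contra y0 => /eqP/enorm0_eq0 ->.
move: E; rewrite (mulIf en0 h) => /(scalerI (lt0r_neq0 py)).
by [].
Qed.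

Lemma bmap_surj b : cube K b -> exists2 x, bmap x = b & enorm x <= 1.
Proof.
move=> [b01 bK].
have fb : fan_point K b by split => // i; have /andP[] := b01 i.
have nb1 : `|b| <= 1.
  by apply: mx_norm_leP => // i j; rewrite ord1; have /andP[h0 h1] := b01 j; rewrite ger0_norm.
have [b0|b0] := eqVneq b 0; first by exists 0; rewrite ?bmap0 ?b0 // enorm0.
have [x0 hx0] := psi_surj (b *m VR).
have fx0 : fc (psi x0) = b by rewrite hx0 fan_coord_uniq.
have x00 : x0 != 0 by rewrite -fc_psi_eq0 fx0.
have e0 : 0 < enorm x0.
  by rewrite lt_neqAle enorm_ge0 andbT eq_sym; apply: contra x00 => /eqP/enorm0_eq0 ->.
have nb0 : 0 < `|b| by rewrite normr_gt0.
have c0 : 0 < `|b| / enorm x0 by rewrite divr_gt0.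
exists ((`|b| / enorm x0) *: x0); last first.
  by rewrite enormZ ?(ltW c0) // divfK ?lt0r_neq0.
rewrite /bmap psiZ ?(ltW c0) // fan_coordZ ?(ltW c0) // fx0 enormZ ?(ltW c0) //.
rewrite normrZ (gtr0_norm c0) scalerA.
rewrite [X in X *: _](_ : _ = 1) ?scale1r //.
by field; rewrite (lt0r_neq0 nb0) (lt0r_neq0 e0).
Qed.

Lemma bmap_continuous : continuous bmap.
Proof.
(* At the origin the quotient gives no information; continuity comes from the equality of the norms
   of [bmap x] and [x]. *)
move=> x; have [->|x0] := eqVneq x 0.
  apply/continuous_norm_ltP => e e0.
  have /continuous_norm_ltP /(_ e e0) [e' e'0 h] := @enorm_continuous 0.
  exists e' => // y /h; rewrite bmap0 subr0 enorm0 subr0 bmap_norm ger0_norm //.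
  exact: enorm_ge0.
have cf : {for x, continuous (fun x => fc (psi x))}.
  by apply: continuous_comp; [exact: psi_cont|exact: fan_coord_continuous].
have c1 : {for x, continuous (fun x => enorm x / `|fc (psi x)|)}.
  apply: continuousM; first exact: enorm_continuous.
  apply: continuousV; first by rewrite normr_eq0 fc_psi_eq0.
  by apply: (continuous_comp cf); exact: norm_continuous.
exact: continuousZ c1 cf.
Qed.

Definition ball_chart (x : 'rV[R]_n) : TSpt R n k := cube_point V (bmap x).

Lemma ball_chart_coord x : disk x -> chart_coord V K (ball_chart x) (bmap x).
Proof. by move=> /disk_enorm x1; apply: (cube_point_coord fanK); exact: bmap_cube. Qed.

Lemma ball_chart_valid x : disk x -> TSvalid V K (ball_chart x).
Proof. by move=> /ball_chart_coord; exact: chart_coord_valid. Qed.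

Lemma ball_chart_inj x y : disk x -> disk y ->
  TSequiv V K (ball_chart x) (ball_chart y) -> x = y.
Proof.
move=> /disk_enorm x1 /disk_enorm y1 /(cube_point_equiv fanK (bmap_cube x1) (bmap_cube y1)).
exact: bmap_inj.
Qed.

Lemma ball_chart_surj a b : chart_coord V K a b ->
  exists x, [/\ disk x, bmap x = b & TSequiv V K a (ball_chart x)].
Proof.
move=> hb; have [cb _ _ _] := hb; have [x xb x1] := bmap_surj cb.
exists x; split => //; first exact/disk_enorm.
by rewrite /ball_chart xb; exact: (chart_coord_point fanK hb).
Qed.

Lemma disk_open_eps (U : set 'rV[R]_n) : U `<=` disk (R := R) (n := n) ->
  (forall x, U x -> exists2 e : R, 0 < e & forall y, `|y - x| < e -> disk y -> U y) ->
  disk_open U.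
Proof.
move=> Ud hU.
exists [set x | exists2 e : R, 0 < e & forall y, `|y - x| < e -> disk y -> U y]; split.
  rewrite openE => x [e e0 he]; apply/nbhs_norm_ltP; exists (e / 2).
    by rewrite divr_gt0.
  move=> y yx; exists (e / 2); first by rewrite divr_gt0.
  move=> z zy; apply: he; rewrite -(subrK y z) -addrA (le_lt_trans (ler_normD _ _)) //.
  by rewrite (splitr e) ltrD.
rewrite predeqE => x; split => [Ux|[[e e0 he] dx]]; first by split; [exact: hU|exact: Ud].
by apply: he; rewrite ?subrr ?normr0.
Qed.

Lemma disk_open_epsP (U : set 'rV[R]_n) x : disk_open U -> U x ->
  exists2 e : R, 0 < e & forall y, `|y - x| < e -> disk y -> U y.
Proof.
move=> [ O [Oop ->]] [Ox _].
have /nbhs_norm_ltP [e e0 he] : nbhs x O by exact: open_nbhs_nbhs.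
by exists e => // y hy dy; split => //; exact: he.
Qed.

Lemma ball_chart_preimage_open W : TSopen V K W ->
  disk_open [set x | disk x /\ W (ball_chart x)].
Proof.
move=> Wop; apply: disk_open_eps => [x []//|x [dx Wx]].
have cb := bmap_cube (proj1 (disk_enorm x) dx).
have /nbhs_norm_ltP [e e0 he] := TSopen_cube fanK Wop cb Wx.
have /continuous_norm_ltP /(_ e e0) [e' e'0 he'] := @bmap_continuous x.
exists e' => // y /he' yx dy; split => //; apply: he => //.
exact/bmap_cube/disk_enorm.
Qed.

Lemma disk_bounded (x : 'rV[R]_n) : disk x -> `|x| <= 1.
Proof.
move=> dx; apply: mx_norm_leP => // i j; rewrite ord1.
rewrite -(@ler_pXn2r _ 2) ?nnegrE // expr1n -normrX ger0_norm ?sqr_ge0 //.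
apply: le_trans dx; rewrite (bigD1 j) //= lerDl; apply: sumr_ge0 => l _.
exact: sqr_ge0.
Qed.

Lemma disk_closed : closed (disk (R := R) (n := n)).
Proof.
apply: closed_le_fun; last exact: cst_continuous.
by apply: continuous_sum => i; apply: continuousM_fun; exact: continuous_coord.
Qed.

(* The disk is compact, so the inverse of bmap is continuous. *)
Lemma bmap_separated (U : set 'rV[R]_n) x0 : disk_open U -> U x0 ->
  exists2 e : R, 0 < e & forall x, disk x -> `|bmap x - bmap x0| <= e -> U x.
Proof.
move=> Uop Ux0.
have [ O [Oop UE]] := Uop.
have [h|/existsNP [x1 /not_implyP [dx1 nU1]]] := pselect (forall x, disk x -> U x); last first.
  have [x [dx nOx] hmin] : exists2 x, (disk (R := R) (n := n) `&` ~` O) x &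
      forall y, (disk (R := R) (n := n) `&` ~` O) y -> `|bmap x - bmap x0| <= `|bmap y - bmap x0|.
    apply: (@continuous_min_on _ _ _ 1 (fun x => `|bmap x - bmap x0|)).
    - by exists x1; split => // Ox1; apply: nU1; rewrite UE.
    - by apply: closedI; [exact: disk_closed|exact: open_closedC].
    - by move=> y [/disk_bounded].
    - move=> x; apply: (@continuous_comp _ _ _ (fun x => bmap x - bmap x0) (fun y => `|y|)).
        by apply: continuousB; [exact: bmap_continuous|exact: cst_continuous].
      exact: norm_continuous.
  have pos : 0 < `|bmap x - bmap x0|.
    rewrite normr_gt0 subr_eq0; apply/eqP => /bmap_inj xx0; apply: nOx.
    by move: Ux0; rewrite xx0 UE => -[].
  exists (`|bmap x - bmap x0| / 2); first by rewrite divr_gt0.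
  move=> y dy hy; rewrite UE; split => //; apply: contrapT => nOy.
  have := le_trans (hmin y (conj dy nOy)) hy; rewrite leNgt => /negP; apply.
  by rewrite ltr_pdivrMr //; lra.
by exists 1 => // x dx _; exact: h.
Qed.

Lemma ball_chart_image_open U : disk_open U ->
  TSopen V K (fun a => TSvalid V K a /\ exists x, U x /\ TSequiv V K a (ball_chart x)).
Proof.
move=> Uop; have Ud x : U x -> disk x by case: Uop => O [_ ->] [].
split; first split.
- by move=> a [].
- move=> a b ab bv [_ [x [Ux ax]]]; split => //; exists x; split => //.
  exact: rst_trans (rst_sym _ _ _ _ ab) ax.
move=> S SK phi0 hv0 [_ [x0 [Ux0 ax0]]].
have hb0 : chart_coord V K (S, phi0) (bmap x0).
  by apply/(chart_coord_equiv fanK (bmap x0) ax0); apply: ball_chart_coord; exact: Ud.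
have [e e0 he] := bmap_separated Uop Ux0.
have [ms [N [hN hms]]] := chart_coord_near fanK hb0 e0.
exists ms, N; split => // phi hv hphi; split => //.
have [b hb] := chart_coord_exists fanK hv.
have [x [dx xb ax]] := ball_chart_surj hb.
exists x; split => //; apply: he => //; rewrite xb.
exact: (hms phi b hb hphi).
Qed.

Lemma TSembed_tpoint (w : 'rV[R]_n) : TSembed k w = tpoint V finset.set0 finset.set0 w.
Proof.
congr (_, _); apply/funext => m; rewrite asboolT; last by move=> i; rewrite finset.in_set0.
rewrite ifF //; apply/negbTE/existsPn => i.
by rewrite finset.in_set0.
Qed.

Lemma cube_point_TSembed b : cube K b -> (forall i, b 0 i < 1) ->
  cube_point V b = TSembed k (cube_fin b *m VR) /\ fc (cube_fin b *m VR) = cube_fin b.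
Proof.
move=> cb b1; split.
  rewrite TSembed_tpoint /cube_point /cube_pt; have -> // : cube_inf b = finset.set0.
  by apply/setP => i; rewrite finset.in_set finset.in_set0 lt_eqF.
apply: fan_coord_uniq; split => [i|]; first exact: (cube_fin_ge0 i cb).
have [_ bK] := cb; exact: (fan_face fanK bK (cube_fin_supp b)).
Qed.

Lemma TSembed_coord (w : 'rV[R]_n) : exists b, [/\ chart_coord V K (TSembed k w) b,
  rsupp b = rsupp (fc w) & forall i, b 0 i < 1].
Proof.
have [a0 aK] := fan_coordP fanK w; set a := fc w in a0 aK.
have pos i : 0 < 1 + a 0 i by rewrite ltr_pwDl.
have [b bE] : exists b : 'rV[R]_k, b = \row_i (a 0 i / (1 + a 0 i)) by eexists.
have b1 i : b 0 i < 1 by rewrite bE mxE ltr_pdivrMr // mul1r; lra.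
have sb : rsupp b = rsupp a.
  by apply/setP => i; rewrite !mem_rsupp bE mxE mulf_eq0 invr_eq0 negb_or (lt0r_neq0 (pos i)) andbT.
have cb : cube K b.
  split => [i|]; last by rewrite sb.
  by rewrite (ltW (b1 i)) andbT bE mxE divr_ge0 // ltW.
have fb : cube_fin b = a.
  apply/rowP => i; rewrite mxE bE mxE; have := lt0r_neq0 (pos i) => h.
  have -> : 1 - a 0 i / (1 + a 0 i) = (1 + a 0 i)^-1.
    by rewrite -{1}(mulfV h) -mulrBl addrK mul1r.
  by rewrite invrK divfK.
exists b; split => //.
have [e _] := cube_point_TSembed cb b1.
rewrite fb /a fan_coordK in e; rewrite -e.
exact: (cube_point_coord fanK cb).
Qed.

Lemma flat_closed : closed [set x | flat x].
Proof.
apply: closed_forall => i; apply: closed_forall => _.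
by apply: closed_eq_fun; [exact: continuous_coord|exact: cst_continuous].
Qed.

Let embA : set (TSpt R n k) := fun a => exists2 w, A w & a = TSembed k w.

(** A flat [x] is the limit of [t *: x] with [t < 1]. These have all cubical coordinates below 1,
    hence lie in the dense orbit, and since [cube_fin] does not enlarge supports, [A_supp] places
    them in [A]. *)
Lemma flat_in_closure x : disk x -> flat x -> TSclosure V K embA (ball_chart x).
Proof.
move=> dx fx; split; first exact: ball_chart_valid.
move=> F [Fsat Fop] AF; apply: contrapT => nF.
have Gop := ball_chart_preimage_open Fop.
have [|e e0 he] := disk_open_epsP (x := x) Gop.
  by split => //; split => //; exact: ball_chart_valid.
(* The minimum keeps [t] in [[0, 1)] while [(1 - t) * |x| < e]. *)
pose t := 1 - Num.min 1 (e / (2 * (`|x| + 1))).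
have den : 0 < 2 * (`|x| + 1) by rewrite mulr_gt0 // ltr_wpDl.
have s0 : 0 < Num.min 1 (e / (2 * (`|x| + 1))) by rewrite lt_min ltr01 divr_gt0.
have t1 : t < 1 by rewrite /t gtrBl.
have t0 : 0 <= t by rewrite /t subr_ge0 ge_min lexx.
have x1 := proj1 (disk_enorm x) dx.
have etx : enorm (t *: x) < 1 by rewrite enormZ // (le_lt_trans _ t1) // ler_piMr.
have dtx : disk (t *: x) by apply/disk_enorm/ltW.
have close : `|t *: x - x| < e.
  rewrite -{2}[x]scale1r -scalerBl normrZ /t addrAC subrr add0r normrN gtr0_norm //.
  have : Num.min 1 (e / (2 * (`|x| + 1))) <= e / (2 * (`|x| + 1)) by rewrite ge_min lexx orbT.
  rewrite ler_pdivlMr //; move: s0; set s := Num.min _ _; have : 0 <= `|x| by [].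
  set N := `|x|; nra.
have [_ [_ nFt]] := he _ close dtx; apply: nFt; apply: AF.
have b1 i : bmap (t *: x) 0 i < 1.
  apply: le_lt_trans etx; rewrite -bmap_norm; apply: le_trans (ler_norm _) _.
  exact: mx_norm_entry.
have [e1 e2] := cube_point_TSembed (bmap_cube (ltW etx)) b1.
exists (cube_fin (bmap (t *: x)) *m VR) => //.
apply: (@A_supp (psi (t *: x))); first by apply/A_flat => i hi; rewrite mxE fx // mulr0.
by rewrite e2 -bmap_supp cube_fin_supp.
Qed.

(** The image of the flat part of the disk is closed, its complement being the image of a relatively
    open set. It contains [embA] because the cubical coordinates of a vector have the support of its
    fan coordinates. *)
Lemma closure_flat x : disk x -> TSclosure V K embA (ball_chart x) -> flat x.
Proof.
move=> dx [_ hcl].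
pose F : set (TSpt R n k) := fun a => TSvalid V K a /\
  exists y, (disk y /\ flat y) /\ TSequiv V K a (ball_chart y).
have Uop : disk_open [set y : 'rV[R]_n | disk y /\ ~ flat y].
  exists (~` [set x | flat x]); split; first by apply: closed_openC; exact: flat_closed.
  by rewrite predeqE => y; split => -[].
have Fcl : TSclosed V K F.
  split.
    split; first by move=> a [].
    move=> a b ab bv [_ [y [dy ay]]]; split => //; exists y; split => //.
    exact: rst_trans (rst_sym _ _ _ _ ab) ay.
  have := ball_chart_image_open Uop.
  congr TSopen; apply/funext => a; apply/propext; split.
    move=> [av [y [[dy ny] ay]]]; split => // -[_ [z [[dz fz] az]]]; apply: ny.
    suff -> : y = z by [].
    apply: ball_chart_inj => //; exact: rst_trans (rst_sym _ _ _ _ ay) az.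
  move=> [av nF]; split => //; have [b hb] := chart_coord_exists fanK av.
  have [y [dy yb ay]] := ball_chart_surj hb.
  exists y; split => //; split => // fy; apply: nF; split => //.
  by exists y.
have [] := hcl F Fcl; last first.
  by move=> _ [y [[dy fy] xy]]; rewrite (ball_chart_inj dx dy xy).
move=> a [w Aw ->]; have [b [hb sb b1]] := TSembed_coord w.
split; first exact: chart_coord_valid hb.
have [y [dy yb ay]] := ball_chart_surj hb.
exists y; split => //; split => //; apply/A_flat; apply: (A_supp Aw).
by rewrite -bmap_supp yb sb.
Qed.

Theorem standard_pair_of_section : standard_pair_TS V K (TSclosure V K embA) d.
Proof.
exists ball_chart; split; first exact: ball_chart_valid.
split; first exact: ball_chart_inj.
split.
  move=> a /(chart_coord_exists fanK) [b /ball_chart_surj [x [dx _ ax]]].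
  by exists x.
split; first exact: ball_chart_preimage_open.
split; first exact: ball_chart_image_open.
rewrite predeqE => x; split => -[dx h]; split => //.
  exact: closure_flat.
exact: flat_in_closure.
Qed.

End StandardPair.

(** * Linear straightening and the shear *)

Lemma submx_pid_mx (F : fieldType) n d (x : 'rV[F]_n) :
  (x <= (pid_mx d : 'M[F]_(d, n)))%MS <-> forall j : 'I_n, (d <= j)%N -> x 0 j = 0.
Proof.
split=> [/submxP [y ->] j dj|h].
  rewrite mxE big1 // => l _; rewrite mxE; case: eqP => [e|]; last by rewrite mulr0.
  by have := ltn_ord l; rewrite e ltnNge dj.
suff -> : x = x *m (pid_mx d : 'M[F]_(n, d)) *m (pid_mx d : 'M[F]_(d, n)) by rewrite submxMl.
rewrite -mulmxA mul_pid_mx !minnn; apply/rowP => j; rewrite mxE (bigD1 j) //= big1 ?addr0.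
  rewrite mxE eqxx /=; have [jd|dj] := ltnP j d; first by rewrite mulr1.
  by rewrite mulr0 h.
by move=> l lj; rewrite mxE; case: eqP => [/val_inj e|]; rewrite ?mulr0 // e eqxx in lj *.
Qed.

(** A standard pair asks for the first [n - d] coordinates to vanish, whereas on the row space of
    [pid_mx] the last ones do; hence the reversal of coordinates. *)
Lemma flat_basis (F : fieldType) n d (A : 'M[F]_(d, n)) : row_free A ->
  exists2 M, M \in unitmx & forall x : 'rV[F]_n,
    (x *m M <= A)%MS <-> forall i : 'I_n, (i < n - d)%N -> x 0 i = 0.
Proof.
move=> freeA; pose s := perm (@rev_ord_inj n).
exists (perm_mx s *m row_ebase A); first by rewrite unitmx_mul unitmx_perm row_ebase_unit.
move=> x; rewrite mulmxA.
have -> : (x *m perm_mx s *m row_ebase A <= A)%MS =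
    (x *m perm_mx s <= (pid_mx d : 'M[F]_(d, n)))%MS.
  have EA : (A :=: (pid_mx d : 'M[F]_(d, n)) *m row_ebase A)%MS.
    rewrite -{1}[A]mulmx_ebase (eqP freeA) -mulmxA; apply: eqmxMfull.
    by rewrite row_full_unit col_ebase_unit.
  by rewrite EA submxMfree // row_free_unit row_ebase_unit.
have E j : (x *m perm_mx s) 0 j = x 0 (rev_ord j).
  rewrite -[s]invgK -col_permE mxE; congr (x 0 _).
  by apply: (@perm_inj _ s); rewrite permKV permE rev_ordK.
rewrite submx_pid_mx; split => h i hi.
  have := h (rev_ord i); rewrite E rev_ordK; apply.
  by rewrite /=; lia.
by rewrite E; apply: h; have := ltn_ord i; rewrite /=; lia.
Qed.

Section Shear.
Variables (R : realType) (n d : nat) (U : 'M[R]_(d, n)) (s : 'rV[R]_d -> 'rV[R]_n).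
Hypothesis freeU : row_free U.
Hypothesis sK : forall eta, s eta *m U^T = eta.
Hypothesis sZ : forall t eta, 0 <= t -> s (t *: eta) = t *: s eta.
Hypothesis s_cont : continuous s.

(* The image of s is the graph of a map over a linear complement of the kernel of U^T,
   hence is straightened by a shear. *)
Lemma shear_exists : exists psi : 'rV[R]_n -> 'rV[R]_n,
  [/\ continuous psi, forall t x, 0 <= t -> psi (t *: x) = t *: psi x,
      injective psi, forall w, exists x, psi x = w &
      forall x, psi x = s (psi x *m U^T) <-> flat d x].
Proof.
have [B UB] := row_freeP freeU.
have BU : B^T *m U^T = 1%:M by rewrite -trmx_mul UB trmx1.
have freeB : row_free B^T by apply/row_freeP; exists U^T.
have [M Mu flatM] := flat_basis freeB.
(* [y *m U^T *m B^T] is the projection of [y] to the row space of [B^T] along the kernel of [U^T];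
   [sh] replaces this component by the value of [s]. *)
pose sh (y : 'rV[R]_n) := s (y *m U^T) + (y - y *m U^T *m B^T).
have shU y : sh y *m U^T = y *m U^T.
  by rewrite mulmxDl sK mulmxBl -[X in _ - X]mulmxA BU mulmx1 subrr addr0.
exists (fun x => sh (x *m M)); split.
- move=> x; apply: (@continuous_comp _ _ _ (fun x : 'rV[R]_n => x *m M) sh).
    exact: mulmx_continuous.
  move: (x *m M) => y; apply: continuousD.
    apply: (@continuous_comp _ _ _ (fun y : 'rV[R]_n => y *m U^T) s).
      exact: mulmx_continuous.
    exact: s_cont.
  apply: continuousB; first exact: cvg_id.
  rewrite (_ : (fun y => _) = fun y : 'rV[R]_n => y *m (U^T *m B^T)); last first.
    by apply/funext => z; rewrite mulmxA.
  exact: mulmx_continuous.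
- by move=> t x t0; rewrite /sh -!scalemxAl sZ // -scalerBr -scalerDr.
- move=> x y e; have eU := congr1 (fun z => z *m U^T) e; rewrite /= !shU in eU.
  move: e; rewrite /sh eU => /addrI /addIr e.
  by rewrite -[x](mulmxK Mu) e mulmxK.
- move=> w; exists ((w - s (w *m U^T) + w *m U^T *m B^T) *m invmx M).
  rewrite mulmxKV // /sh.
  have -> : (w - s (w *m U^T) + w *m U^T *m B^T) *m U^T = w *m U^T.
    by rewrite mulmxDl mulmxBl sK subrr add0r -mulmxA BU mulmx1.
  by rewrite addrK addrC subrK.
- move=> x; rewrite shU /flat -flatM /sh; split => [/eqP|/submxP [z ->]].
    by rewrite -subr_eq0 addrAC subrr add0r subr_eq0 => /eqP ->; rewrite submxMl.
  by rewrite -[z *m B^T *m U^T]mulmxA BU mulmx1 subrr addr0.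
Qed.

End Shear.

(** * Real equations from invariance under conjugation *)

Section RealForm.
Variables (R : realType) (n d : nat) (p : 'rV[complex R]_n) (B : 'M[complex R]_(d, n)).
Local Notation C := (complex R).
Local Notation toC := (map_mx (real_complex R)).
Local Notation conjM := (map_mx (@conjc R)).
Hypothesis freeB : row_free B.
Hypothesis realL : is_real_subvariety (Lset p B).

Lemma LsetP z : Lset p B z <-> (forall i, z 0 i != 0) /\ (z - p <= B)%MS.
Proof.
(* In Lset the equation z = p + y *m B is an equality of coefficient functions. *)
split=> -[z0].
  move=> [y e]; split => //; have -> : z = p + y *m B by apply/matrixP => i j; rewrite e.
  by rewrite addrAC subrr add0r submxMl.
by move=> /submxP [y e]; split => //; exists y; rewrite -e addrC subrK.
Qed.

(** Lets any direction of the affine space be realised as a real multiple of a difference of two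
    points of the torus. *)
Lemma small_multiple_nonvanishing (z v : 'rV[C]_n) : (forall i, z 0 i != 0) ->
  exists2 t : R, t != 0 & forall i, (z + real_complex R t *: v) 0 i != 0.
Proof.
move=> z0; pose N (x : C) := `|complex.Re x| + `|complex.Im x|.
have N0 x : x != 0 -> 0 < N x.
  rewrite eq_complex negb_and /= => /orP[h|h]; first by rewrite ltr_pwDl // normr_gt0.
  by rewrite ltr_wpDl // normr_gt0.
have Nge0 x : 0 <= N x by rewrite addr_ge0.
have [g g0 hg] : exists2 g : R, 0 < g & forall i : 'I_n, predT i -> g <= N (z 0 i).
  by apply: fin_pos_lower_bound => i _; exact: N0.
pose W := \sum_i N (v 0 i) + 1.
have W0 : 0 < W by rewrite ltr_wpDl // sumr_ge0.
have [q qE] : exists q, q = g / W / 2 by eexists.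
have q0 : 0 < q by rewrite qE !divr_gt0.
exists q; first by rewrite lt0r_neq0.
move=> i; rewrite !mxE; apply/eqP => /eqP; rewrite addr_eq0 => /eqP e.
have : N (z 0 i) = q * N (v 0 i).
  rewrite e /N; case: (v 0 i) => a b /=.
  by rewrite !mul0r subr0 addr0 !normrN !normrM (gtr0_norm q0) mulrDr.
have vW : N (v 0 i) <= W.
  by rewrite /W (bigD1 i) //= -addrA lerDl addr_ge0 // sumr_ge0.
have := hg i isT.
have h1 : q * N (v 0 i) <= q * W by rewrite ler_wpM2l // ltW.
have h2 : q * W = g / 2 by rewrite qE mulrAC divfK ?lt0r_neq0.
lra.
Qed.

(** Invariance is given only at points of the torus; small real multiples carry it over to the
    direction space. The real and imaginary parts of a basis then span a real space whose
    complexification is the direction, hence of rank [d]. *)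
Lemma real_form : Lset p B !=set0 -> exists (p' : 'rV[R]_n) (U : 'M[R]_(d, n)),
  [/\ row_free U,
      forall z, Lset p B z -> exists y : 'rV[C]_d, z = toC p' + y *m toC U &
      forall x, in_affine p' U x -> (forall i, 0 < x 0 i) -> Lset p B (toC x)].
Proof.
move=> [z0 Lz0]; have /LsetP [z00 z0p] := Lz0.
have /LsetP [_ cz0p] := realL Lz0.
have diff (u v : 'rV[C]_n) : (u - p <= B)%MS -> (v - p <= B)%MS -> (u - v <= B)%MS.
  by move=> hu hv; rewrite -[u](subrK p) -addrA -[p - v]opprB addmx_sub // eqmx_opp.
have conj_sub (v : 'rV[C]_n) : (v <= B)%MS -> (conjM v <= B)%MS.
  move=> vB; have [t t0 ht] := small_multiple_nonvanishing v z00.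
  have Lz : Lset p B (z0 + real_complex R t *: v).
    by apply/LsetP; split => //; rewrite addrAC addmx_sub // scalemx_sub.
  have /LsetP [_ h] := realL Lz; have := diff _ _ h cz0p.
  rewrite map_mxD addrAC subrr add0r map_mxZ /=.
  have tC : Complex t (- 0) != 0 :> C by rewrite eq_complex negb_and t0.
  by rewrite (eqmx_scale _ tC).
have conjB : (conjM B <= B)%MS.
  by apply/row_subP => i; rewrite -map_row; apply: conj_sub; exact: row_sub.
pose iC : C := Complex 0 1.
pose ReM m (A : 'M[C]_(m, n)) : 'M[R]_(m, n) := map_mx (@complex.Re R) A.
pose ImM m (A : 'M[C]_(m, n)) : 'M[R]_(m, n) := map_mx (@complex.Im R) A.
have twoC : (2%:R : C) != 0 by rewrite pnatr_eq0.
have iC0 : iC != 0 by rewrite eq_complex /= oner_eq0 andbF.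
have ReE m (A : 'M[C]_(m, n)) : 2%:R *: toC (ReM m A) = A + conjM A.
  apply/matrixP => i j; rewrite !mxE; case: (A i j) => a b.
  by apply/eqP; rewrite mulr_natl mulr2n eq_complex /= addr0 subrr !eqxx.
have ImE m (A : 'M[C]_(m, n)) : (2%:R * iC) *: toC (ImM m A) = A - conjM A.
  apply/matrixP => i j; rewrite !mxE; case: (A i j) => a b.
  apply/eqP; rewrite -mulrA mulr_natl mulr2n eq_complex /=.
  by apply/andP; split; apply/eqP; ring.
have sumE m (A : 'M[C]_(m, n)) : A = toC (ReM m A) + iC *: toC (ImM m A).
  apply/matrixP => i j; rewrite !mxE; case: (A i j) => a b.
  by apply/eqP; rewrite eq_complex /=; apply/andP; split; apply/eqP; ring.
pose G := col_mx (ReM d B) (ImM d B).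
have GB : (toC G :=: B)%MS.
  apply/eqmxP/andP; split.
    rewrite map_col_mx col_mx_sub; apply/andP; split.
      rewrite -(eqmx_scale _ twoC) ReE addmx_sub //.
    rewrite -(eqmx_scale _ (mulf_neq0 twoC iC0)) ImE addmx_sub // eqmx_opp //.
  rewrite [X in (X <= _)%MS]sumE map_col_mx addmx_sub //.
    by rewrite -addsmxE addsmxSl.
  by rewrite scalemx_sub // -addsmxE addsmxSr.
have rkG : \rank G = d by rewrite -(mxrank_map (real_complex R)) GB; exact/eqP.
have : exists2 U : 'M[R]_(\rank G, n), row_free U & (U :=: G)%MS.
  by exists (row_base G); [exact: row_base_free|exact: eq_row_base].
rewrite rkG => -[U freeU UG].
have UB : (toC U :=: B)%MS.
  by apply: eqmx_trans GB; apply/map_eqmx.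
(* The midpoint of [z0] and its conjugate. It may leave the torus but stays in the affine space,
   which is all that a base point must do. *)
pose p' := ReM 1%N z0.
have p'p : (toC p' - p <= B)%MS.
  rewrite -(eqmx_scale _ twoC) scalerBr ReE.
  have -> : z0 + conjM z0 - 2%:R *: p = (z0 - p) + (conjM z0 - p).
    by rewrite scaler_nat mulr2n opprD addrACA.
  exact: addmx_sub.
exists p', U; split => //.
  move=> z /LsetP [_ zp]; have := diff _ _ zp p'p; rewrite -UB => /submxP [y e].
  by exists y; rewrite -e addrC subrK.
move=> x xA x0; apply/LsetP; split.
  by move=> i; rewrite mxE real_complex_neq0 lt0r_neq0.
rewrite -(subrK (toC p') (toC x)) -addrA addmx_sub //.
by rewrite -map_mxB -UB map_submx.
Qed.

End RealForm.

Lemma Rpos_supp (R : realType) n d k (V : 'I_k -> 'rV[int]_n) (K : {set {set 'I_k}})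
    (fanK : complete_unimodular_fan R V K) (X : set 'rV[complex R]_n) (w w' : 'rV[R]_n) :
  Rpos V K X d w -> rsupp (fan_coord fanK w') \subset rsupp (fan_coord fanK w) ->
  Rpos V K X d w'.
Proof.
move=> [S SK [Sd SX Sp /(cone_fan_coord fanK _ SK) Sw]] h; exists S => //; split => //.
by apply/(cone_fan_coord fanK _ SK); exact: fintype.subset_trans h Sw.
Qed.

Theorem mainTheorem10 (R : realType) (n d : nat)
    (p : 'rV[complex R]_n) (B : 'M[complex R]_(d, n))
    (k : nat) (V : 'I_k -> 'rV[int]_n) (K : {set {set 'I_k}}) :
  row_free B ->
  Lset p B !=set0 ->
  is_real_subvariety (Lset p B) ->
  Rpos V K (Lset p B) d !=set0 ->
  complete_unimodular_fan R V K ->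
  (forall w, Trop (Lset p B) w ->
     exists2 S, S \in K & cone V S `<=` Trop (Lset p B) /\ cone V S w) ->
  standard_pair_TS V K
    (TSclosure V K (fun a => exists2 w, Rpos V K (Lset p B) d w & a = TSembed k w))
    d.
Proof.
move=> freeB L0 realL [w0 Rw0] fanK tropL.
have [p' [U [freeU LsubC posL]]] := real_form freeB realL L0.
(* Nonemptiness of the positive part enters here: its point lifts to a positive point of the affine
   space, the input of Birch's theorem. *)
have [x0 affx0 posx0] := pos_trop_affine_point (Rpos_pos_trop LsubC Rw0).
have Req := Rpos_eq_pos_trop fanK freeU LsubC posL tropL affx0 posx0.
have [psi [pc pZ pinj psurj pflat]] := shear_exists freeU
  (pos_sectionK freeU affx0 posx0) (pos_sectionZ freeU affx0 posx0)
  (@pos_section_continuous _ _ _ _ _ freeU _ affx0 posx0).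
apply: (standard_pair_of_section (fanK := fanK) pc pZ pinj psurj).
  by move=> w w'; exact: Rpos_supp.
move=> x; rewrite -pflat Req; split => [|->]; first exact: pos_section_uniq.
exact: pos_sectionP.
Qed.
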